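(* Let $N\ge2$ and $p_{N+1}\le p<2$, where $p_{N+1}:=1+\frac2{N+1}$. Set $$h(x'):=\begin{cases}|x'|^{2-\frac2{p-1}}\chi_{B'(0,1)}(x')&\text{if }p>p_{N+1},\\[3pt]|x'|^{-N+1}\big|\log|x'|\big|^{-\frac{N+1}2-1}\chi_{B'(0,1/2)}(x')&\text{if }p=p_{N+1},\end{cases}$$ for $x'\in\mathbb R^{N-1}$. Consider problem (P) with $\mu=\kappa h(x')\otimes\delta_1(x_N)$, where $\kappa>0$. Then there exists $\kappa_0>0$ with the following properties: (i) problem (P) possesses a local-in-time solution if $0<\kappa<\kappa_0$; (ii) problem (P) possesses no local-in-time solutions if $\kappa>\kappa_0$.
   Context: $\Omega:=\mathbb R^{N-1}\times(0,\infty)$; points are written $x=(x',x_N)$; $\partial\Omega$ is identified with $\mathbb R^{N-1}$. $B'(x',r)$ is the open ball in $\mathbb R^{N-1}$ and $\chi_E$ is the characteristic function of $E$. $Q_T:=\Omega\times(0,T)$. $\mathcal L(Q_T)$ is the set of nonnegative, measurable, almost everywhere finite functions on $Q_T$. $\delta_1$ is the Dirac measure at $0$ in the variable $x_N$, and $h(x')\otimes\delta_1(x_N)$ is the measure carried by $\partial\Omega$ with density $h$ with respect to $dx'$. Kernels: $\Gamma_d(x,t):=(4\pi t)^{-d/2}\exp(-|x|^2/(4t))$ on $\mathbb R^d\times(0,\infty)$. The Dirichlet heat kernel of $\Omega$ is $$G(x,y,t):=\Gamma_N(x-y,t)\left(1-\exp\left(-\frac{x_Ny_N}{t}\right)\right),\qquad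 x,y\in\overline\Omega,\ t>0,$$ and, for $x,y\in\overline\Omega$, $t>0$, $K(x,y,t):=y_N^{-1}G(x,y,t)$ if $y_N>0$ and $K(x,y,t):=(\partial_{y_N}G)(x,y,t)=\frac{x_N}{t}\Gamma_N(x-y,t)$ if $y_N=0$. Problem (P), for a nonnegative Radon measure $\mu$ on $\overline\Omega$, is $\partial_tu=\Delta u+u^p$ in $\Omega$, $t>0$, with $u=0$ on $\partial\Omega$ and $x_Nu(x,0)=\mu$ on $\overline\Omega$. A function $u\in\mathcal L(Q_T)$ is a solution to (P) in $Q_T$ if $$u(x,t)=\int_{\overline\Omega}K(x,y,t)\,d\mu(y)+\int_0^t\int_\Omega G(x,y,t-s)u(y,s)^p\,dy\,ds$$ for almost all $(x,t)\in Q_T$. A local-in-time solution is a solution in $Q_T$ for some $T>0$. *)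

(* Defs.v *)
From HB Require Import structures.
From mathcomp Require Import all_boot all_order all_algebra.
From mathcomp Require Import all_classical all_reals all_analysis.
From mathcomp Require Import measurable_realfun.
Set Implicit Arguments.
Unset Strict Implicit.
Unset Printing Implicit Defensive.
Import Order.TTheory GRing.Theory Num.Theory.
Import numFieldNormedType.Exports.
Local Open Scope classical_set_scope.
Local Open Scope ring_scope.

Lemma product_measure_sigma_finite d1 d2 (T1 : measurableType d1)
    (T2 : measurableType d2) (R : realType)
    (m1 : {sigma_finite_measure set T1 -> \bar R})
    (m2 : {sigma_finite_measure set T2 -> \bar R}) :
  sigma_finite setT (m1 \x m2)%E.
Proof.
have /sigma_finiteP[F [TF ndF Foo]] := sigma_finiteT m1.
have /sigma_finiteP[G [TG ndG Goo]] := sigma_finiteT m2.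
exists (fun n => F n `*` G n).
  rewrite -setXTT TF TG predeqE => -[x y]; split.
    move=> [/= [n _ Fnx] [k _ Gky]]; exists (maxn n k) => //; split.
    - by move: x Fnx; exact/subsetPset/ndF/leq_maxl.
    - by move: y Gky; exact/subsetPset/ndG/leq_maxr.
  by move=> [n _ []/= ? ?]; split; exists n.
move=> k; have [? ?] := Foo k; have [? ?] := Goo k.
split; first exact: measurableX.
by rewrite product_measure1E// lte_mul_pinfty// ge0_fin_numE.
Qed.

Section sigma_finite_of.
Context d (T : measurableType d) (R : realType).
Variables (m : {measure set T -> \bar R}) (sm : sigma_finite setT m).

Definition sigma_finite_of of sigma_finite setT m : set T -> \bar R := m.

HB.instance Definition _ := Measure.on (sigma_finite_of sm).
HB.instance Definition _ :=
  Measure_isSigmaFinite.Build _ _ _ (sigma_finite_of sm) sm.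

End sigma_finite_of.

Section euclidean.
Context {R : realType}.
Implicit Types n : nat.

Definition enorm n (x : n.-tuple R) : R :=
  Num.sqrt (\sum_(i < n) tnth x i ^+ 2).

Definition tsub n (x y : n.-tuple R) : n.-tuple R :=
  [tuple tnth x i - tnth y i | i < n].

Definition eball n (r : R) : set (n.-tuple R) := [set x | enorm x < r].

Lemma measurable_enorm n : measurable_fun [set: n.-tuple R] (@enorm n).
Proof.
apply: (@measurableT_comp _ _ _ _ _ _ (@Num.sqrt R)).
  by apply: continuous_measurable_fun; exact: sqrt_continuous.
apply: measurable_sum => i.
by apply: measurable_funX; exact: measurable_tnth.
Qed.

Definition tcons n (z : measurableTypeR R * n.-tuple R) : n.+1.-tuple R :=
  [tuple of (z.1 : R) :: z.2].

Lemma measurable_tcons n : measurable_fun setT (@tcons n).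
Proof.
apply: (@measurable_cons _ _ (measurableTypeR R * n.-tuple R)%type R fst n snd).
  exact: measurable_fst.
exact: measurable_snd.
Qed.

(* Lebesgue measure on R^n, as the n-fold product of the one-dimensional one. *)
Fixpoint lebesgue_tuple n : set (n.-tuple R) -> \bar R :=
  match n with
  | 0 => dirac [tuple]
  | m.+1 => pushforward (lebesgue_measure \x @lebesgue_tuple m)%E (@tcons m)
  end.
Arguments lebesgue_tuple n _ : clear implicits.

Let lebesgue_tuple_sigma_finite_measure n :
  exists2 m : {measure set (n.-tuple R) -> \bar R},
    lebesgue_tuple n = m & sigma_finite setT m.
Proof.
elim: n => [|n [m mE sm]]; first by exists (dirac [tuple]) => //; exact: sigma_finiteT.
pose M : {sigma_finite_measure set (n.-tuple R) -> \bar R} :=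
  sigma_finite_of sm.
pose P : {measure set (measurableTypeR R * n.-tuple R)%type -> \bar R} :=
  (@lebesgue_measure R \x M)%E.
pose uncons (t : n.+1.-tuple R) : measurableTypeR R * n.-tuple R :=
  (thead t, [tuple of behead t]).
have muncons : measurable_fun setT uncons.
  apply: (@measurable_fun_pair _ _ _ _ (measurableTypeR R) (n.-tuple R)%type).
    by move=> mT Y mY; exact: (@measurable_tnth _ R n.+1 ord0 mT Y mY).
  exact: measurable_behead.
exists (measure_function_pushforward__canonical__measure_function_Measure
    P (@measurable_tcons n)).
  by rewrite /= mE.
have [F FT Foo] := product_measure_sigma_finite (@lebesgue_measure R) M.
exists (fun i => uncons @^-1` F i) => [|i].
  by rewrite -preimage_bigcup -FT.
have [mFi Fioo] := Foo i; split.
  by rewrite -[X in measurable X]setTI; exact: muncons.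
rewrite /= /pushforward -comp_preimage.
rewrite (_ : uncons \o _ = id) ?preimage_id//.
apply/funext => -[a t]; rewrite /uncons /tcons /=; congr pair.
by apply: val_inj.
Qed.

Section instances.
Variable n : nat.

Let lebesgue_tuple0 : lebesgue_tuple n set0 = 0%E.
Proof. by have [m -> _] := lebesgue_tuple_sigma_finite_measure n. Qed.

Let lebesgue_tuple_ge0 A : (0 <= lebesgue_tuple n A)%E.
Proof. by have [m -> _] := lebesgue_tuple_sigma_finite_measure n. Qed.

Let lebesgue_tuple_semi_sigma_additive : semi_sigma_additive (lebesgue_tuple n).
Proof.
have [m -> _] := lebesgue_tuple_sigma_finite_measure n.
exact: measure_semi_sigma_additive.
Qed.

HB.instance Definition _ := isMeasure.Build _ _ _ (lebesgue_tuple n)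
  lebesgue_tuple0 lebesgue_tuple_ge0 lebesgue_tuple_semi_sigma_additive.

Let lebesgue_tuple_sigma_finite : sigma_finite setT (lebesgue_tuple n).
Proof. by have [m -> ] := lebesgue_tuple_sigma_finite_measure n. Qed.

HB.instance Definition _ := Measure_isSigmaFinite.Build _ _ _ (lebesgue_tuple n)
  lebesgue_tuple_sigma_finite.

End instances.
End euclidean.
Arguments lebesgue_tuple {R} n _.

(* R^N as R^(N-1) x R, a point x being the pair (x', x_N); meant for N >= 1. *)
Notation euclidean_space R N :=
  (N.-1.-tuple (Real.sort R) * measurableTypeR R)%type.

Section half_space.
Context {R : realType}.
Variable N : nat.
Local Notation space := (euclidean_space R N).
Implicit Types (p t T : R).

Definition space_lebesgue : set space -> \bar R :=
  (lebesgue_tuple N.-1 \x lebesgue_measure)%E.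

HB.instance Definition _ := Measure.on space_lebesgue.
HB.instance Definition _ := Measure_isSigmaFinite.Build _ _ _ space_lebesgue
  (product_measure_sigma_finite (lebesgue_tuple N.-1) lebesgue_measure).

Definition spacetime_lebesgue :
    set (space * measurableTypeR R)%type -> \bar R :=
  (space_lebesgue \x lebesgue_measure)%E.

HB.instance Definition _ := Measure.on spacetime_lebesgue.
HB.instance Definition _ := Measure_isSigmaFinite.Build _ _ _ spacetime_lebesgue
  (product_measure_sigma_finite space_lebesgue lebesgue_measure).

Definition xN (x : space) : R := x.2.

Definition snorm (x : space) : R := Num.sqrt (enorm x.1 ^+ 2 + xN x ^+ 2).

Definition ssub (x y : space) : space := (tsub x.1 y.1, xN x - xN y).

Definition Omega : set space := [set x | 0 < xN x].

Definition Omega_closure : set space := [set x | 0 <= xN x].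

Definition Q_ T : set (space * measurableTypeR R) :=
  [set z | Omega z.1 /\ 0 < (z.2 : R) < T].

Definition GammaN (x : space) t : R :=
  (4 * pi * t) `^ (- (N%:R / 2)) * expR (- (snorm x ^+ 2 / (4 * t))).

Definition kernelG (x y : space) t : R :=
  GammaN (ssub x y) t * (1 - expR (- (xN x * xN y / t))).

Definition kernelK (x y : space) t : R :=
  if 0 < xN y then (xN y)^-1 * kernelG x y t else xN x / t * GammaN (ssub x y) t.

(* On y_N = 0, kernelK is the derivative of kernelG with respect to y_N. *)
Lemma kernelK_boundary (x : space) (y' : N.-1.-tuple R) t : t != 0 ->
  is_derive (0 : R) (1 : R) (fun s => kernelG x (y', s) t) (kernelK x (y', 0) t).
Proof.
move=> t0; rewrite /kernelK /= ltxx.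
have dexp : is_derive (0 : R) (1 : R)
    (fun s : R => 1 - expR (- (xN x * s / t))) (xN x / t).
  have dlin : is_derive (0 : R) (1 : R) (fun s : R => - (xN x / t) * s) (- (xN x / t)).
    by apply: is_derive_eq; rewrite /GRing.scale /= mulr1.
  have := is_derive1_comp (is_derive_expR (- (xN x / t) * 0)) dlin.
  rewrite mulr0 expR0 mul1r => d1.
  rewrite (_ : (fun s : R => _) = cst 1 - (expR \o (fun s => - (xN x / t) * s))).
    by apply: is_derive_eq; rewrite sub0r opprK.
  by apply/funext => s; congr (1 - expR _); rewrite mulNr mulrAC.
have [d dGamma] : exists d, is_derive (0 : R) (1 : R)
    (fun s : R => GammaN (ssub x (y', s)) t) d.
  set e := enorm (tsub x.1 y') ^+ 2; set c := (4 * pi * t) `^ (- (N%:R / 2)).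
  pose q : R -> R := - (4 * t)^-1 *: (cst e + (cst (xN x) - id) ^+ 2).
  have dq : derivable q 0 1 by [].
  have := is_derive1_comp (is_derive_expR (q 0)) (derivableP dq).
  move=> /(is_deriveZ c) dcq; eexists.
  rewrite (_ : (fun s : R => _) = c *: (expR \o q)); first exact: dcq.
  apply/funext => s; rewrite /GammaN /snorm /= sqr_sqrtr ?addr_ge0 ?sqr_ge0//.
  by congr (_ * expR _); rewrite /q /= mulrC -mulNr.
rewrite /kernelG.
have := is_deriveM dGamma dexp.
rewrite mulr0 mul0r oppr0 expR0 subrr scale0r addr0 => D.
by rewrite [X in is_derive _ _ _ X]mulrC; exact: D.
Qed.

(* Almost everywhere finite nonnegative measurable functions on Q_T; values of
   u outside Q_T are irrelevant. *)
Definition calL T (u : space * measurableTypeR R -> \bar R) : Prop :=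
  [/\ forall z, Q_ T z -> (0 <= u z)%E,
      measurable_fun (Q_ T) u &
      {ae spacetime_lebesgue, forall z, Q_ T z -> u z \is a fin_num}].

Definition solution (p : R) (mu : {measure set space -> \bar R}) T
    (u : space * measurableTypeR R -> \bar R) : Prop :=
  calL T u /\
  {ae spacetime_lebesgue, forall z, Q_ T z ->
     let x := z.1 in let t := z.2 : R in
     u z = (\int[mu]_(y in Omega_closure) (kernelK x y t)%:E +
            \int[lebesgue_measure]_(s in `]0%R, t[)
              \int[space_lebesgue]_(y in Omega)
                ((kernelG x y (t - s))%:E * u (y, s) `^ p))%E}.

Definition local_in_time_solvable (p : R) (mu : {measure set space -> \bar R}) :
    Prop :=
  exists T, 0 < T /\ exists u, solution p mu T u.

Definition p_crit : R := 1 + 2 / N.+1%:R.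

(* At x' = 0 both powers take the library's value 0; the point is negligible
   since N.-1 > 0 when 2 <= N. *)
Definition hdens (p : R) (x' : N.-1.-tuple R) : R :=
  if p_crit < p then enorm x' `^ (2 - 2 / (p - 1)) * \1_(eball 1) x'
  else enorm x' `^ (- N%:R + 1) *
       `|ln (enorm x')| `^ (- (N.+1%:R / 2) - 1) * \1_(eball 2^-1) x'.

Lemma hdens_ge0 p (x' : N.-1.-tuple R) : 0 <= hdens p x'.
Proof. by rewrite /hdens; case: ifP => _; rewrite ?mulr_ge0 ?powR_ge0. Qed.

Lemma measurable_eball n r : measurable (@eball R n r).
Proof.
rewrite (_ : @eball R n r = @enorm R n @^-1` `]-oo, r[); last first.
  by apply/seteqP; split => x /=; rewrite in_itv.
by rewrite -[X in measurable X]setTI; exact: measurable_enorm.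
Qed.

Lemma measurable_hdens p : measurable_fun setT (hdens p).
Proof.
rewrite /hdens; move: (_ < p) => [|]; repeat apply: measurable_funM;
  try by apply: measurable_indic; exact: measurable_eball.
- by apply: (measurableT_comp (measurable_powR _)); exact: measurable_enorm.
- by apply: (measurableT_comp (measurable_powR _)); exact: measurable_enorm.
- apply: (measurableT_comp (measurable_powR _)).
  apply: measurableT_comp => //.
  by apply: (measurableT_comp (@measurable_ln R)); exact: measurable_enorm.
Qed.

(* The measure hdens(x') dx' on R^(N-1). *)
Definition h_measure (p : R) (A : set (N.-1.-tuple R)) : \bar R :=
  (\int[lebesgue_tuple N.-1]_(x' in A) (hdens p x')%:E)%E.

Lemma h_measure0 p : h_measure p set0 = 0%E.
Proof. by rewrite /h_measure integral_set0. Qed.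

Lemma h_measure_ge0 p A : (0 <= h_measure p A)%E.
Proof. by apply: integral_ge0 => x _; rewrite lee_fin hdens_ge0. Qed.

Lemma h_measure_semi_sigma_additive p : semi_sigma_additive (h_measure p).
Proof.
apply: semi_sigma_additive_nng_induced => [|x].
  by apply/measurable_EFinP; exact: measurable_hdens.
by rewrite lee_fin hdens_ge0.
Qed.

HB.instance Definition _ p := isMeasure.Build _ _ _ (h_measure p)
  (h_measure0 p) (h_measure_ge0 p) (@h_measure_semi_sigma_additive p).

(* kappa hdens(x') (x) delta_1(x_N), with delta_1 the Dirac mass at x_N = 0. *)
Definition boundary_datum (p : R) (kappa : {posnum R}) :
    {measure set space -> \bar R} :=
  mscale (kappa%:num)%:nng (h_measure p \x @dirac _ (measurableTypeR R) (0%R : R) R)%E.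

End half_space.

(* Main.v *)
Require Import Defs.
From mathcomp Require Import all_boot all_order all_algebra.
From mathcomp Require Import all_classical all_reals all_analysis.
From mathcomp Require Import measurable_realfun.
From mathcomp Require Import ring lra.
Set Implicit Arguments.
Unset Strict Implicit.
Unset Printing Implicit Defensive.
Import Order.TTheory GRing.Theory Num.Theory.
Import numFieldNormedType.Exports.
Local Open Scope classical_set_scope.
Local Open Scope ring_scope.

(** The solution sought is a fixed point of a monotone Volterra operator,
the potential of the datum plus the Duhamel integral of [u ^ p], with nonnegative
kernels. Its Picard iterates from 0 increase to a least fixed point, which is
finite as soon as some finite [v] dominates its own image. Two consequences:
solvability passes to smaller [kappa], so the threshold is the supremum of the
solvable values once these are known to be bounded and to exist, and existence
reduces to exhibiting a supersolution ([supersolution_solvable]).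

The kernel [G] is the product of the heat kernel in [x'] and of the reflected
heat kernel [dir1] in [x_N]. With [pois1 t x_N = (x_N / t) heat1 t x_N], the
derivative of [dir1] at the boundary, the potential of the datum at [(x, t)] is
[kappa * pois1 t x_N] times the heat flow of [h] in [x'], and [dir1] propagates
[pois1] by a semigroup law ([dir1_pois1]).

Existence. The supersolution is [B * pois1 t x_N * (Ph t x' + eta t * Pf t x')],
where [Ph] and [Pf] are mixtures [\int w(s) heatN (t + s) ds]; the heat flow acts
on such a mixture by translating [t]. The weight of [Ph] is chosen so that
[h <= C * Ph 0]. The weight of [Pf] is slightly more singular, which makes room for
[Ph ^ p <= C * A t * Pf] with [\int_0^t A(s) s ^ (1 - p) ds <= C * eta t]; the factor
[s ^ (1 - p)] is the price of [pois1 s y <= 1 / s]. Then [existence_criterion]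
applies for small [B]. Pure powers serve as weights above the critical exponent
([existence_power]); at the critical exponent the weights are [1 / s] times powers
of [- ln s] ([existence_critical]).

Nonexistence. The equation is tested against
[poisson_weight t x = pois1 t x_N * heatN t x'], which the Duhamel kernel
reproduces and which increases with [t] once multiplied by [t ^ (N.-1 / 2 + 3 / 2)].
If [m t] denotes [t ^ (N.-1 / 2 + 3 / 2)] times the weighted integral of [u(., t)],
this gives [mass_lower]:
[m t >= c * kappa * \int_(|y| <= sqrt t) h + c * J t], where [J t] is the weighted
integral of [u ^ p] up to time [t]. By Jensen a lower bound [m >= a * phi] implies
[J t >= c * a ^ p * \int_0^t s ^ (- q) phi(s) ^ p ds] with
[q = (p - 1) * (N.-1 / 2 + 1)]. For [phi t] the order of magnitude of the mass of
[h] in the ball of radius [sqrt t], namely [t ^ (N.-1 / 2 + 1 - (p - 1)^-1)] above the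
critical exponent and [(- ln t) ^ (- (p - 1)^-1)] at it, the last integral is again
at least [c * phi t]. So when [kappa] is large the constant [a] at least doubles at
every application and [J] is infinite; but away from time 0 the Duhamel kernel
dominates the weight, so [J t] is at most a multiple of a finite value of [u]
([source_finite], [nonexistence_criterion]). *)

(** * Densities and Volterra operators *)

Lemma eqW d (T : porderType d) (x y : T) : x = y -> (x <= y)%O.
Proof. by move=> ->. Qed.

Section density.
Import HBSimple HBNNSimple.
Local Open Scope ereal_scope.
Context d (T : measurableType d) (R : realType).
Variables (m n : {measure set T -> \bar R}) (g : T -> R).
Hypotheses (g0 : forall x, (0 <= g x)%R) (mg : measurable_fun setT g).
Hypothesis nE : forall A, measurable A -> n A = \int[m]_(x in A) (g x)%:E.

Let mEg : measurable_fun setT (EFin \o g).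
Proof. exact/measurable_EFinP. Qed.

(** Both sides agree on indicators by the hypothesis on [n], hence on simple
functions, hence on [f] by monotone convergence. *)
Lemma ge0_integral_density (f : T -> \bar R) :
  (forall x, 0 <= f x) -> measurable_fun setT f ->
  \int[n]_x f x = \int[m]_x (f x * (g x)%:E).
Proof.
move=> f0 mf.
pose f_ := nnsfun_approx measurableT mf.
have cf x : (f_ k x)%:E @[k --> \oo] --> f x by exact: cvg_nnsfun_approx.
have ndf x : nondecreasing_seq (fun k => (f_ k x)%:E).
  by move=> a b ab; rewrite lee_fin; exact/lefP/nd_nnsfun_approx.
transitivity (limn (fun k => \int[n]_x (f_ k x)%:E)).
  rewrite -monotone_convergence//.
  - by apply: eq_integral => x _; apply/esym/cvg_lim => //; exact: cf.
  - by move=> k; exact/measurable_EFinP/measurable_funP.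
  - by move=> k x _; rewrite lee_fin.
rewrite [X in limn X](_ : _ = (fun k => \int[m]_x ((f_ k x)%:E * (g x)%:E))); last first.
  apply/funext => k.
  under eq_integral do rewrite fimfunE -fsumEFin//.
  rewrite ge0_integral_fsum//; last 2 first.
  - by move=> y; exact/measurable_EFinP/measurable_funM.
  - by move=> y x _; rewrite nnfun_muleindic_ge0.
  transitivity (\int[m]_x (\sum_(y \in range (f_ k)) ((y * \1_(f_ k @^-1` [set y]) x)%:E * (g x)%:E))).
    rewrite ge0_integral_fsum//; last 2 first.
    - by move=> y; apply: emeasurable_funM => //; exact/measurable_EFinP/measurable_funM.
    - by move=> y x _; apply: mule_ge0; [rewrite nnfun_muleindic_ge0|rewrite lee_fin].
    apply: eq_fsbigr => r /set_mem [t _ <-].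
    have r0 : (0 <= f_ k t)%R by [].
    have mI : d.-measurable (f_ k @^-1` [set f_ k t]) by exact: measurable_sfunP.
    under eq_integral do rewrite EFinM.
    rewrite ge0_integralZl_EFin//; last exact/measurable_EFinP/measurable_indic.
    rewrite integral_indic// setIT nE// -ge0_integralZl_EFin//; last 2 first.
      by move=> x _; rewrite lee_fin.
      exact: measurable_funTS.
    rewrite integral_mkcond; apply: eq_integral => x _.
    rewrite patchE indicE; case: ifPn => _ /=; first by rewrite mulr1.
    by rewrite mulr0 mul0e.
  apply: eq_integral => x _.
  rewrite -ge0_mule_fsuml; last by move=> y; rewrite nnfun_muleindic_ge0.
  by rewrite fsumEFin// [in RHS]fimfunE.
rewrite -monotone_convergence//.
- apply: eq_integral => x _; apply/cvg_lim => //.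
  by apply: cvgeZr => //; exact: cf.
- move=> k; apply: emeasurable_funM => //; exact/measurable_EFinP/measurable_funP.
- by move=> k x _; rewrite mule_ge0// lee_fin.
- move=> x _ a b ab; apply: lee_wpmul2r; rewrite lee_fin//.
  exact/lefP/nd_nnsfun_approx.
Qed.

End density.

Lemma lee_poweR (R : realType) (r : R) (x y : \bar R) : 0 <= r ->
  (0 <= x)%E -> (x <= y)%E -> (x `^ r <= y `^ r)%E.
Proof.
move=> r0 x0 xy; apply: gt0_ler_poweR => //; rewrite in_itv/= leey andbT//.
exact: le_trans xy.
Qed.

Lemma ereal_nondecreasing_cvgn_le (R : realType) (u : (\bar R)^nat) n :
  nondecreasing_seq u -> (u n <= limn u)%E.
Proof.
move=> ndu; rewrite (cvg_lim _ (ereal_nondecreasing_cvgn ndu))//.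
by apply: ereal_sup_ubound; exists n.
Qed.

Lemma limn_poweR (R : realType) (a : (\bar R)^nat) (p : R) : 0 < p ->
  (forall n, (0 <= a n)%E) -> nondecreasing_seq a ->
  limn (fun n => (a n `^ p)%E) = ((limn a) `^ p)%E.
Proof.
move=> p0 a0 nda.
have ca := ereal_nondecreasing_is_cvgn nda.
have l0 : (0 <= limn a)%E by apply: lime_ge => //; near=> n.
have ndp : nondecreasing_seq (fun n => (a n `^ p)%E).
  by move=> i j ij; apply: lee_poweR; rewrite ?(ltW p0)//; exact: nda.
have cp := ereal_nondecreasing_is_cvgn ndp.
have leal n : (a n <= limn a)%E by exact: ereal_nondecreasing_cvgn_le.
apply/eqP; rewrite eq_le; apply/andP; split.
  apply: lime_le => //; near=> n.
  by apply: lee_poweR; rewrite ?(ltW p0).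
set m := limn (fun n => (a n `^ p)%E).
have m0 : (0 <= m)%E by apply: lime_ge; [exact: cp|near=> n; exact: poweR_ge0].
have lem : (limn a <= m `^ p^-1)%E.
  apply: lime_le => //; near=> n.
  have anm : (a n `^ p <= m)%E by exact: (ereal_nondecreasing_cvgn_le n ndp).
  rewrite -[leLHS]poweRe1// -(@mulfV _ p) ?gt_eqF// poweRrM.
  by apply: lee_poweR; rewrite ?poweR_ge0// invr_ge0 ltW.
rewrite -[leRHS]poweRe1// -(@mulVf _ p) ?gt_eqF// poweRrM.
by apply: lee_poweR; rewrite ?(ltW p0).
Unshelve. all: by end_near. Qed.

Section volterra.
Local Open Scope ereal_scope.
Context d (Z : measurableType d) (R : realType).
Variables (nu : {sigma_finite_measure set Z -> \bar R}) (kap : Z * Z -> R).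
Variables (w : Z -> \bar R) (p : R).
Hypotheses (kap0 : forall z, (0 <= kap z)%R) (mkap : measurable_fun setT kap).
Hypotheses (w0 : forall z, 0 <= w z) (mw : measurable_fun setT w) (p0 : (0 < p)%R).

Definition volterra (u : Z -> \bar R) (z : Z) :=
  w z + \int[nu]_y ((kap (z, y))%:E * u y `^ p).

Let integrand_ge0 (u : Z -> \bar R) (z : Z * Z) :
  0 <= (kap z)%:E * u z.2 `^ p.
Proof. by rewrite mule_ge0 ?lee_fin ?poweR_ge0. Qed.

Let measurable_integrand (u : Z -> \bar R) : measurable_fun setT u ->
  measurable_fun setT (fun z : Z * Z => (kap z)%:E * u z.2 `^ p).
Proof.
move=> mu; apply: emeasurable_funM; first exact/measurable_EFinP.
apply: (measurableT_comp (measurable_poweR _)).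
exact: measurableT_comp.
Qed.

Let measurable_integrand2 (u : Z -> \bar R) z : measurable_fun setT u ->
  measurable_fun setT (fun y => (kap (z, y))%:E * u y `^ p).
Proof.
move=> mu; exact: (measurableT_comp (measurable_integrand mu) (measurable_pair1 z)).
Qed.

Lemma volterra_ge0 u z : 0 <= volterra u z.
Proof.
rewrite adde_ge0//; apply: integral_ge0 => y _.
exact: (integrand_ge0 u (z, y)).
Qed.

Lemma measurable_volterra u : measurable_fun setT u ->
  measurable_fun setT (volterra u).
Proof.
move=> mu; apply: emeasurable_funD => //.
exact: (measurable_fun_fubini_tonelli_F _ (measurable_integrand mu) (integrand_ge0 u)).
Qed.

Lemma le_volterra u v z : measurable_fun setT u -> measurable_fun setT v ->
  (forall y, 0 <= u y) ->
  {ae nu, forall y, kap (z, y) != 0%R -> u y <= v y} ->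
  volterra u z <= volterra v z.
Proof.
move=> mu mv u0 uv; apply: leeD => //.
apply: ae_ge0_le_integral.
- exact: measurableT.
- by move=> y _; exact: (integrand_ge0 u (z, y)).
- exact: measurable_integrand2.
- by move=> y _; exact: (integrand_ge0 v (z, y)).
- exact: measurable_integrand2.
apply: filterS uv => y uv _; have [->|k0] := eqVneq (kap (z, y)) 0%R.
  by rewrite !mul0e.
rewrite lee_pmul//; rewrite ?lee_fin// ?poweR_ge0//.
by apply: lee_poweR; rewrite ?(ltW p0)//; exact: uv.
Qed.

Let u_ n := iter n volterra (cst 0).

Let u_ge0 n z : 0 <= u_ n z.
Proof. by case: n => [//|n]; exact: volterra_ge0. Qed.

Let measurable_u n : measurable_fun setT (u_ n).
Proof. by elim: n => [|n ih]; [exact: measurable_cst|exact: measurable_volterra]. Qed.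

Let nd_u z : nondecreasing_seq (fun n => u_ n z).
Proof.
apply/nondecreasing_seqP => n; elim: n z => [|n ih] z; first exact: volterra_ge0.
apply: (@le_volterra (u_ n) (u_ n.+1)); [exact: measurable_u|exact: (measurable_u n.+1)|exact: u_ge0|].
by apply: aeW => y _; exact: ih.
Qed.

(** The iterates from 0 increase by monotonicity of the operator and their limit
is a fixed point by monotone convergence. Each iterate stays below a supersolution.
The comparison holds on any set [Q] that contains the past of its points, which
is how a supersolution known only for small times is enough. *)
Lemma volterra_least_solution : exists u : Z -> \bar R,
  [/\ forall z, 0 <= u z, measurable_fun setT u, forall z, u z = volterra u z &
   forall (Q : set Z) v, measurable_fun setT v ->
    (forall z y, Q z -> kap (z, y) != 0%R -> Q y) ->
    {ae nu, forall z, Q z -> volterra v z <= v z} ->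
    {ae nu, forall z, Q z -> u z <= v z}].
Proof.
pose u z := limn (fun n => u_ n z).
have cu z : u_ n z @[n --> \oo] --> u z.
  exact: (ereal_nondecreasing_is_cvgn (@nd_u z)).
have u0 z : 0 <= u z by apply: lime_ge; [exact: cu|near=> n].
have mu : measurable_fun setT u.
  by apply: (emeasurable_fun_cvg u_) => // z _; exact: cu.
exists u; split => //.
  move=> z; transitivity (limn (fun n => volterra (u_ n) z)).
    apply/esym/cvg_lim => //.
    by have := cu z; rewrite -cvg_shiftS.
  have Elim : \int[nu]_y ((kap (z, y))%:E * u y `^ p) =
      limn (fun n => \int[nu]_y ((kap (z, y))%:E * u_ n y `^ p)).
    have mI n := measurable_integrand2 z (measurable_u n).
    have ge0I n y : [set: Z] y -> 0 <= (kap (z, y))%:E * u_ n y `^ p.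
      by move=> _; exact: (integrand_ge0 (u_ n) (z, y)).
    have ndp y : nondecreasing_seq (fun n => u_ n y `^ p).
      by move=> a b ab; apply: lee_poweR; rewrite ?(ltW p0)//; exact: nd_u.
    have ndk y : [set: Z] y -> nondecreasing_seq (fun n => (kap (z, y))%:E * u_ n y `^ p).
      by move=> _ a b ab; apply: lee_wpmul2l; [rewrite lee_fin|exact: ndp].
    rewrite -(monotone_convergence nu measurableT mI ge0I ndk).
    apply: eq_integral => y _; rewrite -limn_poweR//.
    by rewrite limeMl//; exact: ereal_nondecreasing_is_cvgn.
  rewrite /volterra Elim.
  have ndI : nondecreasing_seq (fun n => \int[nu]_y ((kap (z, y))%:E * u_ n y `^ p)).
    move=> a b ab; apply: ge0_le_integral.
    - exact: measurableT.
    - by move=> y _; exact: (integrand_ge0 (u_ a) (z, y)).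
    - exact: measurable_integrand2.
    - exact: measurable_integrand2.
    - move=> y _; apply: lee_wpmul2l; first by rewrite lee_fin.
      by apply: lee_poweR; rewrite ?(ltW p0)//; exact: nd_u.
  have cI := ereal_nondecreasing_is_cvgn ndI.
  have I0 : 0 <= limn (fun n => \int[nu]_y ((kap (z, y))%:E * u_ n y `^ p)).
    apply: lime_ge => //; near=> n; apply: integral_ge0 => y _.
    exact: (integrand_ge0 (u_ n) (z, y)).
  rewrite limeD//.
  - by rewrite lim_cst.
  - exact: is_cvg_cst.
  - by rewrite lim_cst// ge0_adde_def// inE.
move=> Q v mv Qk supv.
have uv n : {ae nu, forall z, Q z -> u_ n z <= v z}.
  elim: n => [|n ih].
    apply: filterS supv => z /[apply]; apply: le_trans; exact: volterra_ge0.
  apply: filterS supv => z h Qz; apply: le_trans (h Qz).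
  apply: le_volterra => //; apply: filterS ih => y ih k0; apply: ih; exact: Qk k0.
have /ae_foralln := uv.
apply: filterS => z uvz Qz; apply: lime_le; first exact: cu.
by near=> n; exact: uvz.
Unshelve. all: by end_near. Qed.

End volterra.

(** * The heat kernel on the line *)

Lemma measurable_inv (R : realType) : measurable_fun setT (fun x : R => x^-1).
Proof.
rewrite (_ : (fun x => _) = (fun x : R => if 0 <= x then x `^ (-1) else - ((- x) `^ (-1)))).
  apply: measurable_fun_ifT.
  - by apply: measurable_fun_ler; [exact: measurable_cst|exact: measurable_id].
  - exact: measurable_powR.
  - apply: measurableT_comp => //; apply: (measurableT_comp (measurable_powR _)).
    by apply: measurable_funN; exact: measurable_id.
apply/funext => x; case: (leP 0 x) => x0; first by rewrite powR_inv1.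
by rewrite powR_inv1 ?oppr_ge0 ?ltW// invrN opprK.
Qed.

Section heat1.
Context {R : realType}.
Implicit Types t s x y m : R.
Notation mu := (@lebesgue_measure R).

Definition heat1 t x : R := (4 * pi * t) `^ (- 2^-1) * expR (- (x ^+ 2 / (4 * t))).

Lemma heat1_ge0 t x : 0 <= heat1 t x.
Proof. by rewrite mulr_ge0 ?powR_ge0 ?expR_ge0. Qed.

Lemma heat1_gt0 t x : 0 < t -> 0 < heat1 t x.
Proof. by move=> t0; rewrite mulr_gt0 ?expR_gt0 ?powR_gt0// !mulr_gt0 ?pi_gt0. Qed.

Lemma heat1N t x : heat1 t (- x) = heat1 t x.
Proof. by rewrite /heat1 sqrrN. Qed.

Lemma measurable_heat1 : measurable_fun setT (fun z : R * R => heat1 z.1 z.2).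
Proof.
apply: measurable_funM.
  apply: (measurableT_comp (measurable_powR _)).
  by apply: measurable_funM => //; exact: measurable_fst.
apply: measurableT_comp => //; apply: measurableT_comp => //.
apply: measurable_funM; first by apply: measurable_funX; exact: measurable_snd.
apply: (measurableT_comp (@measurable_inv R)).
by apply: measurable_funM => //; exact: measurable_fst.
Qed.

Lemma heat1_normal t m x : 0 < t ->
  heat1 t (x - m) = normal_pdf m (Num.sqrt (2 * t)) x.
Proof.
move=> t0; have t20 : 0 < 2 * t by rewrite mulr_gt0.
have s0 : Num.sqrt (2 * t) != 0 by rewrite gt_eqF// sqrtr_gt0.
rewrite normal_pdfE//= /normal_peak /normal_fun sqr_sqrtr ?ltW// /heat1.
congr (_ * expR _); last by field; rewrite gt_eqF.
rewrite powRN powR12_sqrt; last by rewrite !mulr_ge0 ?pi_ge0// ltW.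
by congr ((Num.sqrt _)^-1); ring.
Qed.

Lemma integral_heat1 t m : 0 < t ->
  (\int[mu]_x (heat1 t (x - m))%:E = 1)%E.
Proof.
by move=> t0; under eq_integral do rewrite heat1_normal//; exact: integral_normal_pdf.
Qed.

(** Completing the square: the product of two Gaussians in [y] is a Gaussian
centred at the barycentre [s x / (t + s)]. *)
Lemma heat1_mul t s x y : 0 < t -> 0 < s ->
  heat1 t (x - y) * heat1 s y =
  heat1 (t + s) x * heat1 (t * s / (t + s)) (y - s * x / (t + s)).
Proof.
move=> t0 s0; have ts0 : 0 < t + s by rewrite addr_gt0.
have p0 := @pi_gt0 R.
rewrite /heat1 mulrACA [RHS]mulrACA -!powRM -?expRD; last 4 first.
- by rewrite !mulr_ge0// ltW.
- by rewrite !mulr_ge0 ?invr_ge0// ltW.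
- by rewrite !mulr_ge0// ltW.
- by rewrite !mulr_ge0// ltW.
congr (_ `^ _ * expR _); first by field; rewrite gt_eqF.
by field; rewrite !gt_eqF//= mulr_gt0.
Qed.

Lemma heat1_semigroup t s x : 0 < t -> 0 < s ->
  (\int[mu]_y (heat1 t (x - y) * heat1 s y)%:E = (heat1 (t + s) x)%:E)%E.
Proof.
move=> t0 s0; have r0 : 0 < t * s / (t + s) by rewrite divr_gt0 ?mulr_gt0 ?addr_gt0.
under eq_integral do rewrite heat1_mul// EFinM.
rewrite ge0_integralZl_EFin ?heat1_ge0//.
- by rewrite integral_heat1// mule1.
- by move=> y _; rewrite lee_fin heat1_ge0.
- apply/measurable_EFinP.
  under eq_fun do rewrite heat1_normal//.
  exact: measurable_normal_pdf.
Qed.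

Lemma is_derive_heat1 t x : is_derive x 1 (heat1 t) (- (x / (2 * t)) * heat1 t x).
Proof.
pose q : R -> R := - (4 * t)^-1 *: (id ^+ 2).
have qE y : q y = - (y ^+ 2 / (4 * t)).
  by have -> : q y = - (4 * t)^-1 * y ^+ 2 by []; ring.
have dq : is_derive x 1 q (- (x / (2 * t))).
  apply: is_derive_eq; rewrite /GRing.scale/= expr1 mulr1 mulr2n.
  by have [->|t0] := eqVneq t 0; [rewrite !mulr0 invr0; ring|field].
have := is_derive1_comp (is_derive_expR (q x)) dq.
move=> /(is_deriveZ ((4 * pi * t) `^ (- 2^-1))) D.
have E : heat1 t = (fun y => (4 * pi * t) `^ (- 2^-1) * expR (q y)).
  by apply/funext => y; rewrite /heat1 -qE.
have -> : - (x / (2 * t)) * heat1 t x =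
    (4 * pi * t) `^ (- 2^-1) *: (expR (q x) * - (x / (2 * t))).
  by rewrite E /GRing.scale/=; ring.
by rewrite E; exact: D.
Qed.

Lemma continuous_heat1 t : continuous (heat1 t).
Proof.
move=> x; apply: differentiable_continuous; apply/derivable1_diffP.
by apply: ex_derive; exact: is_derive_heat1.
Qed.

Let D1 t m y := heat1 t (y - m) - heat1 t (y + m).
Let S1 t m y := heat1 t (y - m) + heat1 t (y + m).

Let is_derive_shift t m y :
  is_derive y 1 (fun y => heat1 t (y + m)) (- ((y + m) / (2 * t)) * heat1 t (y + m)).
Proof.
have d1 : is_derive y (1 : R) (fun y : R => y + m) 1.
  by apply: is_derive_eq; rewrite addr0.
by have := @is_derive1_comp R (heat1 t) (fun y => y + m) y _ _ (is_derive_heat1 t (y + m)) d1; rewrite mulr1.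
Qed.

Let is_derive_D1 t m y : 0 < t ->
  is_derive y 1 (fun y => - (2 * t) * D1 t m y) (y * D1 t m y - m * S1 t m y).
Proof.
move=> t0; rewrite /D1 /S1.
have h1 := is_derive_shift t (- m) y; have h2 := is_derive_shift t m y.
apply: is_derive_eq; rewrite /GRing.scale/=.
by field; rewrite gt_eqF.
Qed.

(** The reflected Gaussian differs by the factor [expR (- (x * y / t))], so the kernel
of the half-space is a difference of two heat kernels. *)
Lemma heat1_sub t x y : 0 < t ->
  heat1 t (x - y) - heat1 t (x + y) = heat1 t (x - y) * (1 - expR (- (x * y / t))).
Proof.
move=> t0; rewrite mulrBr mulr1; congr (_ - _).
rewrite /heat1 -[RHS]mulrA -expRD; congr (_ * expR _); field.
by rewrite gt_eqF.
Qed.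

Lemma heat1_sub_ge0 t x y : 0 < t -> 0 <= x * y ->
  0 <= heat1 t (x - y) - heat1 t (x + y).
Proof.
move=> t0 xy; rewrite heat1_sub// mulr_ge0 ?heat1_ge0// subr_ge0.
by rewrite expR_le1 oppr_le0 divr_ge0// ltW.
Qed.

(** The derivative of [- 2 t (heat1 t (y - m) - heat1 t (y + m))] is the integrand
minus [m] times an even density whose integral over the half-line is 1, so
integration over [[0, n]] and the decay of the primitive give [m]. *)
Lemma heat1_sub_moment t m : 0 < t -> 0 < m ->
  (\int[mu]_(y in `[0%R, +oo[) (y * (heat1 t (y - m) - heat1 t (y + m)))%:E = m%:E)%E.
Proof.
move=> t0 m0.
have cS y0 : {for y0, continuous (heat1 t)} := @continuous_heat1 t y0.
have csh k : continuous (fun y => heat1 t (y + k)).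
  move=> y; apply: (@continuous_comp _ _ _ (fun y : R => y + k) (heat1 t)) => //.
  exact: (@cvgD _ R^o _ _ _ _ _ y k cvg_id (cvg_cst _)).
have msh k : measurable_fun setT (fun y => heat1 t (y + k)).
  by apply: continuous_measurable_fun; exact: csh.
have cD : continuous (D1 t m) by move=> y; apply: cvgB; exact: csh.
have cS1 : continuous (S1 t m) by move=> y; apply: cvgD; exact: csh.
have cP : continuous (fun y => y * D1 t m y).
  by move=> y; apply: cvgM; [exact: cvg_id|exact: cD].
have cm : continuous (fun y => m * S1 t m y).
  by move=> y; apply: cvgM; [exact: cvg_cst|exact: cS1].
have P0 y : 0 <= y * D1 t m y.
  have [y0|/ltW y0] := leP 0 y.
    by rewrite mulr_ge0// heat1_sub_ge0// mulr_ge0// ltW.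
  rewrite mulr_le0// /D1 -heat1N -(heat1N _ (y + m)) subr_le0 -subr_ge0 opprB opprD (addrC m).
  by rewrite heat1_sub_ge0// mulr_ge0 ?oppr_ge0// ltW.
have S0 y : 0 <= S1 t m y by rewrite addr_ge0 ?heat1_ge0.
have mS : measurable_fun setT (S1 t m) by exact: continuous_measurable_fun.
have step n : (0 < n)%N -> (\int[mu]_(y in `[0%R, n%:R]) (y * D1 t m y)%:E =
    (- (2 * t) * D1 t m n%:R)%:E + m%:E * \int[mu]_(y in `[0%R, n%:R]) (S1 t m y)%:E)%E.
  move=> n0; have n0R : 0 < n%:R :> R by rewrite ltr0n.
  have cF y : {for y, continuous (fun y => - (2 * t) * D1 t m y)}.
    by apply: cvgM; [exact: cvg_cst|exact: cD].
  have := @continuous_FTC2 R (fun y => y * D1 t m y - m * S1 t m y)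
    (fun y => - (2 * t) * D1 t m y) 0 n%:R n0R.
  rewrite [D1 t m 0](_ : _ = 0) ?mulr0 ?sube0; last by rewrite /D1 sub0r heat1N add0r subrr.
  move=> <-.
  - rewrite -ge0_integralZl_EFin ?(ltW m0)//; last 2 first.
    + by move=> y _; rewrite lee_fin.
    + by apply/measurable_EFinP; exact: measurable_funTS.
    rewrite -integralD//.
    + by apply: eq_integral => y _; rewrite -EFinM -EFinD subrK.
    + apply: continuous_compact_integrable; first exact: segment_compact.
      by apply: continuous_subspaceT => y; apply: cvgB; [exact: cP|exact: cm].
    + apply: (@continuous_compact_integrable _ (fun y => m * S1 t m y)); first exact: segment_compact.
      exact: continuous_subspaceT.
  - by apply: continuous_subspaceT => y; apply: cvgB; [exact: cP|exact: cm].
  - split.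
    + by move=> y _; apply: ex_derive; exact: is_derive_D1.
    + by apply: cvg_at_right_filter; exact: cF.
    + by apply: cvg_at_left_filter; exact: cF.
  - move=> y _; rewrite derive1E; have h := is_derive_D1 m y t0.
    exact: derive_val.
have mP : measurable_fun setT (fun y => y * D1 t m y) by exact: continuous_measurable_fun.
have c1 := ge0_cvgn_integral (mu := mu) P0 mP.
have c2 := ge0_cvgn_integral (mu := mu) S0 mS.
have S1E : (\int[mu]_(y in `[0%R, +oo[) (S1 t m y)%:E = 1)%E.
  have S1N : S1 t m =1 S1 t m \o -%R.
    by move=> y /=; rewrite /S1 -heat1N -[in X in _ + X = _]heat1N !opprD !opprK addrC.
  have := ge0_symfun_integralT S0 cS1 S1N.
  rewrite -set_itvcy => E2.
  have : (\int[mu]_x (S1 t m x)%:E = 2%:E)%E.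
    under eq_integral do rewrite EFinD.
    rewrite ge0_integralD//.
    - rewrite integral_heat1//.
      rewrite (_ : (fun y => _) = (fun y => (heat1 t (y - (- m)))%:E)).
        by rewrite integral_heat1// -EFinD.
      by apply/funext => y; rewrite opprK.
    - by move=> y _; rewrite lee_fin heat1_ge0.
    - by apply/measurable_EFinP; exact: msh.
    - by move=> y _; rewrite lee_fin heat1_ge0.
    - by apply/measurable_EFinP; exact: msh.
  rewrite E2; case: (\int[mu]_(y in _) _)%E => [r| |]//=.
  - by rewrite -EFinM => -[]/eqP; rewrite -[eqbRHS]mulr1 => /eqP/mulfI ->.
  - by rewrite gt0_muley// lte_fin.
  - by rewrite gt0_muleNy// lte_fin.
rewrite S1E in c2.
have cF : D1 t m n%:R @[n --> \oo] --> (0 : R).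
  have cb : (4 * pi * t) `^ (- 2^-1) * expR (- n%:R) @[n --> \oo] --> (0 : R).
    rewrite -[X in _ --> X](mulr0 ((4 * pi * t) `^ (- 2^-1))).
    by apply: cvgM; [exact: cvg_cst|exact: cvgn_expR].
  apply: (squeeze_cvgr _ (cvg_cst (0 : R)) cb); near=> n.
  have n2m : 2 * m <= n%:R by near: n; exact: nbhs_infty_ger.
  have n16 : 16 * t <= n%:R by near: n; exact: nbhs_infty_ger.
  rewrite heat1_sub_ge0 ?mulr_ge0 ?ler0n ?(ltW m0)//=.
  apply: (@le_trans _ _ (heat1 t (n%:R - m))).
    by rewrite lerBlDr lerDl heat1_ge0.
  rewrite ler_wpM2l ?powR_ge0// ler_expR lerN2 ler_pdivlMr ?mulr_gt0//.
  have h1 : n%:R / 2 <= n%:R - m by lra.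
  have h2 : n%:R / 2 * (n%:R / 2) <= (n%:R - m) * (n%:R - m).
    by apply: ler_pM => //; rewrite divr_ge0// ler0n.
  have h3 : n%:R * (16 * t) <= n%:R * n%:R by rewrite ler_wpM2l// ler0n.
  by rewrite expr2; lra.
have c3 : ((- (2 * t) * D1 t m n%:R)%:E +
    m%:E * \int[mu]_(y in `[0%R, n%:R]) (S1 t m y)%:E)%E @[n --> \oo] --> m%:E.
  have c4 : (- (2 * t) * D1 t m n%:R)%:E @[n --> \oo] --> (- (2 * t) * 0)%:E.
    by apply: cvg_EFin; [exact: nearW|apply: cvgM; [exact: cvg_cst|exact: cF]].
  have c5 : (m%:E * \int[mu]_(y in `[0%R, n%:R]) (S1 t m y)%:E)%E @[n --> \oo] --> (m%:E * 1)%E.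
    exact: cvgeZl.
  by have := cvgeD _ c4 c5; rewrite mulr0 add0e mule1; apply.
apply: (cvg_unique _ c1) => //; apply: cvg_trans c3; apply: near_eq_cvg.
by near=> n; rewrite step//; near: n; exact: nbhs_infty_gt.
Unshelve. all: by end_near. Qed.

End heat1.

(** * Half-line kernels and the heat kernel in several variables *)

Section pois1.
Context {R : realType}.
Implicit Types t s x y a : R.
Notation mu := (@lebesgue_measure R).

(** The Dirichlet heat kernel of the half-line, by reflection. *)
Definition dir1 t x y : R := heat1 t (x - y) - heat1 t (x + y).

(** The derivative of [dir1 t x y] in [y] at the boundary, that is the solution on
the half-line with a unit dipole at 0 as datum. *)
Definition pois1 t x : R := x / t * heat1 t x.

Lemma dir1C t x y : dir1 t x y = dir1 t y x.
Proof. by rewrite /dir1 -heat1N opprB (addrC x). Qed.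

Lemma dir1_ge0 t x y : 0 < t -> 0 <= x -> 0 <= y -> 0 <= dir1 t x y.
Proof. by move=> t0 x0 y0; rewrite heat1_sub_ge0// mulr_ge0. Qed.

Lemma pois1_ge0 t x : 0 <= t -> 0 <= x -> 0 <= pois1 t x.
Proof. by move=> t0 x0; rewrite mulr_ge0 ?heat1_ge0// divr_ge0. Qed.

Lemma measurable_dir1 : measurable_fun setT (fun z : R * (R * R) => dir1 z.1 z.2.1 z.2.2).
Proof.
have m2 : measurable_fun setT (fun z : R * (R * R) => z.2) by exact: measurable_snd.
have m21 : measurable_fun setT (fun z : R * (R * R) => z.2.1).
  exact: (measurableT_comp measurable_fst m2).
have m22 : measurable_fun setT (fun z : R * (R * R) => z.2.2).
  exact: (measurableT_comp measurable_snd m2).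
apply: measurable_funB.
  apply: (measurableT_comp measurable_heat1 (g := fun z : R * (R * R) => (z.1, z.2.1 - z.2.2))).
  by apply: measurable_fun_pair; [exact: measurable_fst|exact: measurable_funB].
apply: (measurableT_comp measurable_heat1 (g := fun z : R * (R * R) => (z.1, z.2.1 + z.2.2))).
by apply: measurable_fun_pair; [exact: measurable_fst|exact: measurable_funD].
Qed.

Lemma measurable_pois1 : measurable_fun setT (fun z : R * R => pois1 z.1 z.2).
Proof.
apply: measurable_funM; last exact: measurable_heat1.
apply: measurable_funM; first exact: measurable_snd.
exact: (measurableT_comp (@measurable_inv R) measurable_fst).
Qed.

Lemma measurable_heat1_shift t m : measurable_fun setT (fun y => heat1 t (y + m)).
Proof.
apply: (measurableT_comp measurable_heat1 (g := fun y => (t, y + m))).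
apply: measurable_fun_pair; first exact: measurable_cst.
exact: measurable_funD.
Qed.

(** Completing the square turns the integrand into a multiple of the first
moment computed in [heat1_sub_moment]. *)
Lemma dir1_pois1 t s x : 0 < t -> 0 < s -> 0 < x ->
  (\int[mu]_(y in `]0%R, +oo[) (dir1 t x y * pois1 s y)%:E = (pois1 (t + s) x)%:E)%E.
Proof.
move=> t0 s0 x0; have ts0 : 0 < t + s by rewrite addr_gt0.
pose m := s * x / (t + s); pose r := t * s / (t + s).
have m0 : 0 < m by rewrite divr_gt0 ?mulr_gt0.
have r0 : 0 < r by rewrite divr_gt0 ?mulr_gt0.
have E y : dir1 t x y * pois1 s y =
    heat1 (t + s) x / s * (y * (heat1 r (y - m) - heat1 r (y + m))).
  have e1 := heat1_mul x y t0 s0.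
  have := heat1_mul x (- y) t0 s0; rewrite opprK !heat1N -opprD heat1N => e2.
  transitivity (y / s * (heat1 t (x - y) * heat1 s y - heat1 t (x + y) * heat1 s y)).
    by rewrite /dir1 /pois1; ring.
  by rewrite e1 e2 -/m -/r; ring.
under eq_integral do rewrite E EFinM.
rewrite integral_itv_obnd_cbnd; last first.
  apply: emeasurable_funM; first exact: measurable_cst.
  apply/measurable_EFinP/measurable_funTS/measurable_funM => //.
  by apply: measurable_funB; exact: measurable_heat1_shift.
rewrite ge0_integralZl_EFin//.
- rewrite heat1_sub_moment// -EFinM /m /pois1; congr (_%:E).
  by field; rewrite !gt_eqF.
- move=> y; rewrite /= in_itv/= andbT => y0; rewrite lee_fin mulr_ge0//.
  by rewrite heat1_sub_ge0// mulr_ge0// ltW.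
- apply/measurable_EFinP/measurable_funTS/measurable_funM => //.
  by apply: measurable_funB; exact: measurable_heat1_shift.
- by rewrite divr_ge0 ?heat1_ge0// ltW.
Qed.

End pois1.

Section lebesgue_tuple.
Context {R : realType}.
Local Open Scope ereal_scope.

Lemma ge0_integral_tuple0 (f : 0.-tuple R -> \bar R) : measurable_fun setT f ->
  \int[lebesgue_tuple 0]_x f x = f [tuple].
Proof.
move=> mf; transitivity (\int[@dirac _ (0.-tuple R) [tuple] R]_x f x).
  by apply: eq_measure_integral => A mA _.
by rewrite integral_dirac// diracE in_setT mul1e.
Qed.

Lemma ge0_integral_tupleS n (f : n.+1.-tuple R -> \bar R) :
  (forall x, 0 <= f x) -> measurable_fun setT f ->
  \int[lebesgue_tuple n.+1]_x f x =
  \int[lebesgue_measure]_z \int[lebesgue_tuple n]_x f (tcons (z, x)).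
Proof.
move=> f0 mf.
pose P := measure_function_pushforward__canonical__measure_function_Measure
  (@lebesgue_measure R \x @lebesgue_tuple R n) (@measurable_tcons R n).
transitivity (\int[P]_x f x); first exact: eq_measure_integral.
rewrite (ge0_integral_pushforward (@measurable_tcons R n))//= preimage_setT.
have mft : measurable_fun setT (f \o @tcons R n).
  exact: (measurableT_comp mf (@measurable_tcons R n)).
rewrite (@fubini_tonelli1 _ _ _ _ R _ _ (f \o @tcons R n)) => [//|//|z]; exact: f0.
Qed.

End lebesgue_tuple.

Section heatN.
Context {R : realType}.
Implicit Types t s : R.

Definition heatN n t (x : n.-tuple R) : R := \prod_(i < n) heat1 t (tnth x i).

Lemma heatN_ge0 n t (x : n.-tuple R) : 0 <= heatN t x.
Proof. by apply: prodr_ge0 => i _; exact: heat1_ge0. Qed.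

Lemma enorm_ge0 n (x : n.-tuple R) : 0 <= enorm x.
Proof. exact: sqrtr_ge0. Qed.

Lemma enorm_sqr n (x : n.-tuple R) : enorm x ^+ 2 = \sum_(i < n) tnth x i ^+ 2.
Proof. by rewrite sqr_sqrtr// sumr_ge0// => i _; exact: sqr_ge0. Qed.

Lemma heatNE n t (x : n.-tuple R) : 0 <= t ->
  heatN t x = (4 * pi * t) `^ (- (n%:R / 2)) * expR (- (enorm x ^+ 2 / (4 * t))).
Proof.
move=> t0; rewrite /heatN /heat1 big_split/=; congr (_ * _).
  rewrite prodr_const card_ord -powR_mulrn ?powR_ge0// -powRrM.
  by congr (_ `^ _); ring.
by rewrite -expR_sum sumrN enorm_sqr mulr_suml.
Qed.

Lemma measurable_heatN n :
  measurable_fun setT (fun z : R * n.-tuple R => heatN z.1 z.2).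
Proof.
apply: measurable_prod => i _.
apply: (measurableT_comp (@measurable_heat1 R) (g := fun z : R * n.-tuple R => (z.1, tnth z.2 i))).
apply: measurable_fun_pair; first exact: measurable_fst.
exact: (measurableT_comp (measurable_tnth i) measurable_snd).
Qed.

Lemma measurable_tsub n :
  measurable_fun setT (fun z : n.-tuple R * n.-tuple R => tsub z.1 z.2).
Proof.
apply/measurable_fun_tnthP => i.
rewrite (_ : _ \o _ = (fun z : n.-tuple R * n.-tuple R => tnth z.1 i - tnth z.2 i)).
  apply: measurable_funB; apply: (measurableT_comp (measurable_tnth i)).
    exact: measurable_fst.
  exact: measurable_snd.
by apply/funext => z /=; rewrite tnth_mktuple.
Qed.

Lemma measurable_heatN_tsub n t (x : n.-tuple R) :
  measurable_fun setT (fun y => heatN t (tsub x y)).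
Proof.
apply: (measurableT_comp (@measurable_heatN n) (g := fun y => (t, tsub x y))).
apply: measurable_fun_pair; first exact: measurable_cst.
exact: (measurableT_comp (@measurable_tsub n) (measurable_pair1 x)).
Qed.

Lemma measurable_heatN1 n t : measurable_fun setT (@heatN n t).
Proof. exact: (measurableT_comp (@measurable_heatN n) (measurable_pair1 t)). Qed.

Lemma heatN_semigroup n t s (x : n.-tuple R) : 0 < t -> 0 < s ->
  (\int[lebesgue_tuple n]_y (heatN t (tsub x y) * heatN s y)%:E =
   (heatN (t + s) x)%:E)%E.
Proof.
move=> t0 s0; elim: n x => [|n ih] x.
  rewrite ge0_integral_tuple0 ?/heatN ?big_ord0 ?mul1r//.
  by apply/measurable_EFinP/measurable_funM; [exact: measurable_heatN_tsub|exact: measurable_heatN1].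
rewrite ge0_integral_tupleS; last 2 first.
- by move=> y; rewrite lee_fin mulr_ge0 ?heatN_ge0.
- apply/measurable_EFinP/measurable_funM; [exact: measurable_heatN_tsub|exact: measurable_heatN1].
pose a := thead x; pose b : n.-tuple R := [tuple of behead x].
have hS r z (y : n.-tuple R) : heatN r (tcons (z, y)) = heat1 r z * heatN r y.
  rewrite /heatN big_ord_recl/= tnth0; congr (_ * _).
  by apply: eq_bigr => i _; rewrite tnthS.
have xE : x = tcons (a, b) by rewrite {1}(tuple_eta x).
have sE z y : tsub x (tcons (z, y)) = tcons (a - z, tsub b y).
  apply/eq_from_tnth => i; rewrite tnth_mktuple xE.
  case: (unliftP ord0 i) => [j|] ->; first by rewrite !tnthS tnth_mktuple.
  by rewrite !tnth0.
rewrite {2}xE hS EFinM -ih -heat1_semigroup//.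
rewrite -ge0_integralZr//.
- apply: eq_integral => z _.
  rewrite -ge0_integralZl_EFin//.
  + by apply: eq_integral => y _; rewrite sE !hS -EFinM mulrACA.
  + by move=> y _; rewrite lee_fin mulr_ge0 ?heatN_ge0.
  + apply/measurable_EFinP/measurable_funM; [exact: measurable_heatN_tsub|exact: measurable_heatN1].
  + by rewrite mulr_ge0 ?heat1_ge0.
- apply/measurable_EFinP/measurable_funM.
    rewrite (_ : (fun _ => _) = (fun y => heat1 t (y + (- a)))).
      exact: measurable_heat1_shift.
    by apply/funext => y; rewrite -heat1N opprB.
  rewrite (_ : heat1 s = (fun y => heat1 s (y + 0))); first exact: measurable_heat1_shift.
  by apply/funext => y; rewrite addr0.
- by move=> z _; rewrite ?lee_fin mulr_ge0 ?heat1_ge0.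
- by rewrite ih lee_fin heatN_ge0.
Qed.

End heatN.

(** * One-dimensional integrals of powers and logarithms *)

Section ftc_bounds.
Context {R : realType}.
Implicit Types a b x e g : R.
Notation mu := (@lebesgue_measure R).

Let FTC2_is_derive (f F : R -> R) a b : a < b ->
  (forall x, a <= x <= b -> {for x, continuous f}) ->
  (forall x, a <= x <= b -> is_derive x 1 F (f x)) ->
  (\int[mu]_(x in `[a, b]) (f x)%:E = (F b - F a)%:E)%E.
Proof.
move=> ab cf dF.
have cF x : a <= x <= b -> {for x, continuous F}.
  move=> xab; apply: differentiable_continuous; apply/derivable1_diffP.
  by apply: ex_derive; exact: dF.
rewrite (@continuous_FTC2 _ f F)//.
- apply: continuous_in_subspaceT => x /set_mem/=; rewrite in_itv/= => xab.
  exact: cf.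
- split.
  + move=> x; rewrite in_itv/= => /andP[ax xb]; apply: ex_derive; apply: dF.
    by rewrite !ltW.
  + by apply: cvg_at_right_filter; apply: cF; rewrite lexx ltW.
  + by apply: cvg_at_left_filter; apply: cF; rewrite lexx ltW.
- move=> x; rewrite in_itv/= => /andP[ax xb]; rewrite derive1E.
  have h : is_derive x 1 F (f x) by apply: dF; rewrite !ltW.
  exact: derive_val.
Qed.

(** The fundamental theorem on [[a + (b - a) / (n + 2), b]] and monotone convergence:
the integrand may be singular at [a]. *)
Lemma integral_le_antiderivative (f F : R -> R) a b : a < b ->
  measurable_fun setT f ->
  (forall x, a < x <= b -> 0 <= f x) ->
  (forall x, a < x <= b -> 0 <= F x) ->
  (forall x, a < x <= b -> {for x, continuous f}) ->
  (forall x, a < x <= b -> is_derive x 1 F (f x)) ->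
  (\int[mu]_(x in `]a, b[) (f x)%:E <= (F b)%:E)%E.
Proof.
move=> ab mf f0 F0 cf dF.
pose c (n : nat) := a + (b - a) / n.+2%:R.
have ba0 : 0 < b - a by rewrite subr_gt0.
have ac n : a < c n by rewrite ltrDl divr_gt0.
have cb n : c n < b.
  rewrite -ltrBrDl ltr_pdivrMr// ltr_pMr// ltr1n//.
have cE (n : nat) x : c n <= x <= b -> a < x <= b.
  by move=> /andP[cx ->]; rewrite (lt_le_trans (ac n) cx).
pose S n : set R := `[c n, b]%classic.
have mS n : measurable (S n) by exact: measurable_itv.
have ndS : {homo S : n m / (n <= m)%N >-> (n <= m)%O}.
  move=> n m nm; apply/subsetPset => x; rewrite /S/= !in_itv/= => /andP[cx ->].
  rewrite andbT (le_trans _ cx)// lerD2l ler_pM2l// lef_pV2 ?posrE ?ltr0n//.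
  by rewrite ler_nat !ltnS.
have SU : `]a, b]%classic = \bigcup_n S n.
  apply/seteqP; split => x /=.
    rewrite in_itv/= => /andP[ax xb].
    have xa : 0 < x - a by rewrite subr_gt0.
    have [n nE] : exists n : nat, (b - a) / (x - a) < n%:R.
      by exists (Num.bound ((b - a) / (x - a))); apply: archi_boundP; rewrite divr_ge0// ltW.
    exists n => //; rewrite /S/= in_itv/= xb andbT -lerBrDl.
    rewrite ler_pdivrMr// -ler_pdivrMl// mulrC (le_trans (ltW nE))// ler_nat.
    by rewrite ltnW.
  by move=> [n _]; rewrite /S/= in_itv/= => /cE.
rewrite (@le_trans _ _ (\int[mu]_(x in `]a, b]) (f x)%:E)%E)//.
  apply: ge0_subset_integral => //.
  - exact/measurable_EFinP/measurable_funTS.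
  - by apply: subset_itvl; rewrite bnd_simp.
rewrite SU.
have cvS : (\int[mu]_(x in S n) (f x)%:E)%E @[n --> \oo] -->
    (\int[mu]_(x in \bigcup_n S n) (f x)%:E)%E.
  apply: ge0_nondecreasing_set_cvg_integral => // [n|n x].
    exact/measurable_EFinP/measurable_funTS.
  by rewrite /S/= in_itv/= => /cE xab; rewrite lee_fin f0.
rewrite -(cvg_lim _ cvS)//; apply: lime_le.
  by apply/cvg_ex; eexists; exact: cvS.
near=> n.
rewrite (FTC2_is_derive (cb n) (fun x h => cf x (cE n x h)) (fun x h => dF x (cE n x h))).
by rewrite lee_fin gerBl F0// ac ltW.
Unshelve. all: by end_near. Qed.

Lemma continuous_powR e x : 0 < x -> {for x, continuous (fun y => y `^ e)}.
Proof.
move=> x0; apply: differentiable_continuous; apply/derivable1_diffP.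
by apply: ex_derive; exact: is_derive1_powR.
Qed.

Lemma integral_powR_near0 e t : 0 < e -> 0 < t ->
  (\int[mu]_(x in `]0%R, t[) (x `^ (e - 1))%:E <= (t `^ e / e)%:E)%E.
Proof.
move=> e0 t0; apply: (@integral_le_antiderivative _ (fun x => x `^ e / e)) => //.
- by move=> x _; exact: powR_ge0.
- by move=> x _; rewrite divr_ge0 ?powR_ge0// ltW.
- by move=> x /andP[x0 _]; exact: continuous_powR.
- move=> x /andP[x0 _]; have h := is_derive1_powR e x0.
  rewrite (_ : (fun x => x `^ e / e) = e^-1 *: (fun x => x `^ e)); last first.
    by apply/funext => y; rewrite mulrC.
  by apply: is_derive_eq; rewrite /GRing.scale/= mulKf// gt_eqF.
Qed.

Lemma integral_powR_tail e s r : 0 < e -> 0 < s -> s < r ->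
  (\int[mu]_(x in `]s, r[) (x `^ (- e - 1))%:E <= (s `^ (- e) / e)%:E)%E.
Proof.
move=> e0 s0 sr.
apply: (@le_trans _ _ ((s `^ (- e) / e - r `^ (- e) / e)%:E)); last first.
  by rewrite lee_fin gerBl divr_ge0 ?powR_ge0// ltW.
have pos x : s < x <= r -> 0 < x by move=> /andP[sx _]; exact: lt_trans sx.
apply: (@integral_le_antiderivative _ (fun x => s `^ (- e) / e - x `^ (- e) / e)) => //.
- by move=> x _; exact: powR_ge0.
- move=> x xs; have x0 := pos _ xs; rewrite subr_ge0 ler_wpM2r ?invr_ge0 ?(ltW e0)//.
  rewrite !powRN lef_pV2 ?posrE ?powR_gt0//.
  rewrite ge0_ler_powR ?nnegrE ?(ltW e0) ?(ltW s0) ?(ltW x0)//.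
  by case/andP: xs => /ltW.
- by move=> x /pos; exact: continuous_powR.
- move=> x /pos x0; have h := is_derive1_powR (- e) x0.
  rewrite (_ : (fun x => _) = cst (s `^ (- e) / e) - e^-1 *: (fun x => x `^ (- e))); last first.
    by apply/funext => y; rewrite (mulrC (y `^ _)).
  apply: is_derive_eq; rewrite /GRing.scale/= sub0r mulNr mulrN opprK mulKf//.
  by rewrite gt_eqF.
Qed.

Lemma integral_log_near0 g r : 0 < g -> 0 < r < 1 ->
  (\int[mu]_(x in `]0%R, r[) (x^-1 * (- ln x) `^ (- g - 1))%:E <=
   ((- ln r) `^ (- g) / g)%:E)%E.
Proof.
move=> g0 /andP[r0 r1].
have pos x : 0 < x <= r -> 0 < x /\ 0 < - ln x.
  by move=> /andP[x0 xr]; split => //; rewrite oppr_gt0 ln_lt0// x0 (le_lt_trans xr).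
apply: (@integral_le_antiderivative _ (fun x => (- ln x) `^ (- g) / g)) => //.
- apply: measurable_funM; first exact: measurable_inv.
  apply: (measurableT_comp (measurable_powR _)).
  by apply: measurable_funN; exact: measurable_ln.
- by move=> x /pos[x0 _]; rewrite mulr_ge0 ?powR_ge0// invr_ge0 ltW.
- by move=> x _; rewrite divr_ge0 ?powR_ge0// ltW.
- move=> x /pos[x0 lx0]; apply: cvgM; first by apply: cvgV; [rewrite gt_eqF|exact: cvg_id].
  apply: (@continuous_comp _ _ _ (fun x => - ln x) (fun y => y `^ (- g - 1))).
    by apply: cvgN; exact: continuous_ln.
  exact: continuous_powR.
- move=> x /pos[x0 lx0].
  have h1 : is_derive x (1 : R) (fun x => - ln x) (- x^-1).
    by have h := is_derive1_ln x0; exact: is_deriveN.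
  have h2 := @is_derive1_comp R (fun y => y `^ (- g)) (fun x => - ln x) x _ _ (is_derive1_powR (- g) lx0) h1.
  rewrite (_ : (fun x => _) = g^-1 *: ((fun y => y `^ (- g)) \o (fun x => - ln x))); last first.
    by apply/funext => y; rewrite mulrC.
  by apply: is_derive_eq; rewrite /GRing.scale/=; field; rewrite !gt_eqF.
Qed.

Lemma integral_inv_itv a b : 0 < a -> a < b ->
  (\int[mu]_(x in `[a, b]) (x^-1)%:E = (ln b - ln a)%:E)%E.
Proof.
move=> a0 ab; apply: FTC2_is_derive => // x /andP[ax _].
- by apply: cvgV; [rewrite gt_eqF// (lt_le_trans a0)|exact: cvg_id].
- by apply: is_derive1_ln; rewrite (lt_le_trans a0).
Qed.

(** From [ln y < y] applied to a negative power of [x]. *)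
Lemma powR_log_le g e x : 0 < g -> 0 < e -> 0 < x < 1 ->
  (- ln x) `^ g <= (g / e) `^ g * x `^ (- e).
Proof.
move=> g0 e0 /andP[x0 x1].
have h : - ln x <= (g / e) * x `^ (- (e / g)).
  have := ln_sublinear (powR_gt0 (- (e / g)) x0); rewrite ln_powR => /ltW.
  rewrite mulNr -mulrN -ler_pdivlMl ?divr_gt0// => /le_trans; apply.
  by rewrite invf_div.
have l0 : 0 <= - ln x by rewrite oppr_ge0 ltW// ln_lt0// x0.
apply: (@le_trans _ _ (((g / e) * x `^ (- (e / g))) `^ g)).
  by apply: ge0_ler_powR; rewrite ?nnegrE ?(ltW g0)// mulr_ge0 ?powR_ge0// divr_ge0// ltW.
rewrite powRM ?powR_ge0 ?divr_ge0 ?(ltW g0) ?(ltW e0)// -powRrM.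
by rewrite mulNr divfK// gt_eqF.
Qed.

End ftc_bounds.

(** * Factorisation of the half-space kernels *)

Section kernels.
Context {R : realType} {N : nat}.
Hypothesis N0 : (0 < N)%N.
Notation space := (euclidean_space R N).
Notation spacetime := (space * measurableTypeR R)%type.

Lemma GammaNE (x : space) (t : R) : 0 < t ->
  GammaN x t = heatN t x.1 * heat1 t x.2.
Proof.
move=> t0; rewrite heatNE ?ltW// /GammaN /heat1 mulrACA -expRD -powRD; last first.
  by apply/implyP => _; rewrite gt_eqF// !mulr_gt0 ?pi_gt0.
congr (_ `^ _ * expR _).
  by rewrite -{1}(prednK N0) -natr1; ring.
rewrite /snorm sqr_sqrtr ?addr_ge0 ?sqr_ge0// /xN.
by rewrite mulrDl opprD.
Qed.

Lemma kernelGE (x y : space) (t : R) : 0 < t ->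
  kernelG x y t = heatN t (tsub x.1 y.1) * dir1 t x.2 y.2.
Proof. by move=> t0; rewrite /kernelG GammaNE//= -mulrA -heat1_sub. Qed.

Lemma kernelK0E (x : space) (y : N.-1.-tuple R) (t : R) : 0 < t ->
  @kernelK R N x (y, 0) t = heatN t (tsub x.1 y) * pois1 t x.2.
Proof.
move=> t0; rewrite /kernelK /xN/= ltxx GammaNE//= subr0 /pois1 /xN.
by rewrite mulrCA.
Qed.

Lemma measurable_kernelK (x : space) (t : R) : 0 < t ->
  measurable_fun setT (fun y : space => kernelK x y t).
Proof.
move=> t0.
have m1 : measurable_fun setT (fun y : space => y.1) by exact: measurable_fst.
have m2 : measurable_fun setT (fun y : space => y.2) by exact: measurable_snd.
have mh : measurable_fun setT (fun y : space => heatN t (tsub x.1 y.1)).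
  exact: (measurableT_comp (measurable_heatN_tsub t x.1) m1).
apply: measurable_fun_ifT.
- by apply: measurable_fun_ltr => //; exact: measurable_cst.
- apply: measurable_funM; first exact: (measurableT_comp (@measurable_inv R) m2).
  under eq_fun do rewrite kernelGE//.
  apply: measurable_funM => //.
  apply: (measurableT_comp (@measurable_dir1 R) (g := fun y : space => (t, (x.2, y.2)))).
  by apply: measurable_fun_pair => //; apply: measurable_fun_pair.
- under eq_fun do rewrite GammaNE//.
  apply: measurable_funM; first exact: measurable_cst.
  apply: measurable_funM => //=.
  rewrite (_ : (fun y => _) = (fun y : space => heat1 t (y.2 + - x.2))).
    exact: (measurableT_comp (measurable_heat1_shift t (- x.2)) m2).
  by apply/funext => y; rewrite -heat1N opprB.
Qed.

Lemma kernelK_ge0 (x y : space) (t : R) : 0 < t -> 0 <= x.2 -> 0 <= y.2 ->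
  0 <= @kernelK R N x y t.
Proof.
move=> t0 x0 y0; rewrite /kernelK; case: ifP => _.
  by rewrite mulr_ge0 ?invr_ge0// kernelGE// mulr_ge0 ?heatN_ge0 ?dir1_ge0.
rewrite GammaNE//; apply: mulr_ge0; first by apply: divr_ge0 => //; exact: ltW.
by apply: mulr_ge0; [exact: heatN_ge0|exact: heat1_ge0].
Qed.

Lemma integral_h_measure (p : R) (f : N.-1.-tuple R -> \bar R) :
  (forall x, (0 <= f x)%E) -> measurable_fun setT f ->
  (\int[@h_measure R N p]_x f x = \int[lebesgue_tuple N.-1]_x (f x * (hdens p x)%:E))%E.
Proof.
move=> f0 mf; apply: ge0_integral_density => //.
- by move=> x; exact: hdens_ge0.
- exact: measurable_hdens.
Qed.

(** The Dirac factor makes the datum the image of [h_measure] under the embedding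
of the boundary. *)
Lemma integral_boundary_datum (p : R) (k : {posnum R}) (f : space -> R) :
  (forall x, (@Omega_closure R N) x -> 0 <= f x) -> measurable_fun setT f ->
  (\int[boundary_datum N p k]_(x in (@Omega_closure R N)) (f x)%:E =
   (k%:num)%:E * \int[lebesgue_tuple N.-1]_x (f (x, 0) * hdens p x)%:E)%E.
Proof.
move=> f0 mf.
have mO : measurable (@Omega_closure R N).
  rewrite (_ : (@Omega_closure R N) = snd @^-1` `[0%R, +oo[%classic); last first.
    by apply/seteqP; split => x /=; rewrite /Omega_closure/= in_itv/= andbT.
  rewrite -[X in measurable X]setTI; apply: measurable_snd => //.
have mfO : measurable_fun (@Omega_closure R N) (EFin \o f).
  by apply/measurable_EFinP; exact: measurable_funTS.
rewrite ge0_integral_mscale//; congr (_ * _)%E.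
pose emb (y : N.-1.-tuple R) : space := (y, 0).
have memb : measurable_fun setT emb by apply: measurable_fun_pair.
pose P := measure_function_pushforward__canonical__measure_function_Measure
  (@h_measure R N p) memb.
transitivity (\int[P]_(x in (@Omega_closure R N)) (f x)%:E)%E.
  apply: eq_measure_integral => A mA _.
  rewrite /product_measure1 /= /P /pushforward/=.
  transitivity (\int[@h_measure R N p]_x (\1_(emb @^-1` A) x)%:E)%E.
    apply: eq_integral => x _; rewrite /= diracE indicE.
    rewrite mem_xsection; congr ((nat_of_bool _)%:R%:E).
  rewrite integral_indic// ?setIT//.
  by have := memb measurableT A mA; rewrite setTI.
rewrite ge0_integral_pushforward//; last by move=> x /set_mem ?; rewrite lee_fin f0.
rewrite (_ : emb @^-1` (@Omega_closure R N) = setT); last first.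
  by apply/seteqP; split => // x _; rewrite /emb /Omega_closure/= /xN/=.
rewrite integral_h_measure//.
  by move=> x; rewrite lee_fin f0// /Omega_closure/= /xN/=.
by apply/measurable_EFinP; exact: (measurableT_comp mf memb).
Qed.

Lemma integral_kernelK_boundary (p : R) (k : {posnum R}) (x : space) (t : R) : 0 < t -> 0 < x.2 ->
  (\int[boundary_datum N p k]_(y in (@Omega_closure R N)) (@kernelK R N x y t)%:E =
  (k%:num * pois1 t x.2)%:E *
  \int[lebesgue_tuple N.-1]_y (heatN t (tsub x.1 y) * hdens p y)%:E)%E.
Proof.
move=> t0 x0; rewrite integral_boundary_datum.
- rewrite [in RHS]EFinM -muleA; congr (_ * _)%E.
  rewrite -ge0_integralZl_EFin ?pois1_ge0 ?ltW//.
  + by apply: eq_integral => y _; rewrite kernelK0E// -EFinM mulrAC mulrC.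
  + by move=> y _; rewrite lee_fin mulr_ge0 ?heatN_ge0 ?hdens_ge0.
  + apply/measurable_EFinP/measurable_funM; first exact: measurable_heatN_tsub.
    exact: measurable_hdens.
- by move=> y y0; apply: kernelK_ge0 => //; exact: ltW.
- exact: measurable_kernelK.
Qed.

(** The kernel of the Duhamel term extended by 0 to all pairs of space-time
points: causality and positivity of the last coordinates are part of it, and the
Volterra operator integrates over the whole space-time. *)
Definition kernelD (zz : spacetime * spacetime) : R :=
  if [&& 0 < (zz.2.2 : R), (zz.2.2 : R) < zz.1.2, 0 < (zz.1.1.2 : R) & 0 < (zz.2.1.2 : R)]
  then heatN (zz.1.2 - zz.2.2) (tsub zz.1.1.1 zz.2.1.1) *
       dir1 (zz.1.2 - zz.2.2) zz.1.1.2 zz.2.1.2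
  else 0.

Lemma kernelD_ge0 zz : 0 <= kernelD zz.
Proof.
rewrite /kernelD; case: ifP => // /and4P[t0 ts x0 y0].
by rewrite mulr_ge0 ?heatN_ge0 ?dir1_ge0 ?subr_gt0// ltW.
Qed.

Lemma measurable_kernelD : measurable_fun setT kernelD.
Proof.
have mz : measurable_fun setT (fun zz : spacetime * spacetime => zz.1) by exact: measurable_fst.
have my : measurable_fun setT (fun zz : spacetime * spacetime => zz.2) by exact: measurable_snd.
have mt : measurable_fun setT (fun zz : spacetime * spacetime => zz.1.2 : R).
  exact: (measurableT_comp measurable_snd mz).
have ms : measurable_fun setT (fun zz : spacetime * spacetime => zz.2.2 : R).
  exact: (measurableT_comp measurable_snd my).
have mx1 : measurable_fun setT (fun zz : spacetime * spacetime => zz.1.1).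
  exact: (measurableT_comp measurable_fst mz).
have my1 : measurable_fun setT (fun zz : spacetime * spacetime => zz.2.1).
  exact: (measurableT_comp measurable_fst my).
have mx' : measurable_fun setT (fun zz : spacetime * spacetime => zz.1.1.1).
  exact: (measurableT_comp measurable_fst mx1).
have my' : measurable_fun setT (fun zz : spacetime * spacetime => zz.2.1.1).
  exact: (measurableT_comp measurable_fst my1).
have mx : measurable_fun setT (fun zz : spacetime * spacetime => zz.1.1.2 : R).
  exact: (measurableT_comp measurable_snd mx1).
have myN : measurable_fun setT (fun zz : spacetime * spacetime => zz.2.1.2 : R).
  exact: (measurableT_comp measurable_snd my1).
have mts : measurable_fun setT (fun zz : spacetime * spacetime => (zz.1.2 : R) - zz.2.2).
  exact: measurable_funB.
apply: measurable_fun_ifT; last exact: measurable_cst.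
  apply: measurable_and; first exact: measurable_fun_ltr.
  apply: measurable_and; first exact: measurable_fun_ltr.
  by apply: measurable_and; exact: measurable_fun_ltr.
apply: measurable_funM.
  apply: (measurableT_comp (@measurable_heatN R N.-1)
    (g := fun zz : spacetime * spacetime => ((zz.1.2 : R) - zz.2.2, tsub zz.1.1.1 zz.2.1.1))).
  apply: measurable_fun_pair => //.
  apply: (measurableT_comp (@measurable_tsub R N.-1)
    (g := fun zz : spacetime * spacetime => (zz.1.1.1, zz.2.1.1))).
  exact: measurable_fun_pair.
apply: (measurableT_comp (@measurable_dir1 R)
    (g := fun zz : spacetime * spacetime => ((zz.1.2 : R) - zz.2.2, (zz.1.1.2 : R, zz.2.1.2 : R)))).
by apply: measurable_fun_pair => //; exact: measurable_fun_pair.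
Qed.

End kernels.

(** * The mild equation as a Volterra equation *)

Section reformulation.
Context {R : realType} {N : nat}.
Hypothesis N0 : (0 < N)%N.
Notation space := (euclidean_space R N).
Notation spacetime := (space * measurableTypeR R)%type.
Notation leb := (@spacetime_lebesgue R N).
Local Open Scope ereal_scope.

Lemma measurable_Omega : measurable (@Omega R N).
Proof.
rewrite (_ : @Omega R N = snd @^-1` `]0%R, +oo[%classic); last first.
  by apply/seteqP; split => x /=; rewrite /Omega/= in_itv/= andbT.
by rewrite -[X in measurable X]setTI; apply: measurable_snd.
Qed.

Lemma Q_E (T : R) : @Q_ R N T = @Omega R N `*` `]0%R, T[%classic.
Proof. by apply/seteqP; split => z /=; rewrite /Q_/= in_itv. Qed.

Lemma measurable_Q_ (T : R) : measurable (@Q_ R N T).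
Proof. by rewrite Q_E; apply: measurableX => //; exact: measurable_Omega. Qed.

Lemma ge0_integral_spacetime (f : spacetime -> \bar R) :
  (forall z, 0 <= f z) -> measurable_fun setT f ->
  \int[leb]_z f z = \int[lebesgue_measure]_s \int[@space_lebesgue R N]_y f (y, s).
Proof.
move=> f0 mf; pose M := (@space_lebesgue R N \x @lebesgue_measure R)%E.
transitivity (\int[M]_z f z); first exact: eq_measure_integral.
exact: (@fubini_tonelli2 _ _ _ _ R (@space_lebesgue R N) (@lebesgue_measure R)).
Qed.

Lemma duhamelE (p : R) (u : spacetime -> \bar R) (x : space) (t : R) :
  (forall z, 0 <= u z) -> measurable_fun setT u -> (0 < x.2)%R ->
  \int[lebesgue_measure]_(s in `]0%R, t[)
    \int[@space_lebesgue R N]_(y in @Omega R N)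
       ((@kernelG R N x y (t - s))%:E * u (y, s) `^ p) =
  \int[leb]_z ((kernelD ((x, t), z))%:E * u z `^ p).
Proof.
move=> u0 mu x0; rewrite ge0_integral_spacetime; last 2 first.
- by move=> z; rewrite mule_ge0 ?poweR_ge0// lee_fin kernelD_ge0.
- apply: emeasurable_funM.
    apply/measurable_EFinP.
    exact: (measurableT_comp (@measurable_kernelD R N) (measurable_pair1 (x, t))).
  exact: (measurableT_comp (measurable_poweR _) mu).
rewrite integral_mkcond; apply: eq_integral => s _.
rewrite patchE; case: ifPn => [/set_mem/=|].
  rewrite in_itv/= => /andP[s0 st].
  rewrite integral_mkcond; apply: eq_integral => y _.
  rewrite patchE; case: ifPn => [/set_mem y0|yO].
    by rewrite /kernelD/= s0 st x0 (y0 : (0 < y.2)%R)/= kernelGE// subr_gt0.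
  rewrite /kernelD/= s0 st x0/=; case: ifPn => [y0|_]; last by rewrite mul0e.
  by move: yO; rewrite notin_setE => /(_ y0).
move=> sn; rewrite integral0_eq// => y _; rewrite /kernelD/=.
case: ifPn => [/and4P[s0 st _ _]|_]; last by rewrite mul0e.
by move: sn; rewrite notin_setE/= in_itv/= s0 st => /(_ isT).
Qed.

(** Zero outside the half-space and at negative times, as the Volterra operator
lives on the whole space-time. *)
Definition potential (p k : R) (z : spacetime) : \bar R :=
  (k * (if (0 < (z.2 : R))%R && (0 < (z.1.2 : R))%R then pois1 z.2 z.1.2 else 0%R))%:E *
  \int[lebesgue_tuple N.-1]_y (heatN z.2 (tsub z.1.1 y) * @hdens R N p y)%:E.

Lemma potentialE (p : R) (k : {posnum R}) (x : space) (t : R) : (0 < t)%R -> (0 < x.2)%R ->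
  \int[boundary_datum N p k]_(y in @Omega_closure R N) (@kernelK R N x y t)%:E =
  potential p k%:num (x, t).
Proof. by move=> t0 x0; rewrite integral_kernelK_boundary// /potential /= t0 x0. Qed.

Let potential_int_ge0 (p : R) (z : spacetime) :
  0 <= \int[lebesgue_tuple N.-1]_y (heatN z.2 (tsub z.1.1 y) * @hdens R N p y)%:E.
Proof. by apply: integral_ge0 => y _; rewrite lee_fin mulr_ge0 ?heatN_ge0 ?hdens_ge0. Qed.

Lemma potential_ge0 (p k : R) z : (0 <= k)%R -> 0 <= potential p k z.
Proof.
move=> k0; rewrite mule_ge0 ?potential_int_ge0// lee_fin mulr_ge0//.
by case: ifPn => // /andP[t0 x0]; rewrite pois1_ge0// ltW.
Qed.

Lemma le_potential (p k k' : R) z : (0 <= k <= k')%R -> potential p k z <= potential p k' z.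
Proof.
move=> /andP[k0 kk']; rewrite lee_wpmul2r ?potential_int_ge0// lee_fin ler_wpM2r//.
by case: ifPn => // /andP[t0 x0]; rewrite pois1_ge0// ltW.
Qed.

Lemma measurable_potential (p k : R) : measurable_fun setT (potential p k).
Proof.
apply: emeasurable_funM.
  apply/measurable_EFinP; apply: measurable_funM => //.
  have mt : measurable_fun setT (fun z : spacetime => z.2 : R) by exact: measurable_snd.
  have mx : measurable_fun setT (fun z : spacetime => z.1.2 : R).
    exact: (measurableT_comp measurable_snd measurable_fst).
  apply: measurable_fun_ifT => //.
    by apply: measurable_and; exact: measurable_fun_ltr.
  apply: (measurableT_comp (@measurable_pois1 R) (g := fun z : spacetime => (z.2 : R, z.1.2 : R))).
  exact: measurable_fun_pair.
pose F (zy : spacetime * N.-1.-tuple R) :=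
  (heatN zy.1.2 (tsub zy.1.1.1 zy.2) * @hdens R N p zy.2)%:E.
apply: (@measurable_fun_fubini_tonelli_F _ _ _ _ R (@lebesgue_tuple R N.-1) F).
  apply/measurable_EFinP; apply: measurable_funM; last first.
    exact: (measurableT_comp (@measurable_hdens R N p) measurable_snd).
  apply: (measurableT_comp (@measurable_heatN R N.-1)
    (g := fun zy : spacetime * N.-1.-tuple R => (zy.1.2 : R, tsub zy.1.1.1 zy.2))).
  apply: measurable_fun_pair; first exact: (measurableT_comp measurable_snd measurable_fst).
  apply: (measurableT_comp (@measurable_tsub R N.-1)
    (g := fun zy : spacetime * N.-1.-tuple R => (zy.1.1.1, zy.2))).
  apply: measurable_fun_pair => //.
  apply: (measurableT_comp measurable_fst); exact: (measurableT_comp measurable_fst measurable_fst).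
by move=> zy; rewrite lee_fin mulr_ge0 ?heatN_ge0 ?hdens_ge0.
Qed.

Definition mild (p k : R) := volterra leb (@kernelD R N) (potential p k) p.

Let kernelD_Q (T : R) z z' : Q_ T z -> kernelD (z, z') != 0%R -> @Q_ R N T z'.
Proof.
move=> [_ /andP[_ zT]]; rewrite /kernelD; case: ifPn => [|_]; last by rewrite eqxx.
move=> /and4P[t0 ts x0 y0] _; split => //.
by rewrite t0 (lt_trans ts).
Qed.

(** The least fixed point lies below the supersolution on [Q_ T], hence is
almost everywhere finite there. The set [Q_ T] contains the past of its points. *)
Lemma supersolution_solvable (p T : R) (k : {posnum R}) (v : spacetime -> \bar R) :
  (0 < p)%R -> (0 < T)%R -> measurable_fun setT v ->
  {ae leb, forall z, Q_ T z -> mild p k%:num v z <= v z} ->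
  {ae leb, forall z, Q_ T z -> v z < +oo} ->
  local_in_time_solvable p (boundary_datum N p k).
Proof.
move=> p0 T0 mv supv finv; exists T; split => //.
have k0 : (0 <= k%:num)%R by [].
have [u [u0 mu uE umin]] := @volterra_least_solution _ _ R leb (@kernelD R N)
  (potential p k%:num) p (@kernelD_ge0 R N) (@measurable_kernelD R N)
  (fun z => potential_ge0 p z k0) (@measurable_potential p k%:num) p0.
exists u; split.
  split => //; first exact: measurable_funTS.
  have := umin (Q_ T) v mv (@kernelD_Q T) supv.
  apply: filterS2 finv => z finv uv Qz.
  by rewrite ge0_fin_numE// (le_lt_trans (uv Qz))// finv.
apply: aeW => -[x t] [/= x0 /andP[t0 tT]].
by rewrite potentialE// duhamelE// uE.
Qed.

Lemma lebesgue_tuple_neq0 n : @lebesgue_tuple R n setT != 0.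
Proof.
apply/eqP => l0; have := @heatN_semigroup R n 1 1 [tuple 0%R | i < n] ltr01 ltr01.
have mf : measurable_fun setT (fun y : n.-tuple R =>
    (heatN 1 (tsub [tuple 0%R | i < n] y) * heatN 1 y)%:E).
  by apply/measurable_EFinP/measurable_funM; [exact: measurable_heatN_tsub|exact: measurable_heatN1].
have := integral_abs_eq0 measurableT mf l0.
rewrite (eq_integral (fun y : n.-tuple R =>
    (heatN 1 (tsub [tuple 0%R | i < n] y) * heatN 1 y)%:E)); last first.
  by move=> y _; rewrite gee0_abs// lee_fin mulr_ge0 ?heatN_ge0.
move=> -> [] /esym/eqP; rewrite gt_eqF//; apply: prodr_gt0 => i _.
exact: heat1_gt0.
Qed.

(** A solution satisfies the equation only almost everywhere. Its image under the
operator is defined and satisfies the equation at every point of [Q_ T], because the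
operator does not see null sets. A point where it is finite exists as [Q_ T] has
positive measure. *)
Lemma solvable_mild (p : R) (k : {posnum R}) : (0 < p)%R ->
  local_in_time_solvable p (boundary_datum N p k) ->
  exists (T : R) (v : spacetime -> \bar R), (0 < T)%R /\
  [/\ measurable_fun setT v, (forall z, 0 <= v z),
    (forall z, Q_ T z -> v z = mild p k%:num v z),
    {ae leb, forall z, Q_ T z -> v z < +oo} &
    (exists z0, Q_ T z0 /\ v z0 < +oo)].
Proof.
move=> p0 [T [T0 [u [[u0 mu finu] uE]]]].
have k0 : (0 <= k%:num)%R by [].
pose u1 := u \_ (@Q_ R N T).
have u10 z : 0 <= u1 z.
  by rewrite /u1 patchE; case: ifPn => // /set_mem; exact: u0.
have mu1 : measurable_fun setT u1.
  by apply/(measurable_restrictT u (measurable_Q_ T)).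
(* [u1] satisfies the equation almost everywhere, its image everywhere *)
pose v := mild p k%:num u1.
have mv : measurable_fun setT v.
  apply: measurable_volterra => //.
  - exact: kernelD_ge0.
  - exact: measurable_kernelD.
  - exact: measurable_potential.
have v0 z : 0 <= v z.
  apply: volterra_ge0; [exact: kernelD_ge0|by move=> y; exact: potential_ge0].
have uv : {ae leb, forall z, Q_ T z -> u z = v z}.
  apply: filterS uE => -[x t] uE Qz; rewrite (uE Qz).
  case: (Qz) => /= x0 /andP[t0 tT].
  rewrite /v /mild /volterra -(potentialE p k t0 x0) -(duhamelE p t u10 mu1 x0).
  congr (_ + _); apply: eq_integral => s /set_mem/=; rewrite in_itv/= => /andP[s0 st].
  apply: eq_integral => y /set_mem y0; rewrite /u1 patchE mem_set//.
  by split => //=; rewrite s0 (lt_trans st).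
have u1v : {ae leb, forall z, Q_ T z -> u1 z = v z}.
  apply: filterS uv => z uv Qz; rewrite -uv//.
  by rewrite /u1 patchE mem_set.
have finv : {ae leb, forall z, Q_ T z -> v z < +oo}.
  apply: filterS2 finu uv => z finu uv Qz; rewrite -uv//.
  by have := finu Qz; rewrite ge0_fin_numE// u0.
exists T, v; split => //; split => //.
  move=> z Qz; apply/eqP; rewrite eq_le {1}/v; apply/andP; split.
    apply: le_volterra => //; [exact: kernelD_ge0|exact: measurable_kernelD|].
    by apply: filterS u1v => y u1v ky; rewrite u1v//; exact: (kernelD_Q Qz ky).
  apply: le_volterra => //; [exact: kernelD_ge0|exact: measurable_kernelD|].
  by apply: filterS u1v => y u1v ky; rewrite u1v//; exact: (kernelD_Q Qz ky).
apply: contrapT => nex.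
have [B [mB B0 sB]] := finv.
have QB : @Q_ R N T `<=` B.
  move=> z Qz; apply: sB => /(_ Qz) vz; apply: nex; by exists z.
have : leb (@Q_ R N T) = 0.
  by apply: (subset_measure0 _ mB QB B0); exact: measurable_Q_.
have mI : measurable (`]0%R, T[%classic : set R) by exact: measurable_itv.
have mO := measurable_Omega.
have OE : @Omega R N = setT `*` `]0%R, +oo[%classic.
  by apply/seteqP; split => y /=; rewrite /Omega/= in_itv/= andbT; tauto.
have E1 : leb (@Q_ R N T) = @space_lebesgue R N (@Omega R N) * lebesgue_measure (`]0%R, T[%classic : set R).
  by rewrite Q_E; exact: (product_measure1E (@space_lebesgue R N) (@lebesgue_measure R) mO mI).
have E2 : @space_lebesgue R N (@Omega R N) =
    @lebesgue_tuple R N.-1 setT * lebesgue_measure (`]0%R, +oo[%classic : set R).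
  rewrite OE; apply: (product_measure1E (@lebesgue_tuple R N.-1) (@lebesgue_measure R)) => //.
rewrite E1 E2 !lebesgue_measure_itv/= ltry lte_fin T0 sube0 oppr0 adde0.
move/eqP; rewrite !mule_eq0 (negbTE (lebesgue_tuple_neq0 _))/= => /eqP -[T00].
by rewrite T00 ltxx in T0.
Qed.

(** A solution for the larger datum is a supersolution for the smaller one. *)
Lemma solvable_le (p : R) (k k' : {posnum R}) : (0 < p)%R -> (k%:num <= k'%:num)%R ->
  local_in_time_solvable p (boundary_datum N p k') ->
  local_in_time_solvable p (boundary_datum N p k).
Proof.
move=> p0 kk' /(solvable_mild p0)[T [v [T0 [mv v0 vE finv _]]]].
apply: (@supersolution_solvable p T k v) => //.
apply: aeW => z Qz; rewrite [leRHS]vE// /mild /volterra leeD2r//.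
by apply: le_potential; rewrite kk' andbT.
Qed.

End reformulation.

(** * Mixtures of heat kernels *)

Section product_integrals.
Context {R : realType} {N : nat}.
Hypothesis N0 : (0 < N)%N.
Notation space := (euclidean_space R N).
Notation spacetime := (space * measurableTypeR R)%type.
Notation leb := (@spacetime_lebesgue R N).
Local Open Scope ereal_scope.

Lemma integral_space_sep (f : N.-1.-tuple R -> \bar R) (g : R -> \bar R) :
  (forall y, 0 <= f y) -> measurable_fun setT f ->
  (forall y, 0 <= g y) -> measurable_fun setT g ->
  \int[@space_lebesgue R N]_y (f y.1 * g y.2) =
  (\int[lebesgue_tuple N.-1]_y f y) * \int[lebesgue_measure]_y g y.
Proof.
move=> f0 mf g0 mg.
have mfg : measurable_fun setT (fun y : space => f y.1 * g y.2).
  apply: emeasurable_funM; first exact: (measurableT_comp mf measurable_fst).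
  exact: (measurableT_comp mg measurable_snd).
pose M := (@lebesgue_tuple R N.-1 \x @lebesgue_measure R)%E.
transitivity (\int[M]_y (f y.1 * g y.2)); first exact: eq_measure_integral.
rewrite (@fubini_tonelli1 _ _ _ _ R (@lebesgue_tuple R N.-1) (@lebesgue_measure R) _ mfg); last first.
  by move=> y; rewrite mule_ge0.
rewrite -ge0_integralZr//; last exact: integral_ge0.
by apply: eq_integral => y _; rewrite /fubini_F/= ge0_integralZl.
Qed.

Lemma heatN_tsubC n (x y : n.-tuple R) (t : R) : heatN t (tsub x y) = heatN t (tsub y x).
Proof.
by apply: eq_bigr => i _; rewrite !tnth_mktuple -heat1N opprB.
Qed.

Lemma measurable_dir1r (t x : R) : measurable_fun setT (dir1 t x).
Proof.
apply: (measurableT_comp (@measurable_dir1 R) (g := fun y : R => (t, (x, y)))).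
by apply: measurable_fun_pair => //; apply: measurable_fun_pair.
Qed.

Lemma measurable_pois1r (t : R) : measurable_fun setT (@pois1 R t).
Proof.
apply: (measurableT_comp (@measurable_pois1 R) (g := fun y : R => (t, y))).
by apply: measurable_fun_pair.
Qed.

Lemma dir1_pois1_pos (t s x : R) : (0 < t)%R -> (0 < s)%R -> (0 < x)%R ->
  \int[lebesgue_measure]_y (if (0 < y)%R then dir1 t x y * pois1 s y else 0)%:E
  = (pois1 (t + s) x)%:E.
Proof.
move=> t0 s0 x0; rewrite -dir1_pois1// [RHS]integral_mkcond.
apply: eq_integral => y _; rewrite patchE.
case: ifPn => y0; first by rewrite mem_set//= in_itv/= y0.
by rewrite memNset//= in_itv/= andbT; exact/negP.
Qed.

Let pos_dir1_pois1_ge0 (t s x y : R) : (0 < t)%R -> (0 < s)%R -> (0 < x)%R ->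
  (0 <= if (0 < y)%R then dir1 t x y * pois1 s y else 0)%R.
Proof.
move=> t0 s0 x0; case: ifPn => // y0.
by rewrite mulr_ge0 ?dir1_ge0 ?pois1_ge0// ltW.
Qed.

Let measurable_pos_dir1_pois1 (t s x : R) :
  measurable_fun setT (fun y : R => (if (0 < y)%R then dir1 t x y * pois1 s y else 0)%:E).
Proof.
apply/measurable_EFinP; apply: measurable_fun_ifT => //.
- exact: measurable_fun_ltr.
- by apply: measurable_funM; [exact: measurable_dir1r|exact: measurable_pois1r].
Qed.

Lemma integral_kernelD_pois1 (x : space) (t s : R) (f : N.-1.-tuple R -> \bar R) :
  (0 < s < t)%R -> (0 < x.2)%R -> (forall y, 0 <= f y) -> measurable_fun setT f ->
  \int[@space_lebesgue R N]_y ((kernelD ((x, t), (y, s)))%:E * ((pois1 s y.2)%:E * f y.1)) =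
  (pois1 t x.2)%:E * \int[lebesgue_tuple N.-1]_y ((heatN (t - s) (tsub x.1 y))%:E * f y).
Proof.
move=> /andP[s0 st] x0 f0 mf; have ts0 : (0 < t - s)%R by rewrite subr_gt0.
rewrite -(subrK s t) -dir1_pois1_pos// (subrK s t) muleC -integral_space_sep//.
- apply: eq_integral => y _; rewrite /kernelD/= s0 st x0/=.
  case: ifPn => y0; last by rewrite mul0e mule0.
  by rewrite !EFinM -!muleA; congr (_ * _); rewrite [in RHS]muleC -!muleA.
- by move=> y; rewrite mule_ge0// lee_fin heatN_ge0.
- by apply: emeasurable_funM => //; apply/measurable_EFinP; exact: measurable_heatN_tsub.
- by move=> y; rewrite lee_fin pos_dir1_pois1_ge0.
Qed.

Lemma integral_pois1_kernelD (y : space) (t s : R) : (0 < s < t)%R -> (0 < y.2)%R ->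
  \int[@space_lebesgue R N]_(x in @Omega R N)
    ((pois1 t x.2 * heatN t x.1)%:E * (kernelD ((x, t), (y, s)))%:E) =
  (pois1 (t - s + t) y.2 * heatN (t - s + t) y.1)%:E.
Proof.
move=> /andP[s0 st] y0; have ts0 : (0 < t - s)%R by rewrite subr_gt0.
have t0 := lt_trans s0 st.
rewrite EFinM -dir1_pois1_pos// -heatN_semigroup// muleC -integral_space_sep//.
- rewrite integral_mkcond; apply: eq_integral => x _.
  rewrite patchE; case: ifPn => [/set_mem xO|xO].
    have x0 : (0 < x.2)%R by [].
    rewrite /kernelD/= s0 st x0 y0/= -!EFinM heatN_tsubC (dir1C _ x.2); congr (_%:E); ring.
  have -> : (0 < x.2)%R = false by apply/negbTE; apply: contraNN xO => x0; exact: mem_set.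
  by rewrite mule0.
- by move=> x; rewrite lee_fin mulr_ge0 ?heatN_ge0.
- apply/measurable_EFinP/measurable_funM; [exact: measurable_heatN_tsub|exact: measurable_heatN1].
- by move=> x; rewrite lee_fin pos_dir1_pois1_ge0.
Qed.

End product_integrals.

Section superposition.
Context {R : realType} (n : nat).
Implicit Types (w : R -> R) (r t s : R).
Local Open Scope ereal_scope.

(** Superpositions of heat kernels at the shifted times [t + s]: a family with a
prescribed singularity at [t = 0] on which the heat flow acts explicitly. *)
Definition heat_mix w r t (x : n.-tuple R) : \bar R :=
  \int[lebesgue_measure]_(s in `]0%R, r[) (w s * heatN (t + s) x)%:E.

Variables (w : R -> R) (r : R).
Hypotheses (w0 : forall s, (0 <= w s)%R) (mw : measurable_fun setT w).

Lemma heat_mix_ge0 t x : 0 <= heat_mix w r t x.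
Proof. by apply: integral_ge0 => s _; rewrite lee_fin mulr_ge0 ?heatN_ge0. Qed.

Let integrand_measurable :
  measurable_fun setT (fun z : (R * n.-tuple R) * R => (w z.2 * heatN (z.1.1 + z.2) z.1.2)%R).
Proof.
apply: measurable_funM; first exact: (measurableT_comp mw measurable_snd).
apply: (measurableT_comp (@measurable_heatN R n)
  (g := fun z : (R * n.-tuple R) * R => ((z.1.1 + z.2)%R, z.1.2))).
apply: measurable_fun_pair; last exact: (measurableT_comp measurable_snd measurable_fst).
apply: measurable_funD; last exact: measurable_snd.
exact: (measurableT_comp measurable_fst measurable_fst).
Qed.

Lemma measurable_heat_mix : measurable_fun setT (fun z : R * n.-tuple R => heat_mix w r z.1 z.2).
Proof.
pose F (z : (R * n.-tuple R) * R) : \bar R :=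
  if (0 < z.2 < r)%R then (w z.2 * heatN (z.1.1 + z.2) z.1.2)%:E else 0.
have -> : (fun z : R * n.-tuple R => heat_mix w r z.1 z.2) = fubini_F lebesgue_measure F.
  apply/funext => z; rewrite /heat_mix integral_mkcond; apply: eq_integral => s _.
  by rewrite patchE /F/= mem_setE in_itv.
apply: measurable_fun_fubini_tonelli_F.
  apply: measurable_fun_ifT => //; last exact/measurable_EFinP.
  by apply: measurable_and; apply: measurable_fun_ltr.
by move=> z; rewrite /F; case: ifP => //; rewrite lee_fin mulr_ge0 ?heatN_ge0.
Qed.

(** Tonelli and the semigroup law of the heat kernel under the integral sign. *)
Lemma heat_mix_semigroup t s (x : n.-tuple R) : (0 < t)%R -> (0 <= s)%R ->
  \int[lebesgue_tuple n]_y ((heatN t (tsub x y))%:E * heat_mix w r s y) =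
  heat_mix w r (t + s) x.
Proof.
move=> t0 s0.
pose F (z : n.-tuple R * R) : \bar R := if (0 < z.2 < r)%R then
  (heatN t (tsub x z.1) * (w z.2 * heatN (s + z.2) z.1))%:E else 0.
have F0 z : 0 <= F z.
  by rewrite /F; case: ifP => // _; rewrite lee_fin !mulr_ge0 ?heatN_ge0.
have mF : measurable_fun setT F.
  apply: measurable_fun_ifT => //.
    by apply: measurable_and; apply: measurable_fun_ltr.
  apply/measurable_EFinP/measurable_funM.
    exact: (measurableT_comp (measurable_heatN_tsub t x) measurable_fst).
  apply: (measurableT_comp integrand_measurable (g := fun z : n.-tuple R * R => ((s, z.1), z.2))).
  by apply: measurable_fun_pair => //; apply: measurable_fun_pair.
transitivity (\int[lebesgue_tuple n]_y \int[lebesgue_measure]_u F (y, u)).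
  apply: eq_integral => y _; rewrite /heat_mix integral_mkcond -ge0_integralZl_EFin ?heatN_ge0//.
  - apply: eq_integral => u _; rewrite patchE /F/= mem_setE in_itv/=.
    by case: ifP; rewrite ?mule0// EFinM.
  - by move=> u _; rewrite patchE; case: ifP => // _; rewrite lee_fin mulr_ge0 ?heatN_ge0.
  - have mI : measurable (`]0%R, r[%classic : set R) by exact: measurable_itv.
    apply/(measurable_restrictT _ mI).
    apply/measurable_EFinP; apply: measurable_funTS.
    apply: (measurableT_comp integrand_measurable (g := fun u : R => ((s, y), u))).
    by apply: measurable_fun_pair => //; apply: measurable_fun_pair.
rewrite fubini_tonelli// /heat_mix [RHS]integral_mkcond; apply: eq_integral => u _.
rewrite patchE /F/= mem_setE in_itv/=; case: ifPn => [/andP[u0 ur]|_]; last first.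
  by rewrite integral0_eq.
rewrite EFinM -(addrA t s u) -heatN_semigroup//; last by rewrite ltr_wpDl.
rewrite -ge0_integralZl_EFin//.
- by apply: eq_integral => y _; rewrite -EFinM mulrCA.
- by move=> y _; rewrite lee_fin mulr_ge0 ?heatN_ge0.
- apply/measurable_EFinP/measurable_funM; [exact: measurable_heatN_tsub|exact: measurable_heatN1].
Qed.

End superposition.

Lemma heat_mix_fineE (R : realType) n (w : R -> R) (r t : R) (x : n.-tuple R) :
  (forall s, 0 <= w s) -> (heat_mix w r t x < +oo)%E ->
  heat_mix w r t x = (fine (heat_mix w r t x))%:E.
Proof. by move=> w0 h; rewrite fineK// ge0_fin_numE// heat_mix_ge0. Qed.

(** * Supersolutions built from two mixtures *)

Section existence_criterion.
Context {R : realType} {N : nat}.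
Hypothesis N0 : (0 < N)%N.
Notation space := (euclidean_space R N).
Notation spacetime := (space * measurableTypeR R)%type.
Notation leb := (@spacetime_lebesgue R N).

(** With [u = y / sqrt s] the quantity is [s^-1 * u * expR (- u ^ 2 / 4)] up to a
factor at most 1, and [u <= 1 + u ^ 2 / 4]. *)
Lemma pois1_le (s y : R) : 0 < s -> 0 <= y -> pois1 s y <= s^-1.
Proof.
move=> s0 y0; have r0 : 0 < Num.sqrt s by rewrite sqrtr_gt0.
have E : s = Num.sqrt s ^+ 2 by rewrite sqr_sqrtr ?ltW.
pose u := y / Num.sqrt s.
have h1 : (4 * pi * s) `^ (- 2^-1) <= (Num.sqrt s)^-1.
  rewrite powRN powR12_sqrt ?mulr_ge0 ?pi_ge0 ?(ltW s0)// lef_pV2 ?posrE//; last first.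
    by rewrite sqrtr_gt0 !mulr_gt0 ?pi_gt0.
  rewrite ler_sqrt ?mulr_ge0 ?pi_ge0 ?(ltW s0)// -{1}(mul1r s) ler_wpM2r ?(ltW s0)//.
  by have := @pi_ge2 R; lra.
have h2 : u * expR (- (y ^+ 2 / (4 * s))) <= 1.
  have -> : y ^+ 2 / (4 * s) = u ^+ 2 / 4.
    by rewrite /u {1}E; field; rewrite gt_eqF.
  rewrite expRN ler_pdivrMr ?expR_gt0// mul1r.
  apply: le_trans (expR_ge1Dx _).
  by have := sqr_ge0 (u / 2 - 1); rewrite !expr2; lra.
have -> : pois1 s y = s^-1 * (4 * pi * s) `^ (- 2^-1) * Num.sqrt s *
    (u * expR (- (y ^+ 2 / (4 * s)))).
  by rewrite /pois1 /heat1 /u; field; rewrite !gt_eqF.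
apply: (@le_trans _ _ (s^-1 * (Num.sqrt s)^-1 * Num.sqrt s * 1)); last first.
  by rewrite mulr1 divfK// gt_eqF.
apply: ler_pM => //.
- by rewrite !mulr_ge0 ?invr_ge0 ?powR_ge0 ?(ltW s0)// ltW.
- by rewrite mulr_ge0 ?expR_ge0// divr_ge0// ltW.
- by rewrite ler_wpM2r ?(ltW r0)// ler_wpM2l ?invr_ge0 ?(ltW s0).
Qed.

Lemma powR_add_le (p a b : R) : 0 <= p -> 0 <= a -> 0 <= b ->
  (a + b) `^ p <= 2 `^ p * (a `^ p + b `^ p).
Proof.
move=> p0 a0 b0; wlog ab : a b a0 b0 / a <= b.
  move=> H; case: (leP a b) => [|/ltW] ab; first exact: H.
  by rewrite addrC (addrC (a `^ p)); exact: H.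
apply: (@le_trans _ _ ((2 * b) `^ p)).
  by apply: ge0_ler_powR; rewrite ?nnegrE ?addr_ge0 ?mulr_ge0//; lra.
by rewrite powRM// ler_wpM2l ?powR_ge0// lerDr powR_ge0.
Qed.

(** Pointwise form of the estimate on the nonlinearity: one factor of [q] is kept
for the semigroup law and the other [p - 1] are bounded by [s^-1]. *)
Lemma supersolution_pow_le (p B q a b eta s A C : R) : 1 < p -> 0 <= B -> 0 <= q ->
  0 <= a -> 0 <= b -> 0 <= eta -> 0 < s -> q <= s^-1 ->
  a `^ p <= C * A * b -> eta `^ p * b `^ (p - 1) <= C * A ->
  (B * q * (a + eta * b)) `^ p <=
  B `^ p * (2 `^ p * 2 * C) * (A * s `^ (1 - p)) * (q * b).
Proof.
move=> p1 B0 q0 a0 b0 e0 s0 qs h1 h2.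
have p0 : 0 < p by exact: lt_trans p1.
have qp : q `^ p <= q * s `^ (1 - p).
  have -> : s `^ (1 - p) = s^-1 `^ (p - 1).
    by rewrite -powR_inv1 ?(ltW s0)// -powRrM; congr (_ `^ _); ring.
  rewrite -(mulr_powRB1 q0 p0) ler_wpM2l//.
  by apply: ge0_ler_powR; rewrite ?nnegrE ?invr_ge0 ?subr_ge0 ?(ltW p1) ?(ltW s0).
have hb : (eta * b) `^ p <= C * A * b.
  rewrite powRM// -(mulr_powRB1 b0 p0) mulrCA mulrC.
  by rewrite ler_wpM2r.
rewrite powRM ?mulr_ge0 ?addr_ge0 ?mulr_ge0// powRM//.
apply: (@le_trans _ _ (B `^ p * (q * s `^ (1 - p)) * (2 `^ p * (C * A * b + C * A * b)))).
  apply: ler_pM; rewrite ?mulr_ge0 ?powR_ge0 ?ler_wpM2l ?powR_ge0//.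
  apply: (le_trans (powR_add_le (ltW p0) a0 _)); first by rewrite mulr_ge0.
  by rewrite ler_wpM2l ?powR_ge0// lerD.
by apply: eqW; ring.
Qed.

Section criterion.
Variables (p T r C0 C1 : R) (wh wf eta A : R -> R).
Hypotheses (p1 : 1 < p) (T0 : 0 < T) (C00 : 0 < C0) (C10 : 0 < C1).
Hypotheses (wh0 : forall s, 0 <= wh s) (mwh : measurable_fun setT wh).
Hypotheses (wf0 : forall s, 0 <= wf s) (mwf : measurable_fun setT wf).
Hypotheses (eta0 : forall s, 0 <= eta s) (meta : measurable_fun setT eta).
Hypotheses (A0 : forall s, 0 <= A s) (mA : measurable_fun setT A).
Notation Ph := (@heat_mix R N.-1 wh r).
Notation Pf := (@heat_mix R N.-1 wf r).
Hypothesis hP : forall y, ((@hdens R N p y)%:E <= C0%:E * Ph 0 y)%E.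
Hypothesis finP : forall s x, 0 < s < T -> (Ph s x < +oo)%E /\ (Pf s x < +oo)%E.
Hypothesis H1 : forall s x, 0 < s < T ->
  fine (Ph s x) `^ p <= C1 * A s * fine (Pf s x).
Hypothesis H2 : forall s x, 0 < s < T ->
  eta s `^ p * fine (Pf s x) `^ (p - 1) <= C1 * A s.
Hypothesis H3 : forall t, 0 < t < T ->
  (\int[lebesgue_measure]_(s in `]0%R, t[) (A s * s `^ (1 - p))%:E <= (C1 * eta t)%:E)%E.

Let D := 2 `^ p * 2 * C1 * C1.
Let B := D `^ (- (p - 1)^-1).

Let D_gt0 : 0 < D.
Proof. by rewrite !mulr_gt0// powR_gt0. Qed.

Let B_gt0 : 0 < B.
Proof. exact: powR_gt0. Qed.

Let BD : B `^ p * (2 `^ p * 2 * C1) * C1 = B.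
Proof.
have e : B `^ (p - 1) = D^-1.
  rewrite /B -powRrM mulNr mulVf ?powR_inv1 ?(ltW D_gt0)//.
  by rewrite gt_eqF// subr_gt0.
rewrite -(mulr_powRB1 (ltW B_gt0) (lt_trans ltr01 p1)) e.
transitivity (B * (D^-1 * D)); first by rewrite [in RHS]/D; ring.
by rewrite mulVf ?mulr1// gt_eqF.
Qed.

Local Open Scope ereal_scope.

Let v (z : spacetime) : \bar R :=
  (B * (if (0 < (z.2 : R))%R && (0 < (z.1.2 : R))%R then pois1 z.2 z.1.2 else 0%R))%:E *
  (Ph z.2 z.1.1 + (eta z.2)%:E * Pf z.2 z.1.1).

Let mt : measurable_fun setT (fun z : spacetime => z.2 : R).
Proof. exact: measurable_snd. Qed.

Let mx : measurable_fun setT (fun z : spacetime => z.1.2 : R).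
Proof. exact: (measurableT_comp measurable_snd measurable_fst). Qed.

Let mx' : measurable_fun setT (fun z : spacetime => z.1.1).
Proof. exact: (measurableT_comp measurable_fst measurable_fst). Qed.

Let mpois : measurable_fun setT (fun z : spacetime => pois1 (z.2 : R) z.1.2).
Proof.
apply: (measurableT_comp (@measurable_pois1 R) (g := fun z : spacetime => (z.2 : R, z.1.2 : R))).
exact: measurable_fun_pair.
Qed.

Let mP (w : R -> R) : (forall s, (0 <= w s)%R) -> measurable_fun setT w ->
  measurable_fun setT (fun z : spacetime => @heat_mix R N.-1 w r z.2 z.1.1).
Proof.
move=> w0 mw.
apply: (measurableT_comp (@measurable_heat_mix R N.-1 w r w0 mw) (g := fun z : spacetime => (z.2 : R, z.1.1))).
exact: measurable_fun_pair.
Qed.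

Let mv : measurable_fun setT v.
Proof.
apply: emeasurable_funM.
  apply/measurable_EFinP; apply: measurable_funM => //.
  apply: measurable_fun_ifT => //.
  by apply: measurable_and; exact: measurable_fun_ltr.
apply: emeasurable_funD; first exact: mP.
apply: emeasurable_funM; last exact: mP.
by apply/measurable_EFinP; exact: measurableT_comp.
Qed.

Let G (z : spacetime) : \bar R :=
  (B `^ p * (2 `^ p * 2 * C1) * (A z.2 * (z.2 : R) `^ (1 - p)))%:E *
  ((pois1 z.2 z.1.2)%:E * Pf z.2 z.1.1).

Let vG (z : spacetime) : Q_ T z -> v z `^ p <= G z.
Proof.
move=> [/= z0 tT]; rewrite /v /G; case/andP: (tT) => t0 _.
rewrite (z0 : (0 < z.1.2)%R) t0/=.
have [fh ff] := finP z.1.1 tT.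
rewrite (heat_mix_fineE wh0 fh) (heat_mix_fineE wf0 ff) -!EFinM poweR_EFin lee_fin.
have q0 : (0 <= pois1 z.2 z.1.2)%R by rewrite pois1_ge0 ?ltW.
apply: supersolution_pow_le => //.
- exact: ltW.
- by rewrite fine_ge0// heat_mix_ge0.
- by rewrite fine_ge0// heat_mix_ge0.
- by apply: pois1_le => //; exact: ltW.
- exact: H1.
- exact: H2.
Qed.

Let duhamel_le (x : space) (t : R) : Q_ T (x, t) ->
  \int[leb]_z ((@kernelD R N ((x, t), z))%:E * v z `^ p) <=
  (B * pois1 t x.2)%:E * ((eta t)%:E * Pf t x.1).
Proof.
move=> [/= x0 /andP[t0 tT]].
have mk : measurable_fun setT (fun z => (@kernelD R N ((x, t), z))%:E).
  apply/measurable_EFinP.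
  exact: (measurableT_comp (@measurable_kernelD R N) (measurable_pair1 (x, t))).
have mG : measurable_fun setT G.
  apply: emeasurable_funM; last first.
    by apply: emeasurable_funM; [exact/measurable_EFinP|exact: mP].
  apply/measurable_EFinP; apply: measurable_funM => //; apply: measurable_funM.
    exact: measurableT_comp.
  exact: (measurableT_comp (measurable_powR _) mt).
have kpos z : @kernelD R N ((x, t), z) != 0%R -> [/\ (0 < z.2)%R, (z.2 < t)%R & (0 < z.1.2)%R].
  by rewrite /kernelD/=; case: ifPn => [/and4P[]//|]; rewrite eqxx.
have G0 z : (0 < (z.2 : R))%R -> (0 < (z.1.2 : R))%R -> 0 <= G z.
  move=> z20 z10; rewrite mule_ge0//.
    by rewrite lee_fin !mulr_ge0 ?powR_ge0// ltW.
  by rewrite mule_ge0 ?heat_mix_ge0// lee_fin pois1_ge0 ?ltW.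
have kG0 z : 0 <= (@kernelD R N ((x, t), z))%:E * G z.
  have [->|/kpos[z20 _ z10]] := eqVneq (@kernelD R N ((x, t), z)) 0%R; first by rewrite mul0e.
  by rewrite mule_ge0 ?G0// lee_fin kernelD_ge0.
apply: (@le_trans _ _ (\int[leb]_z ((@kernelD R N ((x, t), z))%:E * G z))).
  apply: ge0_le_integral => //.
  - by move=> z _; rewrite mule_ge0 ?poweR_ge0// lee_fin kernelD_ge0.
  - apply: emeasurable_funM => //; exact: (measurableT_comp (measurable_poweR _) mv).
  - exact: emeasurable_funM.
  - move=> z _; have [->|/kpos[z20 z2t z10]] := eqVneq (@kernelD R N ((x, t), z)) 0%R.
      by rewrite !mul0e.
    rewrite lee_wpmul2l// ?lee_fin ?kernelD_ge0// vG//; split => //.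
    by rewrite z20 (lt_trans z2t).
rewrite ge0_integral_spacetime//; last exact: emeasurable_funM.
pose K := (B `^ p * (2 `^ p * 2 * C1))%R.
apply: (@le_trans _ _ (\int[lebesgue_measure]_(s in `]0%R, t[)
    ((K * pois1 t x.2)%:E * Pf t x.1 * (A s * s `^ (1 - p))%:E))).
  apply: eqW.
  rewrite [RHS]integral_mkcond; apply: eq_integral => s _.
  rewrite patchE mem_setE in_itv/=; case: ifPn => [st|sn]; last first.
    rewrite integral0_eq// => y _; rewrite /kernelD/=; case: ifPn => [/and4P[s0 st _ _]|_]; last by rewrite mul0e.
    by move: sn; rewrite s0 st.
  case/andP: (st) => s0 st'.
  transitivity (\int[@space_lebesgue R N]_y ((K * (A s * s `^ (1 - p)))%:E *
      ((@kernelD R N ((x, t), (y, s)))%:E * ((pois1 s y.2)%:E * Pf s y.1)))).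
    by apply: eq_integral => y _; rewrite /G/= muleCA.
  have mPs : measurable_fun setT (Pf s).
    exact: (measurableT_comp (@measurable_heat_mix R N.-1 wf r wf0 mwf) (measurable_pair1 s)).
  rewrite ge0_integralZl//.
  - rewrite (integral_kernelD_pois1 st x0 (heat_mix_ge0 r wf0 s) mPs).
    rewrite (heat_mix_semigroup r wf0 mwf) ?subr_gt0 ?(ltW s0)// subrK.
    rewrite muleA -EFinM [in RHS]muleAC -EFinM; congr (_%:E * _); ring.
  - apply: emeasurable_funM.
      apply: (measurableT_comp mk (g := fun y : space => (y, s))).
      exact: measurable_fun_pair.
    apply: emeasurable_funM; last exact: (measurableT_comp mPs measurable_fst).
    by apply/measurable_EFinP; exact: (measurableT_comp (measurable_pois1r s) measurable_snd).
  - move=> y _; have [->|/kpos[_ _ /= y0]] := eqVneq (@kernelD R N ((x, t), (y, s))) 0%R.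
      by rewrite mul0e.
    apply: mule_ge0; first by rewrite lee_fin kernelD_ge0.
    by rewrite mule_ge0 ?heat_mix_ge0// lee_fin pois1_ge0// ltW.
  - by rewrite lee_fin /K !mulr_ge0 ?powR_ge0// ltW.
have q0 : (0 <= pois1 t x.2)%R by rewrite pois1_ge0// ltW.
have K0 : (0 <= K)%R by rewrite /K !mulr_ge0 ?powR_ge0// ltW.
have mAs : measurable_fun setT (fun s => A s * s `^ (1 - p))%R.
  by apply: measurable_funM => //; exact: measurable_powR.
rewrite ge0_integralZl//.
- apply: (@le_trans _ _ ((K * pois1 t x.2)%:E * Pf t x.1 * (C1 * eta t)%:E)).
    apply: lee_wpmul2l; last by apply: H3; rewrite t0.
    by rewrite mule_ge0 ?heat_mix_ge0// lee_fin mulr_ge0.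
  rewrite muleAC muleA -!EFinM (_ : (K * pois1 t x.2 * (C1 * eta t) = B * pois1 t x.2 * eta t)%R)//.
  by rewrite -[in RHS]BD -/K; ring.
- by apply/measurable_EFinP; exact: measurable_funTS.
- by move=> s; rewrite /= in_itv/= => /andP[s0 _]; rewrite lee_fin mulr_ge0 ?powR_ge0.
- by rewrite mule_ge0 ?heat_mix_ge0// lee_fin mulr_ge0.
Qed.

(** [Ph] controls the datum, [Pf] controls the nonlinearity of both parts, and the
time factor [eta] absorbs the integral of [A s * s `^ (1 - p)]. The Duhamel term of
the candidate is of order [B `^ p] while the candidate is of order [B], whence a small [B]. *)
Lemma existence_criterion : exists2 kappa0 : R, (0 < kappa0)%R &
  forall k : {posnum R}, (k%:num <= kappa0)%R -> local_in_time_solvable p (boundary_datum N p k).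
Proof.
(* the datum must fit below the part of the candidate carried by [Ph] *)
exists (B / C0)%R; first by rewrite divr_gt0.
move=> k kB.
apply: (@supersolution_solvable R N N0 p T k v) => //; first exact: lt_trans p1.
  apply: aeW => -[x t] Qz; case: (Qz) => /= x0 /andP[t0 tT].
  have xN0 : (0 < x.2)%R by [].
  rewrite /mild /volterra [leRHS]/v/= t0 xN0/= ge0_muleDr ?heat_mix_ge0 ?mule_ge0 ?heat_mix_ge0 ?lee_fin//.
  apply: leeD; last exact: duhamel_le.
  rewrite /potential/= t0 xN0/=.
  have q0 : (0 <= pois1 t x.2)%R by rewrite pois1_ge0// ltW.
  have mPs : measurable_fun setT (Ph 0%R).
    exact: (measurableT_comp (@measurable_heat_mix R N.-1 wh r wh0 mwh) (measurable_pair1 (0%R : R))).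
  have mh : measurable_fun setT (fun y => (heatN t (tsub x.1 y))%:E).
    by apply/measurable_EFinP; exact: measurable_heatN_tsub.
  have hle : \int[lebesgue_tuple N.-1]_y (heatN t (tsub x.1 y) * @hdens R N p y)%:E <=
      C0%:E * Ph t x.1.
    have := heat_mix_semigroup r wh0 mwh x.1 t0 (lexx 0%R); rewrite addr0 => <-.
    rewrite -ge0_integralZl//; last 3 first.
    - exact: emeasurable_funM.
    - by move=> y _; rewrite mule_ge0 ?heat_mix_ge0// lee_fin heatN_ge0.
    - by rewrite lee_fin ltW.
    apply: ge0_le_integral => //.
    - by move=> y _; rewrite lee_fin mulr_ge0 ?heatN_ge0 ?hdens_ge0.
    - apply/measurable_EFinP/measurable_funM; first exact: measurable_heatN_tsub.
      exact: measurable_hdens.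
    - by apply: emeasurable_funM => //; exact: emeasurable_funM.
    - move=> y _; rewrite EFinM muleCA; apply: lee_wpmul2l; first by rewrite lee_fin heatN_ge0.
      exact: hP.
  apply: (@le_trans _ _ ((k%:num * pois1 t x.2)%:E * (C0%:E * Ph t x.1))).
    by apply: lee_wpmul2l; [rewrite lee_fin mulr_ge0|exact: hle].
  rewrite muleA -EFinM; apply: lee_wpmul2r; first exact: heat_mix_ge0.
  by rewrite lee_fin mulrAC ler_wpM2r// -ler_pdivlMr.
apply: aeW => -[x t] [/= x0 tT]; rewrite /v/=; have [fh ff] := finP x.1 tT.
by rewrite (heat_mix_fineE wh0 fh) (heat_mix_fineE wf0 ff) -!EFinM ltry.
Qed.

End criterion.
End existence_criterion.

(** * Bounds on mixtures *)

Section superposition_bounds.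
Context {R : realType} (n : nat).
Implicit Types (w : R -> R) (r t s a b : R) (x : n.-tuple R).
Notation mu := (@lebesgue_measure R).
Notation d2 := (n%:R / 2 : R).

Lemma heatN_le t x : 0 < t -> heatN t x <= t `^ (- d2).
Proof.
move=> t0; rewrite heatNE ?(ltW t0)//.
have pi1 : 1 <= 4 * pi :> R by have := @pi_ge2 R; lra.
rewrite powRM ?mulr_ge0 ?pi_ge0 ?(ltW t0)//.
apply: (@le_trans _ _ (1 * t `^ (- d2) * 1)); last by rewrite mulr1 mul1r.
apply: ler_pM; rewrite ?mulr_ge0 ?powR_ge0 ?expR_ge0//.
  rewrite ler_wpM2r ?powR_ge0// powRN invf_le1 ?powR_gt0 ?(lt_le_trans ltr01)//.
  by rewrite -[leLHS](powRr0 (4 * pi)) ler_powR// divr_ge0.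
by rewrite expR_le1 oppr_le0 divr_ge0 ?sqr_ge0// mulr_ge0// ltW.
Qed.

Lemma heatN_add_le t s x : 0 <= t -> 0 < s -> heatN (t + s) x <= s `^ (- d2).
Proof.
move=> t0 s0; apply: (le_trans (heatN_le _ _)); first by rewrite ltr_wpDl.
rewrite !powRN lef_pV2 ?posrE ?powR_gt0 ?ltr_wpDl//.
by apply: ge0_ler_powR; rewrite ?nnegrE ?divr_ge0 ?addr_ge0 ?(ltW s0)// lerDr.
Qed.

Local Open Scope ereal_scope.

Definition heat_mix_on w a b t x : \bar R :=
  \int[mu]_(s in `]a, b[) (w s * heatN (t + s) x)%:E.

Section bounds.
Variable w : R -> R.
Hypotheses (w0 : forall s, (0 <= w s)%R) (mw : measurable_fun setT w).

Lemma measurable_heat_mix_on_integrand t x :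
  measurable_fun setT (fun s => (w s * heatN (t + s) x)%R).
Proof.
apply: measurable_funM => //.
apply: (measurableT_comp (@measurable_heatN R n) (g := fun s : R => ((t + s)%R, x))).
by apply: measurable_fun_pair => //; apply: measurable_funD.
Qed.

Lemma heat_mix_on_ge0 a b t x : 0 <= heat_mix_on w a b t x.
Proof. by apply: integral_ge0 => s _; rewrite lee_fin mulr_ge0 ?heatN_ge0. Qed.

Lemma heat_mix_split a r t x : (0 < a < r)%R ->
  heat_mix w r t x = heat_mix w a t x + heat_mix_on w a r t x.
Proof.
move=> /andP[a0 ar]; rewrite /heat_mix /heat_mix_on.
have mf D : measurable_fun D (fun s => (w s * heatN (t + s) x)%:E).
  by apply/measurable_EFinP; apply: measurable_funTS; exact: measurable_heat_mix_on_integrand.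
have m1 : measurable (`]0%R, a]%classic : set R) by exact: measurable_itv.
have m2 : measurable (`]a, r[%classic : set R) by exact: measurable_itv.
have E : `]0%R, r[%classic = `]0%R, a]%classic `|` `]a, r[%classic :> set R.
  by apply: itv_bndbnd_setU; rewrite bnd_simp ?(ltW a0)//.
rewrite E ge0_integral_setU//.
- by congr (_ + _); apply/esym/integral_itv_bndo_bndc; exact: mf.
- exact: mf.
- by move=> s _; rewrite lee_fin mulr_ge0 ?heatN_ge0.
- apply/disj_setPS => s [] /=; rewrite !in_itv/= => /andP[_ sa] /andP[as' _].
  by move: as'; rewrite ltNge sa.
Qed.

(** The form in which mixtures are estimated: a pointwise bound of the kernel reduces
the integral to an explicit weight [g]. *)
Lemma heat_mix_on_le_weight (g : R -> R) a b t x (M : R) : (0 <= M)%R -> measurable_fun setT g ->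
  (forall s, (a < s < b)%R -> (0 <= g s)%R) ->
  (forall s, (a < s < b)%R -> (w s * heatN (t + s) x <= M * g s)%R) ->
  heat_mix_on w a b t x <= M%:E * \int[mu]_(s in `]a, b[) (g s)%:E.
Proof.
move=> M0 mg g0 wg; rewrite /heat_mix_on -ge0_integralZl_EFin//; last first.
  by apply/measurable_EFinP; exact: measurable_funTS.
apply: ge0_le_integral => //.
- by move=> s _; rewrite lee_fin mulr_ge0 ?heatN_ge0.
- by apply/measurable_EFinP; apply: measurable_funTS; exact: measurable_heat_mix_on_integrand.
- apply: emeasurable_funM => //; apply/measurable_EFinP; exact: measurable_funTS.
Qed.

(** Only the times of order [|x| ^ 2] are kept, where the kernel is comparable to
[|x| ^ (- n)]. *)
Lemma heat_mix_lower r x (m : R) : (0 <= m)%R -> (0 < enorm x)%R -> (enorm x ^+ 2 <= r)%R ->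
  (forall s, (enorm x ^+ 2 / 2 < s < enorm x ^+ 2)%R -> (m <= w s)%R) ->
  (m * ((4 * pi) `^ (- d2) * expR (- 2^-1) / 2) * (enorm x ^+ 2) `^ (1 - d2))%:E
    <= heat_mix w r 0 x.
Proof.
move=> m0 x0 xr wm.
have [q qE] : {q : R | q = (enorm x ^+ 2)%R} by eexists.
rewrite -qE in xr wm *.
have q0 : (0 < q)%R by rewrite qE exprn_gt0.
pose c : R := (m * ((4 * pi) `^ (- d2) * q `^ (- d2) * expR (- 2^-1)))%R.
have c0 : (0 <= c)%R by rewrite !mulr_ge0 ?powR_ge0 ?expR_ge0.
have mf D : measurable_fun D (fun s => (w s * heatN (0 + s) x)%:E).
  by apply/measurable_EFinP; apply: measurable_funTS; exact: measurable_heat_mix_on_integrand.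
(* [c] bounds the integrand from below for [q / 2 < s < q] *)
apply: (@le_trans _ _ (\int[mu]_(s in `](q / 2)%R, q[) c%:E)).
  rewrite integral_cst//= lebesgue_measure_itv/= lte_fin.
  have -> : (q / 2 < q)%R by lra.
  rewrite -EFinD -EFinM lee_fin /c powRD; last by apply/implyP => _; rewrite gt_eqF.
  by rewrite powRr1 ?(ltW q0)//; apply: eqW; field.
apply: (@le_trans _ _ (\int[mu]_(s in `](q / 2)%R, q[) (w s * heatN (0 + s) x)%:E)).
  apply: ge0_le_integral => //; first exact: mf.
  move=> s; rewrite /= in_itv/= => /andP[s1 s2]; rewrite lee_fin add0r.
  have s0 : (0 < s)%R by rewrite (lt_trans _ s1)// divr_gt0.
  apply: ler_pM => //.
    by rewrite !mulr_ge0 ?powR_ge0 ?expR_ge0.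
    by apply: wm; rewrite s1.
  rewrite heatNE ?(ltW s0)// -powRM ?mulr_ge0 ?pi_ge0 ?(ltW q0)//.
  apply: ler_pM; rewrite ?powR_ge0 ?expR_ge0//.
    rewrite !powRN lef_pV2 ?posrE ?powR_gt0 ?mulr_gt0 ?pi_gt0//.
    apply: ge0_ler_powR; rewrite ?nnegrE ?divr_ge0 ?mulr_ge0 ?pi_ge0 ?(ltW q0) ?(ltW s0)//.
    by rewrite ler_wpM2l ?mulr_ge0 ?pi_ge0// ltW.
  rewrite ler_expR lerN2 -qE ler_pdivrMr ?mulr_gt0//; lra.
apply: ge0_subset_integral => //; first exact: mf.
  by move=> s _; rewrite lee_fin mulr_ge0 ?heatN_ge0.
move=> s; rewrite /= !in_itv/= => /andP[s1 s2]; rewrite (lt_le_trans s2 xr) andbT.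
by rewrite (lt_trans _ s1)// divr_gt0.
Qed.

End bounds.

Lemma le_heat_mix_on (w1 w2 : R -> R) a b t x (M : R) :
  (forall s, (0 <= w1 s)%R) -> measurable_fun setT w1 ->
  (forall s, (0 <= w2 s)%R) -> measurable_fun setT w2 -> (0 <= M)%R ->
  (forall s, (a < s < b)%R -> (w1 s <= M * w2 s)%R) ->
  heat_mix_on w1 a b t x <= M%:E * heat_mix_on w2 a b t x.
Proof.
move=> w10 mw1 w20 mw2 M0 w12.
apply: heat_mix_on_le_weight => //; first exact: measurable_heat_mix_on_integrand.
  by move=> s _; rewrite mulr_ge0 ?heatN_ge0.
by move=> s /w12 ?; rewrite mulrA ler_wpM2r ?heatN_ge0.
Qed.

Lemma heat_mix_le (w : R -> R) a r t x :
  (forall s, (0 <= w s)%R) -> measurable_fun setT w -> (0 < a < r)%R ->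
  heat_mix w a t x <= heat_mix w r t x.
Proof.
by move=> w0 mw ar; rewrite [leRHS](heat_mix_split w0 mw t x ar) leeDl// heat_mix_on_ge0.
Qed.

End superposition_bounds.

Lemma powRD_gt0 (R : realType) (x a b : R) : 0 < x -> x `^ a * x `^ b = x `^ (a + b).
Proof. by move=> x0; rewrite powRD//; apply/implyP => _; rewrite gt_eqF. Qed.

(** * Existence above the critical exponent *)

Section power_case.
Context {R : realType} {N : nat}.
Hypothesis N2 : (2 <= N)%N.
Variable p : R.
Hypotheses (hp1 : p_crit N < p) (hp2 : p < 2).

Let N0 : (0 < N)%N. Proof. exact: leq_trans N2. Qed.
Let h2 : R := N.-1%:R / 2.

(** The density is [|y| `^ (- (2 * c))] near the origin. *)
Let c : R := (p - 1)^-1 - 1.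
Let beta : R := h2 - c.

(** Below [beta] so that the weight of [Pf] stays integrable at 0, and at most
[2 - p] so that the exponent [theta] in [interpolation] is nonnegative. *)
Let eps : R := Num.min (beta / 2) (2 - p).

Let p1 : 1 < p.
Proof. by apply: le_lt_trans hp1; rewrite lerDl divr_ge0. Qed.

Let h20 : 0 <= h2. Proof. by rewrite divr_ge0. Qed.

Let c0 : 0 < c.
Proof. by rewrite subr_gt0 invf_gt1 ?subr_gt0//; move: hp2; lra. Qed.

Let N1E : N.+1%:R / 2 = h2 + 1 :> R.
Proof. by rewrite /h2 -[in LHS](prednK N0) -!natr1; field. Qed.

Let beta0 : 0 < beta.
Proof.
have N10 : 0 < N.+1%:R / 2 :> R by rewrite divr_gt0.
have : (p - 1)^-1 < h2 + 1.
  rewrite -N1E -[ltRHS]invrK ltf_pV2 ?posrE ?invr_gt0 ?subr_gt0// invf_div.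
  by rewrite ltrBrDl.
by rewrite /beta /c; lra.
Qed.

Let eps0 : 0 < eps.
Proof. by rewrite lt_min divr_gt0//= subr_gt0. Qed.

Let eps_beta : eps < beta.
Proof. by apply: (@le_lt_trans _ _ (beta / 2)); [by rewrite ge_min lexx|move: beta0; lra]. Qed.

Let eps_p : eps <= 2 - p.
Proof. by rewrite ge_min lexx orbT. Qed.

Let cp : c * (p - 1) = 2 - p.
Proof. by rewrite /c mulrBl mulVf ?mul1r ?gt_eqF ?subr_gt0//; ring. Qed.

Let power_weight (e s : R) : R := s `^ (e - 1).
Let wh := power_weight beta.
Let wf := power_weight (beta - eps).
Notation Ph := (@heat_mix R N.-1 wh 1).
Notation Pf := (@heat_mix R N.-1 wf 1).

Let wh0 s : 0 <= wh s. Proof. exact: powR_ge0. Qed.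
Let wf0 s : 0 <= wf s. Proof. exact: powR_ge0. Qed.
Let mwh : measurable_fun setT wh. Proof. exact: measurable_powR. Qed.
Let mwf : measurable_fun setT wf. Proof. exact: measurable_powR. Qed.

Let mpow (e : R) : measurable_fun setT (fun s : R => s `^ e).
Proof. exact: measurable_powR. Qed.

Let heat_mix_head (e s : R) (y : N.-1.-tuple R) : 0 < e -> 0 < s ->
  (heat_mix (power_weight e) s s y <= (s `^ (e - h2) / e)%:E)%E.
Proof.
move=> e0 s0.
have := @heat_mix_on_le_weight R N.-1 (power_weight e) (fun s => powR_ge0 s _)
  (mpow _) (fun s : R => s `^ (e - 1)) 0 s s y (s `^ (- h2)) (powR_ge0 _ _)
  (mpow _) (fun s _ => powR_ge0 s _).
move=> H; apply: (le_trans (H _)).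
  move=> u /andP[u0 us]; rewrite mulrC ler_wpM2r ?powR_ge0//.
  by rewrite addrC; apply: heatN_add_le => //; exact: ltW.
have -> : s `^ (e - h2) / e = s `^ (- h2) * (s `^ e / e).
  by rewrite mulrA powRD_gt0// (addrC (- h2)).
rewrite EFinM; apply: lee_wpmul2l; first by rewrite lee_fin powR_ge0.
exact: integral_powR_near0.
Qed.

Let heat_mix_tail (e a s : R) (y : N.-1.-tuple R) : e < h2 -> 0 < a -> a < 1 -> 0 <= s ->
  (heat_mix_on (power_weight e) a 1 s y <= (a `^ (e - h2) / (h2 - e))%:E)%E.
Proof.
move=> eh a0 a1 s0.
have := @heat_mix_on_le_weight R N.-1 (power_weight e) (fun s => powR_ge0 s _)
  (mpow _) (fun s : R => s `^ (- (h2 - e) - 1)) a 1 s y 1 ler01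
  (mpow _) (fun s _ => powR_ge0 s _).
move=> H; apply: (le_trans (H _)).
  move=> u /andP[au u1]; have u0 : 0 < u by exact: lt_trans au.
  rewrite mul1r; have -> : - (h2 - e) - 1 = (e - 1) + (- h2) by ring.
  by rewrite -powRD_gt0// ler_wpM2l ?powR_ge0//; exact: heatN_add_le.
rewrite mul1e; have -> : e - h2 = - (h2 - e) by ring.
by apply: integral_powR_tail => //; rewrite subr_gt0.
Qed.

Let Cf : R := (beta - eps)^-1 + (c + eps)^-1.

Let Cf0 : 0 < Cf.
Proof. by rewrite /Cf addr_gt0// invr_gt0 ?subr_gt0// addr_gt0. Qed.

Let be_h : beta - eps < h2.
Proof. by rewrite /beta; move: c0 eps0; lra. Qed.

Let Pf_le s y : 0 < s < 1 -> (Pf s y <= (Cf * s `^ (- (c + eps)))%:E)%E.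
Proof.
move=> /andP[s0 s1].
have -> : - (c + eps) = beta - eps - h2 by rewrite /beta; ring.
rewrite (heat_mix_split wf0 mwf (a := s)) ?s0// mulrDl EFinD; apply: leeD.
  by rewrite mulrC; apply: heat_mix_head; rewrite ?subr_gt0.
have -> : c + eps = h2 - (beta - eps) by rewrite /beta; ring.
by rewrite mulrC; apply: heat_mix_tail => //; exact: ltW.
Qed.

(** The weight of [Ph] is smaller by a factor [a `^ eps] below time [a]. *)
Let wh_wf a s : 0 < s -> s <= a -> wh s <= a `^ eps * wf s.
Proof.
move=> s0 sa; rewrite /wh /wf /power_weight.
have -> : beta - 1 = eps + (beta - eps - 1) by ring.
rewrite -powRD_gt0// ler_wpM2r ?powR_ge0//.
by apply: ge0_ler_powR; rewrite ?nnegrE ?(ltW eps0) ?(ltW s0)// (le_trans (ltW s0)).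
Qed.

Let heat_mix_wh_wf (a r s : R) y : 0 < r -> r <= a -> 0 <= s ->
  (heat_mix wh r s y <= (a `^ eps)%:E * @heat_mix R N.-1 wf r s y)%E.
Proof.
move=> r0 ra s0; apply: le_heat_mix_on => //; first exact: powR_ge0.
by move=> u /andP[u0 ur]; rewrite wh_wf// (le_trans (ltW ur)).
Qed.

Let heat_mix_wf_le (a s : R) y : 0 < a -> a < 1 ->
  (@heat_mix R N.-1 wf a s y <= Pf s y)%E.
Proof.
by move=> a0 a1; apply: heat_mix_le => //; rewrite a0.
Qed.

(** Below the level [a] the mixture is compared with [Pf]; above it the kernel at
time [s + u] is at most [u `^ (- h2)]. *)
Let Ph_le (a s : R) y : 0 < a -> 0 <= s ->
  (Ph s y <= (a `^ eps)%:E * Pf s y + (a `^ (- c) / c)%:E)%E.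
Proof.
move=> a0 s0; have [a1|a1] := leP 1 a.
  apply: (le_trans (heat_mix_wh_wf y _ a1 s0)) => //.
  by rewrite leeDl// lee_fin divr_ge0 ?powR_ge0// ltW.
rewrite (heat_mix_split wh0 mwh (a := a)) ?a0//; apply: leeD.
  apply: (le_trans (heat_mix_wh_wf y a0 (lexx a) s0)).
  by apply: lee_wpmul2l; [rewrite lee_fin powR_ge0|exact: heat_mix_wf_le].
have -> : - c = beta - h2 by rewrite /beta; ring.
have -> : c = h2 - beta by rewrite /beta; ring.
by apply: heat_mix_tail => //; rewrite /beta gtrBl.
Qed.

Let fin_sup w s y M : (forall u, 0 <= w u) -> (@heat_mix R N.-1 w 1 s y <= M%:E)%E ->
  (@heat_mix R N.-1 w 1 s y < +oo)%E /\ fine (heat_mix w 1 s y) <= M.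
Proof.
move=> w0 wM; have lt : (heat_mix w 1 s y < +oo)%E by exact: le_lt_trans wM (ltry _).
by split => //; rewrite -lee_fin fineK// ge0_fin_numE// heat_mix_ge0.
Qed.

Let C0 : R := ((4 * pi) `^ (- h2) * expR (- 2^-1) / 2)^-1 * 2 `^ beta.

(** At [y] the mixture at time 0 is of order [(|y| ^ 2) `^ (beta - h2)], which is the
power in the density. *)
Let dens_le y : ((hdens p y)%:E <= C0%:E * Ph 0 y)%E.
Proof.
rewrite /hdens hp1 indicE; case: (boolP (y \in _)) => [/set_mem/= y1|_]; last first.
  by rewrite mulr0 mule_ge0 ?heat_mix_ge0// lee_fin mulr_ge0 ?powR_ge0// invr_ge0 !mulr_ge0 ?powR_ge0 ?expR_ge0.
rewrite mulr1; have [y0|y0] := eqVneq (enorm y) 0.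
  rewrite y0 powR0; last first.
    have -> : 2 - 2 / (p - 1) = - (2 * c) by rewrite /c; ring.
    by rewrite oppr_eq0 mulf_neq0// gt_eqF.
  by rewrite mule_ge0 ?heat_mix_ge0// lee_fin mulr_ge0 ?powR_ge0// invr_ge0 !mulr_ge0 ?powR_ge0 ?expR_ge0.
have ygt0 : 0 < enorm y by rewrite lt_neqAle eq_sym y0 enorm_ge0.
have [q qE] : {q : R | q = enorm y ^+ 2} by eexists.
have q0 : 0 < q by rewrite qE exprn_gt0.
have q1 : q <= 1 by rewrite qE expr_le1 ?enorm_ge0// ltW.
pose m := (q / 2) `^ beta * q^-1.
pose K : R := (4 * pi) `^ (- h2) * expR (- 2^-1) / 2.
have K0 : 0 < K by rewrite /K divr_gt0// mulr_gt0 ?expR_gt0// powR_gt0// mulr_gt0// pi_gt0.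
have := @heat_mix_lower R N.-1 wh wh0 mwh 1 y m; rewrite -qE => /(_ _ ygt0 q1) H.
have {}H : ((m * K * q `^ (1 - h2))%:E <= Ph 0 y)%E.
  apply: H; first by rewrite /m mulr_ge0 ?powR_ge0// invr_ge0 ltW.
  move=> u /andP[qu uq]; have u0 : 0 < u by rewrite (lt_trans _ qu)// divr_gt0.
  have -> : wh u = u `^ beta * u^-1.
    by rewrite /wh /power_weight -powRD_gt0// powR_inv1// ltW.
  rewrite /m; apply: ler_pM; rewrite ?powR_ge0 ?invr_ge0 ?(ltW q0)//.
    by apply: ge0_ler_powR; rewrite ?nnegrE ?divr_ge0 ?(ltW q0) ?(ltW u0) ?(ltW beta0) ?(ltW qu).
  by rewrite lef_pV2 ?posrE// ltW.
apply: (@le_trans _ _ (C0%:E * (m * K * q `^ (1 - h2))%:E)%E); last first.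
  by apply: lee_wpmul2l => //; rewrite lee_fin /C0 mulr_ge0 ?powR_ge0// invr_ge0 ltW.
rewrite -EFinM lee_fin; apply: eqW.
have -> : enorm y `^ (2 - 2 / (p - 1)) = q `^ (- c).
  rewrite qE -powR_mulrn ?enorm_ge0// -powRrM; congr (_ `^ _); rewrite /c; ring.
have -> : q `^ (- c) = q `^ beta * q^-1 * q `^ (1 - h2).
  by rewrite -(powR_inv1 (ltW q0)) !powRD_gt0//; congr (_ `^ _); rewrite /beta; ring.
rewrite /C0 -/K /m powRM ?invr_ge0 ?(ltW q0)//.
have E2 : 2 `^ beta * 2^-1 `^ beta = 1 :> R.
  by rewrite -powRM ?invr_ge0// divff// powR1.
transitivity (q `^ beta * q^-1 * q `^ (1 - h2) * (2 `^ beta * 2^-1 `^ beta)).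
  by rewrite E2 mulr1.
by field; rewrite !gt_eqF.
Qed.

Let theta : R := (2 - p - eps) / (c + eps).

Let C1 : R := (1 + c^-1) `^ p * Cf `^ theta + Cf `^ (p - 1) + eps^-1.

Let ce0 : 0 < c + eps. Proof. exact: addr_gt0. Qed.

Let T1 : 0 <= (1 + c^-1) `^ p * Cf `^ theta.
Proof. by rewrite mulr_ge0 ?powR_ge0. Qed.

Let T2 : 0 <= Cf `^ (p - 1). Proof. exact: powR_ge0. Qed.

Let T3 : 0 <= eps^-1. Proof. by rewrite invr_ge0 ltW. Qed.

(** Optimising the level [x] in the last hypothesis bounds [a] by a power of [b]
less than 1, whose [p]-th power is [b] times a power that is then traded for a
power of [s]. *)
Let interpolation (s a b : R) : 0 < s -> 0 <= a -> 0 <= b ->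
  b <= Cf * s `^ (- (c + eps)) -> a <= b ->
  (forall x, 0 < x -> a <= x `^ eps * b + x `^ (- c) / c) ->
  a `^ p <= C1 * s `^ (p - 2 + eps) * b.
Proof.
move=> s0 a0 b0 bCf ab aL.
have p0 : 0 < p by exact: lt_trans p1.
have [bz|bn] := eqVneq b 0.
  have -> : a = 0 by apply/eqP; rewrite eq_le a0 andbT -bz.
  by rewrite bz mulr0 powR0// gt_eqF.
have {bn}bgt0 : 0 < b by rewrite lt_neqAle eq_sym bn.
have aK : a <= (1 + c^-1) * b `^ (c / (c + eps)).
  (* at this level the two terms of the bound are of the same order *)
  have := aL (b `^ (- (c + eps)^-1)) (powR_gt0 _ bgt0).
  rewrite -!powRrM -[X in _ * X + _](powRr1 b0) powRD_gt0//.
  have -> : - (c + eps)^-1 * eps + 1 = c / (c + eps) by field; rewrite gt_eqF.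
  have -> : - (c + eps)^-1 * - c = c / (c + eps) by ring.
  by move=> H; apply: (le_trans H); apply: eqW; ring.
have c1 : 0 <= 1 + c^-1 by rewrite addr_ge0// invr_ge0 ltW.
have theta0 : 0 <= theta by rewrite /theta divr_ge0 ?subr_ge0 ?(ltW ce0).
apply: (@le_trans _ _ (((1 + c^-1) * b `^ (c / (c + eps))) `^ p)).
  by apply: ge0_ler_powR; rewrite ?nnegrE ?(ltW p0)// mulr_ge0 ?powR_ge0.
rewrite powRM ?powR_ge0// -powRrM.
have -> : c / (c + eps) * p = 1 + theta by rewrite /theta -cp; field; rewrite gt_eqF.
rewrite -(powRD_gt0 1 theta bgt0) powRr1//.
have bt : b `^ theta <= Cf `^ theta * s `^ (p - 2 + eps).
  apply: (@le_trans _ _ ((Cf * s `^ (- (c + eps))) `^ theta)).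
    by apply: ge0_ler_powR; rewrite ?nnegrE// mulr_ge0 ?powR_ge0// (ltW Cf0).
  rewrite powRM ?powR_ge0 ?(ltW Cf0)// -powRrM.
  have -> // : - (c + eps) * theta = p - 2 + eps.
  by rewrite /theta; field; rewrite gt_eqF.
apply: (@le_trans _ _ ((1 + c^-1) `^ p * (b * (Cf `^ theta * s `^ (p - 2 + eps))))).
  by rewrite ler_wpM2l ?powR_ge0// ler_wpM2l.
rewrite [leLHS](_ : _ = (1 + c^-1) `^ p * Cf `^ theta * (s `^ (p - 2 + eps) * b)); last by ring.
rewrite -[leRHS]mulrA ler_wpM2r ?mulr_ge0 ?powR_ge0// /C1 -addrA lerDl.
by rewrite addr_ge0.
Qed.

Let eta_bound (s b : R) : 0 < s -> 0 <= b -> b <= Cf * s `^ (- (c + eps)) ->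
  (s `^ eps) `^ p * b `^ (p - 1) <= C1 * s `^ (p - 2 + eps).
Proof.
move=> s0 b0 bCf.
apply: (@le_trans _ _ ((s `^ eps) `^ p * (Cf * s `^ (- (c + eps))) `^ (p - 1))).
  rewrite ler_wpM2l ?powR_ge0//.
  have p10 : 0 <= p - 1 by rewrite subr_ge0 ltW.
  by apply: ge0_ler_powR; rewrite ?nnegrE// mulr_ge0 ?powR_ge0// (ltW Cf0).
rewrite powRM ?powR_ge0 ?(ltW Cf0)// -!powRrM mulrCA powRD_gt0//.
have -> : eps * p + - (c + eps) * (p - 1) = p - 2 + eps.
  have -> : eps * p + - (c + eps) * (p - 1) = eps - c * (p - 1) by ring.
  by rewrite cp; ring.
by rewrite ler_wpM2r ?powR_ge0// /C1 addrAC lerDr addr_ge0.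
Qed.

Lemma existence_power : exists2 kappa0 : R, 0 < kappa0 &
  forall k : {posnum R}, k%:num <= kappa0 -> local_in_time_solvable p (boundary_datum N p k).
Proof.
have bd s y : 0 < s < 1 -> [/\ (Ph s y < +oo)%E, (Pf s y < +oo)%E,
    fine (Pf s y) <= Cf * s `^ (- (c + eps)),
    fine (Ph s y) <= fine (Pf s y) &
    forall a, 0 < a -> fine (Ph s y) <= a `^ eps * fine (Pf s y) + a `^ (- c) / c].
  move=> s01; have [s0 s1] := andP s01; have [f1 f2] := fin_sup wf0 (Pf_le y s01).
  have hf := heat_mix_wh_wf y ltr01 (lexx 1) (ltW s0).
  rewrite powR1 mul1e in hf.
  have f3 : (Ph s y < +oo)%E by exact: le_lt_trans hf f1.
  rewrite (heat_mix_fineE wh0 f3) (heat_mix_fineE wf0 f1) lee_fin in hf.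
  split => // a a0; have := Ph_le y a0 (ltW s0).
  by rewrite (heat_mix_fineE wh0 f3) (heat_mix_fineE wf0 f1) -EFinM -EFinD lee_fin.
apply: (@existence_criterion R N N0 p 1 1 C0 C1 wh wf (fun s => s `^ eps)
  (fun s => s `^ (p - 2 + eps))) => //.
- rewrite /C0 mulr_gt0 ?powR_gt0// invr_gt0 divr_gt0// mulr_gt0 ?expR_gt0//.
  by rewrite powR_gt0// mulr_gt0// pi_gt0.
- by rewrite /C1 ltr_wpDl ?invr_gt0// addr_ge0.
- by move=> s; exact: powR_ge0.
- by move=> s; exact: powR_ge0.
- by move=> s y /(bd _ y)[].
- move=> s y s01; have [_ _ bCf ab aL] := bd s y s01; case/andP: s01 => s0 _.
  by apply: interpolation => //; apply: fine_ge0; exact: heat_mix_ge0.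
- move=> s y s01; have [_ _ bCf _ _] := bd s y s01; case/andP: s01 => s0 _.
  by apply: eta_bound => //; apply: fine_ge0; exact: heat_mix_ge0.
- move=> t /andP[t0 t1].
  have -> : (\int[lebesgue_measure]_(s in `]0%R, t[) (s `^ (p - 2 + eps) * s `^ (1 - p))%:E =
      \int[lebesgue_measure]_(s in `]0%R, t[) (s `^ (eps - 1))%:E)%E.
    apply: eq_integral => s /set_mem/=; rewrite in_itv/= => /andP[s0 _].
    by rewrite powRD_gt0//; congr ((_ `^ _)%:E); ring.
  apply: (le_trans (integral_powR_near0 eps0 t0)).
  by rewrite lee_fin mulrC ler_wpM2r ?powR_ge0// /C1 lerDr addr_ge0.
Qed.

End power_case.

(** * Existence at the critical exponent *)

Section critical_case.
Context {R : realType} {N : nat}.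
Hypothesis N2 : (2 <= N)%N.
Variable p : R.
Hypothesis hp : p = p_crit N.

Let N0 : (0 < N)%N. Proof. exact: leq_trans N2. Qed.
Let h2 : R := N.-1%:R / 2.

(** The logarithmic exponent of [h] at the origin is [- (2 * g) - 1]; half of [2 * g]
is the gain that separates the two weights. *)
Let g : R := (h2 + 1) / 2.

Let N1E : N.+1%:R / 2 = h2 + 1 :> R.
Proof. by rewrite /h2 -[in LHS](prednK N0) -!natr1; field. Qed.

Let h20 : 0 < h2.
Proof. by rewrite divr_gt0// ltr0n -ltnS (prednK N0). Qed.

Let g0 : 0 < g. Proof. by rewrite divr_gt0// addr_gt0. Qed.

Let pE : p - 1 = (h2 + 1)^-1.
Proof. by rewrite -N1E hp /p_crit addrAC subrr add0r invf_div. Qed.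

Let p1 : 1 < p.
Proof. by rewrite -subr_gt0 pE invr_gt0 addr_gt0. Qed.

Let pg : 2 * g * (p - 1) = 1.
Proof. by rewrite pE /g; field; rewrite gt_eqF// addr_gt0. Qed.

Let L (s : R) : R := - ln s.
Let l4 : R := L 4^-1.

Let L_gt0 (s : R) : 0 < s < 1 -> 0 < L s.
Proof. by move=> s01; rewrite /L oppr_gt0 ln_lt0. Qed.

Let le_L (s t : R) : 0 < s -> s <= t -> L t <= L s.
Proof.
by move=> s0 st; rewrite /L lerN2 ler_ln// posrE (lt_le_trans s0).
Qed.

Let log_integrand (e s : R) : R := s^-1 * (L s) `^ (- e - 1).

(** Equal to [log_integrand] at positive times, but nonnegative everywhere. *)
Let log_weight (e s : R) : R := s `^ (-1) * (L s) `^ (- e - 1).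

Let log_weightE (e s : R) : 0 < s -> log_weight e s = log_integrand e s.
Proof. by move=> s0; rewrite /log_weight powR_inv1// ltW. Qed.

Let log_weight_ge0 e s : 0 <= log_weight e s.
Proof. by rewrite mulr_ge0 ?powR_ge0. Qed.

Let mL : measurable_fun setT (fun s : R => L s).
Proof. by apply: measurable_funN; exact: measurable_ln. Qed.

Let mlog_integrand e : measurable_fun setT (log_integrand e).
Proof.
apply: measurable_funM; first exact: measurable_inv.
exact: (measurableT_comp (measurable_powR _)).
Qed.

Let mlog_weight e : measurable_fun setT (log_weight e).
Proof.
apply: measurable_funM.
  exact: measurable_powR.
exact: (measurableT_comp (measurable_powR _)).
Qed.

Let wh := log_weight (2 * g).
Let wf := log_weight g.
Notation Ph := (@heat_mix R N.-1 wh 4^-1).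
Notation Pf := (@heat_mix R N.-1 wf 4^-1).

Let weight_le (e a b : R) : 0 < e -> 0 <= a -> 0 < b -> b < 1 ->
  (\int[lebesgue_measure]_(s in `]a, b[) (log_integrand e s)%:E <= (L b `^ (- e) / e)%:E)%E.
Proof.
move=> e0 a0 b0 b1; have := @integral_log_near0 R e b e0; rewrite b0 b1 => /(_ isT).
apply: le_trans; apply: ge0_subset_integral => //.
- by apply/measurable_EFinP; apply: measurable_funTS; exact: (mlog_integrand e).
- move=> s; rewrite /= in_itv/= => /andP[s0 _]; rewrite lee_fin.
  by rewrite mulr_ge0 ?powR_ge0// invr_ge0 ltW.
- by apply: subset_itv; rewrite bnd_simp.
Qed.

Let heat_mix_head (e r s : R) y : 0 < e -> 0 < r -> r < 1 -> 0 < s ->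
  (@heat_mix R N.-1 (log_weight e) r s y <= (s `^ (- h2) * (L r `^ (- e) / e))%:E)%E.
Proof.
move=> e0 r0 r1 s0.
have := @heat_mix_on_le_weight R N.-1 (log_weight e) (log_weight_ge0 e) (mlog_weight e) (log_integrand e) 0 r s y (s `^ (- h2))
  (powR_ge0 _ _) (mlog_integrand e).
move=> H; apply: (le_trans (H _ _)).
- by move=> u /andP[u0 _]; rewrite -log_weightE.
- move=> u /andP[u0 ur]; rewrite log_weightE// mulrC ler_wpM2r//; first by rewrite -log_weightE.
  by rewrite addrC; apply: heatN_add_le => //; exact: ltW.
- rewrite EFinM; apply: lee_wpmul2l; first by rewrite lee_fin powR_ge0.
  exact: weight_le.
Qed.

Let heat_mix_tail (e a s : R) y : 0 < e -> 0 < a -> 0 <= s ->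
  (@heat_mix_on R N.-1 (log_weight e) a 4^-1 s y <= (a `^ (- h2) * (l4 `^ (- e) / e))%:E)%E.
Proof.
move=> e0 a0 s0.
have := @heat_mix_on_le_weight R N.-1 (log_weight e) (log_weight_ge0 e) (mlog_weight e) (log_integrand e) a 4^-1 s y (a `^ (- h2))
  (powR_ge0 _ _) (mlog_integrand e).
move=> H; apply: (le_trans (H _ _)).
- by move=> u /andP[au _]; rewrite -log_weightE// (lt_trans a0).
- move=> u /andP[au ur]; have u0 : 0 < u by exact: lt_trans au.
  rewrite log_weightE// mulrC ler_wpM2r//; first by rewrite -log_weightE.
  apply: (le_trans (heatN_add_le _ s0 u0)).
  rewrite !powRN lef_pV2 ?posrE ?powR_gt0//.
  by apply: ge0_ler_powR; rewrite ?nnegrE ?(ltW h20) ?(ltW u0) ?(ltW a0) ?(ltW au).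
- rewrite EFinM; apply: lee_wpmul2l; first by rewrite lee_fin powR_ge0.
  by apply: weight_le; rewrite ?(ltW a0)// ?invr_gt0// invf_lt1//; lra.
Qed.

Let powR_log_bound (e b s : R) : 0 < e -> 0 < b -> 0 < s < 1 ->
  s `^ b <= (e / b) `^ e * L s `^ (- e).
Proof.
move=> e0 b0 s01; have := powR_log_le e0 b0 s01; case/andP: (s01) => s0 s1.
have Ls := L_gt0 s01.
rewrite !powRN ler_pdivlMr ?powR_gt0// => H.
by rewrite ler_pdivlMr ?powR_gt0// mulrC.
Qed.

Let sq (s : R) : R := s `^ (2^-1).

Let sq_gt0 (s : R) : 0 < s -> 0 < sq s. Proof. exact: powR_gt0. Qed.

Let sq_lt (s : R) : 0 < s < 16^-1 -> sq s < 4^-1.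
Proof.
move=> /andP[s0 s1]; have -> : 4^-1 = sq (16^-1).
  rewrite /sq (_ : 16^-1 = 4^-1 `^ 2%:R).
    by rewrite -powRrM mulfV// powRr1// invr_ge0.
  by rewrite powR_mulrn ?invr_ge0//; field.
by apply: gt0_ltr_powR; rewrite ?nnegrE ?invr_ge0 ?(ltW s0).
Qed.

Let L_sq (s : R) : L (sq s) = L s / 2.
Proof. by rewrite /L /sq ln_powR; ring. Qed.

Let sq_h2 (s : R) : sq s `^ (- h2) = s `^ (- (h2 / 2)).
Proof. by rewrite /sq -powRrM; congr (_ `^ _); ring. Qed.

Let s01_of (s : R) : 0 < s < 16^-1 -> 0 < s < 1.
Proof. by move=> /andP[-> s1]; rewrite (lt_trans s1)// invf_lt1//; lra. Qed.

Let half_pow (s e : R) : 0 < s < 1 -> (L s / 2) `^ (- e) = 2 `^ e * L s `^ (- e).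
Proof.
move=> /L_gt0 Ls; rewrite powRM ?invr_ge0 ?(ltW Ls)// mulrC; congr (_ * _).
by rewrite powRN -powRN -powR_inv1// -powRrM mulN1r opprK.
Qed.

Let Cf : R := 2 `^ g / g + (g / (h2 / 2)) `^ g * (l4 `^ (- g) / g).

Let Cf0 : 0 < Cf.
Proof.
rewrite /Cf ltr_wpDr//; last by rewrite divr_gt0// powR_gt0.
by rewrite mulr_ge0 ?powR_ge0// divr_ge0 ?powR_ge0// ltW.
Qed.

Let Pf_le (s : R) y : 0 < s < 16^-1 -> (Pf s y <= (Cf * (s `^ (- h2) * L s `^ (- g)))%:E)%E.
Proof.
move=> s16; have s01 := s01_of s16; have [s0 s1] := andP s01.
have q0 := sq_gt0 s0; have q4 := sq_lt s16.
rewrite (heat_mix_split (log_weight_ge0 _) (mlog_weight _) (a := sq s)) ?q0//.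
have q1 : sq s < 1 by rewrite (lt_trans q4)// invf_lt1//; lra.
apply: (le_trans (leeD (heat_mix_head y g0 q0 q1 s0) (heat_mix_tail y g0 q0 (ltW s0)))).
rewrite L_sq sq_h2 half_pow// -EFinD lee_fin.
have e1 : s `^ (- (h2 / 2)) <= s `^ (- h2) * ((g / (h2 / 2)) `^ g * L s `^ (- g)).
  have -> : - (h2 / 2) = - h2 + h2 / 2 by field.
  rewrite -powRD_gt0// ler_wpM2l ?powR_ge0// powR_log_bound// divr_gt0//.
apply: (@le_trans _ _ (s `^ (- h2) * (2 `^ g * L s `^ (- g) / g) +
    s `^ (- h2) * ((g / (h2 / 2)) `^ g * L s `^ (- g)) * (l4 `^ (- g) / g))).
  by rewrite lerD2l ler_wpM2r// divr_ge0 ?powR_ge0// ltW.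
by apply: eqW; rewrite /Cf; ring.
Qed.

(** The logarithm plays the role of the small power: the gain of one weight over
the other below time [a] is [L a `^ (- g)]. *)
Let wh_wf (a u : R) : 0 < u -> u <= a -> a < 1 -> wh u <= L a `^ (- g) * wf u.
Proof.
move=> u0 ua a1; have a0 := lt_le_trans u0 ua.
have La : 0 < L a by rewrite L_gt0// a0.
have LaLu := le_L u0 ua; have Lu := lt_le_trans La LaLu.
rewrite /wh /wf !log_weightE// /log_integrand [leRHS]mulrCA ler_wpM2l ?invr_ge0 ?(ltW u0)//.
have -> : - (2 * g) - 1 = - g + (- g - 1) by ring.
rewrite -powRD_gt0// ler_wpM2r ?powR_ge0// !powRN lef_pV2 ?posrE ?powR_gt0//.
by apply: ge0_ler_powR; rewrite ?nnegrE ?(ltW g0) ?(ltW La) ?(ltW Lu).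
Qed.

Let C2 : R := l4 `^ (- g).
Let C3 : R := l4 `^ (- (2 * g)) / (2 * g).

Let C20 : 0 <= C2. Proof. exact: powR_ge0. Qed.
Let C30 : 0 <= C3. Proof. by rewrite divr_ge0 ?powR_ge0// mulr_ge0// ltW. Qed.

(** The mixture is cut at time [sqrt s], whose logarithm is comparable to that
of [s]: below, the gain is [L s `^ (- g)]; the part [T] above is both smaller than [Pf]
and less singular than the critical rate by a power of [s]. *)
Let Ph_le (s : R) y : 0 < s < 16^-1 -> exists T : R, [/\ 0 <= T,
  (T%:E <= C2%:E * Pf s y)%E, T <= C3 * s `^ (- (h2 / 2)) &
  (Ph s y <= (2 `^ g * L s `^ (- g))%:E * Pf s y + T%:E)%E].
Proof.
move=> s16; have s01 := s01_of s16; have [s0 s1] := andP s01.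
have q0 := sq_gt0 s0; have q4 := sq_lt s16.
have q1 : sq s < 1 by rewrite (lt_trans q4)// invf_lt1//; lra.
have tl : (heat_mix_on wh (sq s) 4^-1 s y <= (C3 * s `^ (- (h2 / 2)))%:E)%E.
  by rewrite mulrC -sq_h2; apply: heat_mix_tail => //; [rewrite mulr_gt0|exact: ltW].
have t0 : (0 <= heat_mix_on wh (sq s) 4^-1 s y)%E by apply: heat_mix_on_ge0 => u; exact: log_weight_ge0.
have tf : heat_mix_on wh (sq s) 4^-1 s y = (fine (heat_mix_on wh (sq s) 4^-1 s y))%:E.
  by rewrite fineK// ge0_fin_numE// (le_lt_trans tl)// ltry.
exists (fine (heat_mix_on wh (sq s) 4^-1 s y)); split.
- exact: fine_ge0.
- rewrite -tf; apply: (@le_trans _ _ (C2%:E * heat_mix_on wf (sq s) 4^-1 s y)%E).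
    apply: le_heat_mix_on; [exact: log_weight_ge0|exact: mlog_weight|exact: log_weight_ge0|exact: mlog_weight|exact: C20|].
    move=> u /andP[qu u4]; apply: wh_wf; [exact: lt_trans qu|exact: ltW|].
    by rewrite invf_lt1//; lra.
  apply: lee_wpmul2l; first by rewrite lee_fin.
  rewrite (heat_mix_split (log_weight_ge0 _) (mlog_weight _) (a := sq s) (r := 4^-1)) ?q0//.
  by apply: leeDr; apply: heat_mix_ge0 => u; exact: log_weight_ge0.
- by rewrite -lee_fin -tf.
- rewrite -tf (heat_mix_split (log_weight_ge0 _) (mlog_weight _) (a := sq s)) ?q0//; apply: leeD => //.
  rewrite -half_pow// -L_sq.
  apply: (@le_trans _ _ ((L (sq s) `^ (- g))%:E * heat_mix wf (sq s) s y)%E).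
    apply: le_heat_mix_on; [exact: log_weight_ge0|exact: mlog_weight|exact: log_weight_ge0|exact: mlog_weight|exact: powR_ge0|].
    by move=> u /andP[u0 uq]; apply: wh_wf => //; exact: ltW.
  apply: lee_wpmul2l; first by rewrite lee_fin powR_ge0.
  by apply: heat_mix_le; [exact: log_weight_ge0|exact: mlog_weight|rewrite q0].
Qed.

Let A (s : R) : R := s `^ (- (h2 * (p - 1))) * L s `^ (- g - 1).
Let eta (s : R) : R := L s `^ (- g).

Let A0 s : 0 <= A s. Proof. by rewrite mulr_ge0 ?powR_ge0. Qed.

Let eta_bound (s b : R) : 0 < s < 1 -> 0 <= b -> b <= Cf * (s `^ (- h2) * L s `^ (- g)) ->
  eta s `^ p * b `^ (p - 1) <= Cf `^ (p - 1) * A s.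
Proof.
move=> s01 b0 bCf; have Ls := L_gt0 s01; have Cf_ge0 := ltW Cf0.
have p10 : 0 <= p - 1 by rewrite subr_ge0 ltW.
apply: (@le_trans _ _ (eta s `^ p * (Cf * (s `^ (- h2) * L s `^ (- g))) `^ (p - 1))).
  rewrite ler_wpM2l ?powR_ge0//.
  by apply: ge0_ler_powR; rewrite ?nnegrE// !mulr_ge0 ?powR_ge0.
rewrite powRM ?mulr_ge0 ?powR_ge0// powRM ?powR_ge0// -!powRrM.
apply: eqW; rewrite /A /eta.
have -> : - g - 1 = - g * p + - g * (p - 1) by rewrite -[in LHS]pg; ring.
rewrite -(powRD_gt0 (- g * p) (- g * (p - 1)) Ls).
have -> : - (h2 * (p - 1)) = - h2 * (p - 1) by ring.
by ring.
Qed.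

Let e2 : R := h2 / 2 * (p - 1).
Let K2 : R := ((g + 1) / e2) `^ (g + 1).

Let C1 : R := 2 `^ p * ((2 `^ g) `^ p * Cf `^ (p - 1) + C2 * (C3 `^ (p - 1) * K2)) +
  Cf `^ (p - 1) + g^-1.

(** The part [T] is estimated by splitting [T `^ p]: one factor by [Pf], the others
by the better power of [s], which beats any logarithm. *)
Let interpolation (s a b T : R) : 0 < s < 1 -> 0 <= a -> 0 <= b -> 0 <= T ->
  b <= Cf * (s `^ (- h2) * L s `^ (- g)) ->
  T <= C2 * b -> T <= C3 * s `^ (- (h2 / 2)) ->
  a <= 2 `^ g * L s `^ (- g) * b + T ->
  a `^ p <= C1 * A s * b.
Proof.
move=> s01 a0 b0 T0 bCf Tb Ts aT; have [s0 s1] := andP s01.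
have Ls := L_gt0 s01.
have p0 : 0 < p by exact: lt_trans p1.
have p10 : 0 <= p - 1 by rewrite subr_ge0 ltW.
pose q := 2 `^ g * L s `^ (- g) * b.
have q0 : 0 <= q by rewrite /q !mulr_ge0 ?powR_ge0.
have aq : a `^ p <= 2 `^ p * (q `^ p + T `^ p).
  apply: (@le_trans _ _ ((q + T) `^ p)); last by apply: powR_add_le => //; exact: ltW.
  by apply: ge0_ler_powR; rewrite ?nnegrE ?(ltW p0)// addr_ge0.
have qp : q `^ p <= (2 `^ g) `^ p * Cf `^ (p - 1) * (A s * b).
  rewrite /q -mulrA powRM ?mulr_ge0 ?powR_ge0// -[leRHS]mulrA ler_wpM2l ?powR_ge0//.
  rewrite powRM ?powR_ge0// -(mulr_powRB1 b0 p0) mulrCA mulrC mulrA ler_wpM2r//.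
  exact: eta_bound.
have e20 : 0 < e2.
  have pp : 0 < p - 1 by rewrite subr_gt0.
  by rewrite /e2 mulr_gt0// divr_gt0.
have Tp : T `^ p <= C2 * (C3 `^ (p - 1) * K2) * (A s * b).
  rewrite -(mulr_powRB1 T0 p0).
  apply: (@le_trans _ _ (C2 * b * (C3 * s `^ (- (h2 / 2))) `^ (p - 1))).
    apply: ler_pM; rewrite ?powR_ge0//.
    by apply: ge0_ler_powR; rewrite ?nnegrE// mulr_ge0 ?powR_ge0.
  rewrite powRM ?powR_ge0// -powRrM.
  have -> : - (h2 / 2) * (p - 1) = - (h2 * (p - 1)) + e2 by rewrite /e2; field.
  rewrite -(powRD_gt0 (- (h2 * (p - 1))) e2 s0).
  have g10 : 0 < g + 1 by rewrite addr_gt0.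
  have sK : s `^ e2 <= K2 * L s `^ (- g - 1).
    by rewrite -opprD; exact: powR_log_bound.
  apply: (@le_trans _ _ (C2 * b * (C3 `^ (p - 1) * (s `^ (- (h2 * (p - 1))) *
      (K2 * L s `^ (- g - 1)))))).
    by rewrite !ler_wpM2l ?mulr_ge0 ?powR_ge0.
  by apply: eqW; rewrite /A; ring.
apply: (le_trans aq); apply: (@le_trans _ _ (2 `^ p * ((2 `^ g) `^ p * Cf `^ (p - 1) +
    C2 * (C3 `^ (p - 1) * K2)) * (A s * b))).
  by rewrite -[leRHS]mulrA ler_wpM2l ?powR_ge0// [leRHS]mulrDl lerD.
have -> : C1 * A s * b = C1 * (A s * b) by ring.
apply: ler_wpM2r; first by rewrite mulr_ge0.
rewrite /C1 -[leRHS]addrA lerDl.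
by rewrite addr_ge0 ?powR_ge0// invr_ge0 ltW.
Qed.

Let K : R := (4 * pi) `^ (- h2) * expR (- 2^-1) / 2.
Let K0 : 0 < K.
Proof. by rewrite /K divr_gt0// mulr_gt0 ?expR_gt0// powR_gt0// mulr_gt0// pi_gt0. Qed.

Let C0 : R := (K * 3 `^ (- (2 * g) - 1))^-1.
Let C00 : 0 < C0.
Proof. by rewrite invr_gt0 mulr_gt0// powR_gt0. Qed.

Let dens_le y : ((hdens p y)%:E <= C0%:E * Ph 0 y)%E.
Proof.
have rhs0 : (0 <= C0%:E * Ph 0 y)%E.
  by rewrite mule_ge0 ?heat_mix_ge0// ?lee_fin ?(ltW C00)// => u; exact: log_weight_ge0.
rewrite /hdens hp ltxx indicE; case: (boolP (y \in _)) => [/set_mem/= y1|_]; last first.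
  by rewrite mulr0.
rewrite mulr1; have [y0|y0] := eqVneq (enorm y) 0.
  rewrite y0 powR0 ?mul0r//; rewrite addrC -opprB oppr_eq0 subr_eq0 (eqr_nat _ N 1).
  by rewrite gtn_eqF.
have ygt0 : 0 < enorm y by rewrite lt_neqAle eq_sym y0 enorm_ge0.
have [q qE] : {q : R | q = enorm y ^+ 2} by eexists.
have q0 : 0 < q by rewrite qE exprn_gt0.
have q1 : q <= 4^-1.
  rewrite qE (_ : 4^-1 = 2^-1 ^+ 2); last by field.
  by rewrite ler_sqr ?nnegrE ?enorm_ge0 ?invr_ge0// ltW.
have lny : ln 2 <= L (enorm y).
  rewrite /L lerNr -lnV ?posrE// ler_ln ?posrE ?invr_gt0//.
  exact: ltW.
have ln20 : 0 < ln 2 :> R by rewrite ln_gt0// ltr1n.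
have Ly0 : 0 < L (enorm y) by exact: lt_le_trans lny.
have g210 : 0 < 2 * g + 1 by rewrite addr_gt0// mulr_gt0.
pose m := q^-1 * (3 * L (enorm y)) `^ (- (2 * g) - 1).
have := @heat_mix_lower R N.-1 wh (log_weight_ge0 _) (mlog_weight _) 4^-1 y m; rewrite -qE => /(_ _ ygt0 q1) H.
have {}H : ((m * K * q `^ (1 - h2))%:E <= Ph 0 y)%E.
  apply: H; first by rewrite /m mulr_ge0 ?powR_ge0// invr_ge0 ltW.
  move=> u /andP[qu uq]; have u0 : 0 < u by rewrite (lt_trans _ qu)// divr_gt0.
  have u1 : u < 1 by rewrite (lt_trans uq)// (le_lt_trans q1)// invf_lt1//; lra.
  rewrite /wh log_weightE// /log_integrand /m; apply: ler_pM; rewrite ?powR_ge0 ?invr_ge0 ?(ltW q0)//.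
    by rewrite lef_pV2 ?posrE// ltW.
  have Lu : L u <= 3 * L (enorm y).
    apply: (@le_trans _ _ (L (q / 2))); first by apply: le_L; [exact: divr_gt0|exact: ltW].
    rewrite {1}/L lnM ?posrE ?invr_gt0// lnV ?posrE// qE lnXn// mulr2n.
    by move: lny; rewrite /L; lra.
  have Lu0 : 0 < L u by apply: L_gt0; rewrite u0.
  rewrite -!opprD !powRN lef_pV2 ?posrE ?powR_gt0 ?mulr_gt0//.
  by apply: ge0_ler_powR; rewrite ?nnegrE ?(ltW g210) ?(ltW Lu0) ?mulr_ge0 ?(ltW Ly0).
apply: (@le_trans _ _ (C0%:E * (m * K * q `^ (1 - h2))%:E)%E); last first.
  by apply: lee_wpmul2l => //; rewrite lee_fin ltW.
rewrite -EFinM lee_fin; apply: eqW.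
have -> : `|ln (enorm y)| = L (enorm y).
  by rewrite -normrN gtr0_norm.
have -> : - (N.+1%:R / 2) - 1 = - (2 * g) - 1 :> R by rewrite N1E /g; field.
have -> : enorm y `^ (- N%:R + 1) = q^-1 * q `^ (1 - h2).
  rewrite -(powR_inv1 (ltW q0)) powRD_gt0// qE -powR_mulrn ?enorm_ge0// -powRrM.
  by congr (_ `^ _); rewrite /h2 -{1}(prednK N0) -natr1; field.
rewrite /C0 /m powRM ?(ltW Ly0)//; field.
by rewrite !gt_eqF ?powR_gt0.
Qed.

Lemma existence_critical : exists2 kappa0 : R, 0 < kappa0 &
  forall k : {posnum R}, k%:num <= kappa0 -> local_in_time_solvable p (boundary_datum N p k).
Proof.
have fineP s y : 0 < s < 16^-1 -> [/\ (Ph s y < +oo)%E, (Pf s y < +oo)%E,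
    fine (Pf s y) <= Cf * (s `^ (- h2) * L s `^ (- g)) &
    exists T, [/\ 0 <= T, T <= C2 * fine (Pf s y), T <= C3 * s `^ (- (h2 / 2)) &
      fine (Ph s y) <= 2 `^ g * L s `^ (- g) * fine (Pf s y) + T]].
  move=> s16; have hf := Pf_le y s16.
  have f1 : (Pf s y < +oo)%E by exact: le_lt_trans hf (ltry _).
  have f1E := heat_mix_fineE (log_weight_ge0 _) f1.
  have [T [T0 Tf Ts hT]] := Ph_le y s16.
  rewrite f1E -EFinM lee_fin in Tf; rewrite f1E -EFinM -EFinD in hT.
  have f2 : (Ph s y < +oo)%E by exact: le_lt_trans hT (ltry _).
  rewrite (heat_mix_fineE (log_weight_ge0 _) f2) lee_fin in hT.
  rewrite f1E lee_fin in hf.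
  by split => //; exists T.
have f0 s y e : 0 <= fine (@heat_mix R N.-1 (log_weight e) 4^-1 s y).
  by apply: fine_ge0; apply: heat_mix_ge0; exact: log_weight_ge0.
have T1 : 0 <= 2 `^ p * ((2 `^ g) `^ p * Cf `^ (p - 1) + C2 * (C3 `^ (p - 1) * K2)).
  rewrite mulr_ge0 ?powR_ge0// addr_ge0// mulr_ge0 ?powR_ge0// mulr_ge0 ?powR_ge0//.
apply: (@existence_criterion R N N0 p 16^-1 4^-1 C0 C1 wh wf eta A) => //.
- rewrite /C1 ltr_wpDl ?invr_gt0// addr_ge0 ?powR_ge0//.
- exact: log_weight_ge0.
- exact: mlog_weight.
- exact: log_weight_ge0.
- exact: mlog_weight.
- by move=> s; exact: powR_ge0.
- by apply: (measurableT_comp (measurable_powR _)).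
- apply: measurable_funM; first exact: measurable_powR.
  by apply: (measurableT_comp (measurable_powR _)).
- by move=> s y /(fineP _ y)[].
- move=> s y s16; have [_ _ bCf [T [T0 Tb Ts aT]]] := fineP s y s16.
  exact: (interpolation (s01_of s16) (f0 s y _) (f0 s y _) T0 bCf Tb Ts aT).
- move=> s y s16; have [_ _ bCf _] := fineP s y s16.
  apply: (le_trans (eta_bound (s01_of s16) (f0 s y _) bCf)).
  by rewrite ler_wpM2r// /C1 addrAC lerDr addr_ge0// invr_ge0 ltW.
- move=> t t16; have [t0 t1] := andP (s01_of t16).
  have -> : (\int[lebesgue_measure]_(s in `]0%R, t[) (A s * s `^ (1 - p))%:E =
      \int[lebesgue_measure]_(s in `]0%R, t[) (s^-1 * (- ln s) `^ (- g - 1))%:E)%E.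
    apply: eq_integral => s /set_mem/=; rewrite in_itv/= => /andP[s0 _].
    rewrite /A mulrAC powRD_gt0//; congr ((_ * _)%:E).
    rewrite -powR_inv1 ?(ltW s0)//; congr (_ `^ _).
    have -> : - (h2 * (p - 1)) + (1 - p) = - ((h2 + 1) * (p - 1)) by ring.
    by rewrite pE mulfV// gt_eqF// addr_gt0.
  apply: (le_trans (integral_log_near0 g0 (s01_of t16))).
  rewrite lee_fin mulrC ler_wpM2r ?powR_ge0// /C1 lerDr addr_ge0 ?powR_ge0//.
Qed.

End critical_case.

(** * The boundary weight *)

Section boundary_weight.
Context {R : realType} {N : nat}.
Hypothesis N0 : (0 < N)%N.
Notation space := (euclidean_space R N).
Notation spacetime := (space * measurableTypeR R)%type.
Notation leb := (@spacetime_lebesgue R N).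
Notation mu := (@lebesgue_measure R).
Notation h2 := (N.-1%:R / 2 : R).
Notation e1 := (N.-1%:R / 2 + 3 / 2 : R).

(** As a function of [x] this is the solution of the linear problem in the
half-space whose datum is a unit boundary mass at the origin. *)
Definition poisson_weight (t : R) (x : space) : R :=
  if 0 < (x.2 : R) then pois1 t x.2 * heatN t x.1 else 0.

Lemma poisson_weight_ge0 t x : 0 <= t -> 0 <= poisson_weight t x.
Proof.
by move=> t0; rewrite /poisson_weight; case: ifP => // x0; rewrite mulr_ge0 ?heatN_ge0 ?pois1_ge0// ltW.
Qed.

Lemma measurable_poisson_weight2 : measurable_fun setT (fun z : spacetime => poisson_weight z.2 z.1).
Proof.
have mx : measurable_fun setT (fun z : spacetime => z.1.2 : R).
  exact: (measurableT_comp measurable_snd measurable_fst).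
have mt : measurable_fun setT (fun z : spacetime => z.2 : R) by exact: measurable_snd.
apply: measurable_fun_ifT => //; first exact: measurable_fun_ltr.
apply: measurable_funM.
  apply: (measurableT_comp (@measurable_pois1 R) (g := fun z : spacetime => (z.2 : R, z.1.2 : R))).
  exact: measurable_fun_pair.
apply: (measurableT_comp (@measurable_heatN R N.-1) (g := fun z : spacetime => (z.2 : R, z.1.1))).
apply: measurable_fun_pair => //; exact: (measurableT_comp measurable_fst measurable_fst).
Qed.

Lemma measurable_poisson_weight t : measurable_fun setT (poisson_weight t).
Proof.
apply: (measurableT_comp measurable_poisson_weight2 (g := fun x : space => (x, t))).
exact: measurable_fun_pair.
Qed.

(** After multiplication by this power of [t] only the exponential depends on [t]. *)
Lemma poisson_weightE t (x : space) : 0 < t -> 0 < (x.2 : R) ->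
  t `^ e1 * poisson_weight t x =
  x.2 * (4 * pi) `^ (- h2 - 2^-1) * expR (- ((enorm x.1 ^+ 2 + x.2 ^+ 2) / (4 * t))).
Proof.
move=> t0 x0; have p0 := @pi_gt0 R; have q0 : 0 < 4 * pi :> R by rewrite mulr_gt0.
rewrite /poisson_weight x0 /pois1 /heat1 heatNE ?(ltW t0)//.
have -> : expR (- ((enorm x.1 ^+ 2 + x.2 ^+ 2) / (4 * t))) =
    expR (- (enorm x.1 ^+ 2 / (4 * t))) * expR (- (x.2 ^+ 2 / (4 * t))).
  by rewrite -expRD -opprD -mulrDl.
rewrite !(powRM _ (ltW q0) (ltW t0)).
have -> : - h2 - 2^-1 = - 2^-1 + - h2 :> R by ring.
rewrite -(powRD_gt0 (- 2^-1) (- h2) q0).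
have tE : t `^ e1 = t * (t `^ 2^-1 * t `^ h2).
  by rewrite powRD_gt0// -{2}(powRr1 (ltW t0)) powRD_gt0//; congr (_ `^ _); field.
rewrite tE; transitivity (x.2 * ((4 * pi) `^ (- 2^-1) * (4 * pi) `^ (- h2)) *
  (expR (- (enorm x.1 ^+ 2 / (4 * t))) * expR (- (x.2 ^+ 2 / (4 * t)))) *
  ((t `^ 2^-1 * t `^ (- 2^-1)) * (t `^ h2 * t `^ (- h2)) * (t / t))).
  by rewrite /=; ring.
have inv e : t `^ e * t `^ (- e) = 1 by rewrite powRD_gt0// subrr powRr0.
by rewrite !inv divff ?gt_eqF// !mulr1.
Qed.

Lemma le_poisson_weight s t (x : space) : 0 < s -> s <= t -> s `^ e1 * poisson_weight s x <= t `^ e1 * poisson_weight t x.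
Proof.
move=> s0 st; have t0 := lt_le_trans s0 st.
have [x0|x0] := ltP 0 (x.2 : R); last first.
  by rewrite /poisson_weight ltNge x0/= !mulr0.
rewrite !poisson_weightE// ler_wpM2l ?mulr_ge0 ?powR_ge0 ?(ltW x0)// ler_expR lerN2.
by rewrite ler_wpM2l ?addr_ge0 ?sqr_ge0// lef_pV2 ?posrE ?mulr_gt0// ler_pM2l.
Qed.

Local Open Scope ereal_scope.

(** By symmetry of the kernel, the evolution from [s] to [t] is moved onto the
weight, which it advances from time [t] to time [t - s + t]. *)
Lemma integral_poisson_weight_kernelD (y : space) (t s : R) : (0 < s < t)%R -> (0 < (y.2 : R))%R ->
  \int[@space_lebesgue R N]_x ((poisson_weight t x)%:E * (kernelD ((x, t), (y, s)))%:E) =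
  (poisson_weight (t - s + t) y)%:E.
Proof.
move=> st y0; rewrite [in RHS]/poisson_weight y0 -integral_pois1_kernelD// [RHS]integral_mkcond.
apply: eq_integral => x _; rewrite patchE /poisson_weight.
case: ifPn => x0; first by rewrite mem_set.
by rewrite memNset ?mul0e//; exact/negP.
Qed.

Lemma integral_heatN n t : (0 < t)%R ->
  \int[lebesgue_tuple n]_x (heatN t x)%:E = 1 :> \bar R.
Proof.
move=> t0; elim: n => [|n ih].
  rewrite ge0_integral_tuple0; first by rewrite /heatN big_ord0.
  by apply/measurable_EFinP; exact: measurable_heatN1.
rewrite ge0_integral_tupleS; last 2 first.
- by move=> x; rewrite lee_fin heatN_ge0.
- by apply/measurable_EFinP; exact: measurable_heatN1.
rewrite -[RHS](integral_heat1 0 t0); apply: eq_integral => z _.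
rewrite subr0 -[RHS]mule1 -ih -ge0_integralZl_EFin ?heat1_ge0//.
- apply: eq_integral => x _; rewrite /heatN big_ord_recl/= tnth0 -EFinM; congr (_ * _)%:E.
  by apply: eq_bigr => i _; rewrite tnthS.
- by move=> x _; rewrite lee_fin heatN_ge0.
- by apply/measurable_EFinP; exact: measurable_heatN1.
Qed.

Local Close Scope ereal_scope.

(** Half of the exponent absorbs the factor [y / sqrt s]. *)
Lemma pois1_le_heat1 (s y : R) : (0 < s)%R -> (0 <= y)%R ->
  (pois1 s y <= 2 * 2 `^ 2^-1 * s `^ (- 2^-1) * heat1 (2 * s) y)%R.
Proof.
move=> s0 y0; have p0 := @pi_gt0 R; have q0 : (0 < 4 * pi :> R)%R by rewrite mulr_gt0.
have r0 : (0 < Num.sqrt s)%R by rewrite sqrtr_gt0.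
have E : s = (Num.sqrt s ^+ 2)%R by rewrite sqr_sqrtr ?(ltW s0).
pose u := (y / Num.sqrt s)%R.
have h : (u * expR (- (u ^+ 2 / 8)) <= 2)%R.
  rewrite expRN ler_pdivrMr ?expR_gt0//.
  apply: (@le_trans _ _ (2 * (1 + u ^+ 2 / 8))%R).
    by have := sqr_ge0 (u - 2); rewrite expr2 mulrBl !mulrBr expr2; lra.
  by rewrite ler_pM2l// expR_ge1Dx.
have -> : pois1 s y = (s `^ (- 2^-1) * (u * expR (- (u ^+ 2 / 8))) *
    ((4 * pi * s) `^ (- 2^-1) * expR (- (y ^+ 2 / (4 * (2 * s))))))%R.
  have -> : s `^ (- 2^-1) = (Num.sqrt s)^-1%R by rewrite powRN powR12_sqrt// ltW.
  have e8 : (u ^+ 2 / 8 = y ^+ 2 / (4 * (2 * s)))%R.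
    by rewrite /u {2}E; field; rewrite gt_eqF.
  rewrite /pois1 /heat1 e8 (_ : (y ^+ 2 / (4 * s) = y ^+ 2 / (4 * (2 * s)) + y ^+ 2 / (4 * (2 * s)))%R).
    rewrite opprD expRD /u (_ : (y / s = (Num.sqrt s)^-1 * (y / Num.sqrt s))%R); first by ring.
    by rewrite {1}E; field; rewrite gt_eqF.
  by field; rewrite gt_eqF.
have -> : heat1 (2 * s) y = (2 `^ (- 2^-1) * ((4 * pi * s) `^ (- 2^-1) *
    expR (- (y ^+ 2 / (4 * (2 * s))))))%R.
  rewrite /heat1 [RHS]mulrA -powRM ?mulr_ge0 ?(ltW p0) ?(ltW s0)//.
  by congr (_ `^ _ * _)%R; ring.
set X := ((4 * pi * s) `^ _ * _)%R.
have X0 : (0 <= X)%R by rewrite /X mulr_ge0 ?powR_ge0 ?expR_ge0.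
rewrite [leRHS](_ : _ = s `^ (- 2^-1) * 2 * X * (2 `^ 2^-1 * 2 `^ (- 2^-1)))%R; last by ring.
by rewrite powRD_gt0// subrr powRr0 mulr1 ler_wpM2r// ler_wpM2l// powR_ge0.
Qed.

Local Open Scope ereal_scope.

Let Z : R := (2 * 2 `^ 2^-1)%R.

Lemma integral_poisson_weight_le (s : R) : (0 < s)%R ->
  \int[@space_lebesgue R N]_x (poisson_weight s x)%:E <= (Z * s `^ (- 2^-1))%:E.
Proof.
move=> s0; have Zs0 : (0 <= Z * s `^ (- 2^-1))%R by rewrite mulr_ge0 ?powR_ge0// mulr_ge0 ?powR_ge0.
apply: (@le_trans _ _ (\int[@space_lebesgue R N]_x
   ((heatN s x.1)%:E * (Z * s `^ (- 2^-1) * heat1 (2 * s) x.2)%:E))).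
  apply: ge0_le_integral => //.
  - by move=> x _; rewrite lee_fin poisson_weight_ge0// ltW.
  - by apply/measurable_EFinP; exact: measurable_poisson_weight.
  - apply: emeasurable_funM; apply/measurable_EFinP.
      exact: (measurableT_comp (@measurable_heatN1 R N.-1 s) measurable_fst).
    apply: measurable_funM => //.
    apply: (measurableT_comp (@measurable_heat1 R) (g := fun x : space => ((2 * s)%R, x.2 : R))).
    by apply: measurable_fun_pair.
  - move=> x _; rewrite -EFinM lee_fin /poisson_weight mulrC; case: ifPn => x0.
      by rewrite ler_wpM2l ?heatN_ge0// pois1_le_heat1//; exact: ltW.
    by apply: mulr_ge0; [exact: heatN_ge0|apply: mulr_ge0 => //; exact: heat1_ge0].
rewrite (@integral_space_sep R N (fun x => (heatN s x)%:E)
  (fun x => (Z * s `^ (- 2^-1) * heat1 (2 * s) x)%R%:E)); last 4 first.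
- by move=> x; rewrite lee_fin heatN_ge0.
- by apply/measurable_EFinP; exact: measurable_heatN1.
- by move=> x; rewrite lee_fin mulr_ge0 ?heat1_ge0.
- apply/measurable_EFinP/measurable_funM => //.
  apply: (measurableT_comp (@measurable_heat1 R) (g := fun x : R => ((2 * s)%R, x : R))).
  by apply: measurable_fun_pair.
rewrite integral_heatN// mul1e.
under eq_integral do rewrite EFinM.
rewrite ge0_integralZl_EFin//.
- rewrite (_ : \int[mu]_x (heat1 (2 * s) x)%:E = 1) ?mule1//.
  rewrite -(@integral_heat1 R (2 * s)%R 0%R) ?mulr_gt0//.
  by apply: eq_integral => x _; rewrite subr0.
- by move=> x _; rewrite lee_fin heat1_ge0.
- apply/measurable_EFinP.
  apply: (measurableT_comp (@measurable_heat1 R) (g := fun x : R => ((2 * s)%R, x : R))).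
  by apply: measurable_fun_pair.
Qed.

End boundary_weight.

(** * A weighted Jensen inequality and the weight on space-time *)

Section weighted_jensen.
Local Open Scope ereal_scope.
Context d (X : measurableType d) (R : realType) (m : {measure set X -> \bar R}).
Variables (w : X -> R) (u : X -> \bar R) (p Z M : R).
Hypotheses (w0 : forall x, (0 <= w x)%R) (mw : measurable_fun setT w).
Hypotheses (u0 : forall x, 0 <= u x) (mu : measurable_fun setT u).
Hypotheses (p1 : (1 < p)%R) (Z0 : (0 < Z)%R) (M0 : (0 < M)%R).
Hypothesis wZ : \int[m]_x (w x)%:E <= Z%:E.
Hypothesis wuM : M%:E <= \int[m]_x ((w x)%:E * u x).

Let p0 : (0 < p)%R. Proof. exact: lt_trans p1. Qed.

Let young (l : R) (a : \bar R) : (0 < l)%R -> 0 <= a ->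
  a <= l%:E + (l `^ (1 - p))%R%:E * a `^ p.
Proof.
move=> l0; case: a => [a| |]//; last first.
  by move=> _; rewrite poweRyr ?gt_eqF// gt0_muley ?lte_fin ?powR_gt0// addey.
rewrite lee_fin => a0; rewrite poweR_EFin -EFinM -EFinD lee_fin.
have [al|la] := leP a l; first by rewrite (le_trans al)// lerDl mulr_ge0 ?powR_ge0.
have agt0 := lt_trans l0 la.
rewrite (@le_trans _ _ (l `^ (1 - p) * a `^ p)%R)//; last by rewrite lerDr ltW.
rewrite -{1}(powRr1 a0) (_ : 1 = (1 - p) + p)%R; last by rewrite subrK.
rewrite -powRD_gt0// subrK ler_wpM2r ?powR_ge0//.
rewrite -(opprB p 1) !powRN lef_pV2 ?posrE ?powR_gt0//.
by apply: ge0_ler_powR; rewrite ?nnegrE ?subr_ge0 ?(ltW p1) ?(ltW l0) ?(ltW la).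
Qed.

(** A form of Jensen that bounds the total mass of [w] only from above. For every
level [l], [u <= l + l ^ (1 - p) * u ^ p]; the level is chosen so that [l Z = M / 2]. *)
Lemma weighted_jensen :
  (2 `^ (- p) * Z `^ (1 - p) * M `^ p)%R%:E <= \int[m]_x ((w x)%:E * u x `^ p).
Proof.
(* so that the part of [u] below [l] accounts for at most half of [M] *)
have [l lE] : {l : R | l = (M / (2 * Z))%R} by eexists.
have l0 : (0 < l)%R by rewrite lE divr_gt0// mulr_gt0.
set I := (leRHS).
have mw' : measurable_fun setT (EFin \o w) by exact/measurable_EFinP.
have mup : measurable_fun setT (fun x => (w x)%:E * u x `^ p).
  by apply: emeasurable_funM => //; exact: (measurableT_comp (measurable_poweR _) mu).
have up0 x : 0 <= (w x)%:E * u x `^ p by rewrite mule_ge0 ?poweR_ge0 ?lee_fin.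
have I0 : 0 <= I by exact: integral_ge0.
have key : M%:E <= (l * Z)%:E + (l `^ (1 - p))%R%:E * I.
  apply: (le_trans wuM).
  apply: (@le_trans _ _ (\int[m]_x (l%:E * (w x)%:E + (l `^ (1 - p))%R%:E * ((w x)%:E * u x `^ p)))).
    apply: ge0_le_integral => //.
    - by move=> x _; rewrite mule_ge0 ?lee_fin.
    - exact: emeasurable_funM.
    - by apply: emeasurable_funD; exact: emeasurable_funM.
    - move=> x _; rewrite (muleC l%:E) (muleCA _ (w x)%:E) -ge0_muleDr.
      + apply: lee_wpmul2l; [by rewrite lee_fin|exact: young].
      + by rewrite lee_fin ltW.
      + by rewrite mule_ge0 ?poweR_ge0// lee_fin powR_ge0.
  rewrite ge0_integralD//; last 4 first.
  - by move=> x _; rewrite -EFinM lee_fin mulr_ge0// ltW.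
  - exact: emeasurable_funM.
  - by move=> x _; rewrite mule_ge0// lee_fin powR_ge0.
  - exact: emeasurable_funM.
  rewrite ge0_integralZl_EFin ?(ltW l0)//; last by move=> x _; rewrite lee_fin.
  rewrite ge0_integralZl_EFin ?powR_ge0// EFinM; apply: leeD => //.
  by apply: lee_wpmul2l => //; rewrite lee_fin ltW.
have [->|Ifin] := eqVneq I +oo; first by rewrite leey.
have IE : I = (fine I)%:E by rewrite fineK// ge0_fin_numE// lt_neqAle Ifin leey.
move: key; rewrite IE -EFinM -EFinD !lee_fin => key.
have lZ : (l * Z = M / 2)%R by rewrite lE; field; rewrite gt_eqF.
rewrite lZ in key.
have lp : (l `^ (1 - p) * l `^ (p - 1) = 1)%R.
  by rewrite powRD_gt0// (_ : 1 - p + (p - 1) = 0)%R ?powRr0//; ring.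
have h : (M / 2 * l `^ (p - 1) <= fine I)%R.
  have : (M / 2 <= l `^ (1 - p) * fine I)%R by lra.
  move=> /(ler_wpM2r (powR_ge0 l (p - 1))) /le_trans; apply.
  by rewrite mulrAC lp mul1r.
apply: le_trans h; apply: eqW.
rewrite lE invfM mulrA powRM ?divr_ge0 ?invr_ge0 ?(ltW M0) ?(ltW Z0)//.
rewrite powRM ?invr_ge0 ?(ltW M0)// -!powR_inv1 ?(ltW Z0)// -!powRrM.
have -> : (M `^ p = M * M `^ (p - 1))%R by rewrite mulr_powRB1 ?(ltW M0).
have -> : (2 `^ (- p) = 2 `^ (-1) * 2 `^ (-1 * (p - 1)))%R.
  by rewrite powRD_gt0//; congr (_ `^ _)%R; ring.
have -> : (1 - p = -1 * (p - 1))%R by ring.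
by ring.
Qed.

End weighted_jensen.

Section mass.
Context {R : realType} {N : nat}.
Hypothesis N0 : (0 < N)%N.
Notation space := (euclidean_space R N).
Notation spacetime := (space * measurableTypeR R)%type.
Notation leb := (@spacetime_lebesgue R N).
Notation mu := (@lebesgue_measure R).
Notation h2 := (N.-1%:R / 2 : R).
Notation e1 := (N.-1%:R / 2 + 3 / 2 : R).

(** The power of [s] is the one that makes the weight increasing in time, so that
up to a constant this function lies below the weight at time [t] pulled back to
the earlier time [s]. *)
Definition source_weight (t : R) (z : spacetime) : R :=
  if (0 < (z.2 : R)) && ((z.2 : R) < t) then (z.2 : R) `^ e1 * poisson_weight z.2 z.1 else 0.

Lemma source_weight_ge0 t z : 0 <= source_weight t z.
Proof. by rewrite /source_weight; case: ifP => // /andP[s0 _]; rewrite mulr_ge0 ?powR_ge0 ?poisson_weight_ge0// ltW. Qed.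

Lemma measurable_source_weight t : measurable_fun setT (source_weight t).
Proof.
have mt : measurable_fun setT (fun z : spacetime => z.2 : R) by exact: measurable_snd.
apply: measurable_fun_ifT => //.
  by apply: measurable_and; exact: measurable_fun_ltr.
by apply: measurable_funM; [exact: (measurableT_comp (measurable_powR _) mt)|exact: measurable_poisson_weight2].
Qed.

Lemma enorm_tsub n (x y : n.-tuple R) :
  enorm (tsub x y) ^+ 2 <= 2 * enorm x ^+ 2 + 2 * enorm y ^+ 2.
Proof.
rewrite !enorm_sqr !mulr_sumr -big_split/=; apply: ler_sum => i _.
rewrite tnth_mktuple; have := sqr_ge0 (tnth x i + tnth y i).
by rewrite sqrrD sqrrB; lra.
Qed.

(** Both sides are Gaussian in the second point. At times below [t0 / 4] the Gaussian
of the weight is narrower than that of the kernel seen from [(x, t0)], and both vanish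
linearly at the boundary. *)
Lemma source_weight_le_kernelD (x : space) (t0 : R) : 0 < (x.2 : R) -> 0 < t0 ->
  exists2 C : R, 0 < C & forall t z, t <= t0 / 4 -> C * source_weight t z <= kernelD ((x, t0), z).
Proof.
move=> x0 t00; have p0 := @pi_gt0 R.
have q0 : 0 < 4 * pi :> R by rewrite mulr_gt0.
pose e := - h2 - 2^-1 : R.
pose X2 : R := enorm x.1 ^+ 2 + (x.2 : R) ^+ 2.
exists (t0 `^ e * (x.2 / t0) * expR (- (2 * X2 / t0))).
  by rewrite !mulr_gt0 ?powR_gt0 ?expR_gt0 ?invr_gt0.
move=> t [y s] tt0; rewrite /source_weight/=; case: ifPn => [/andP[s0 st]|_]; last by rewrite mulr0 kernelD_ge0.
have [y0|y0] := ltP 0 (y.2 : R); last by rewrite /poisson_weight ltNge y0/= !mulr0 kernelD_ge0.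
have st0 : s < t0 by lra.
have sts : 4 * s <= t0 by lra.
rewrite poisson_weightE// /kernelD/= s0 st0 x0 y0/= /dir1 heat1_sub ?subr_gt0//.
set r := t0 - s; have r0 : 0 < r by rewrite subr_gt0.
have r1 : r <= t0 by rewrite /r; lra.
have r2 : 3 / 4 * t0 <= r by rewrite /r; lra.
pose Y2 : R := enorm y.1 ^+ 2 + (y.2 : R) ^+ 2.
pose D2 : R := enorm (tsub x.1 y.1) ^+ 2 + (x.2 - y.2 : R) ^+ 2.
have DXY : D2 <= 2 * X2 + 2 * Y2.
  rewrite /D2 /X2 /Y2; have := enorm_tsub x.1 y.1.
  by have := sqr_ge0 (x.2 + y.2 : R); rewrite sqrrD sqrrB; lra.
have X20 : 0 <= X2 by rewrite addr_ge0 ?sqr_ge0.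
have Y20 : 0 <= Y2 by rewrite addr_ge0 ?sqr_ge0.
have GE : heatN r (tsub x.1 y.1) * heat1 r (x.2 - y.2) = (4 * pi * r) `^ e * expR (- (D2 / (4 * r))).
  rewrite heatNE ?(ltW r0)// /heat1 mulrACA powRD_gt0 ?mulr_gt0// -expRD.
  by congr (_ * expR _); rewrite -opprD -mulrDl.
rewrite [leRHS]mulrA GE.
pose zz : R := x.2 * y.2 / r.
have zz0 : 0 < zz by rewrite divr_gt0// mulr_gt0.
(* [z <= expR z - 1] keeps the linear vanishing at the boundary *)
have ez : zz * expR (- zz) <= 1 - expR (- zz).
  have := expR_ge1Dx zz; rewrite addrC -lerBrDr => /(ler_wpM2r (expR_ge0 (- zz))).
  by rewrite mulrBl mul1r -expRD subrr expR0.
have zzl : x.2 * y.2 / t0 <= zz.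
  by rewrite /zz ler_pM2l ?mulr_gt0// lef_pV2.
have zzu : zz <= (Y2 / 4 + X2) / r.
  rewrite /zz ler_wpM2r ?invr_ge0 ?(ltW r0)// /Y2 /X2.
  have := sqr_ge0 (y.2 / 2 - x.2 : R); have := sqr_ge0 (enorm x.1); have := sqr_ge0 (enorm y.1).
  by rewrite sqrrB exprMn; lra.
have pe : (4 * pi * t0) `^ e <= (4 * pi * r) `^ e.
  have -> : e = - (h2 + 2^-1) by rewrite /e; ring.
  rewrite !powRN lef_pV2 ?posrE ?powR_gt0 ?mulr_gt0//.
  have h0 : 0 <= h2 + 2^-1 :> R by rewrite addr_ge0 ?divr_ge0.
  apply: ge0_ler_powR; rewrite ?nnegrE ?(mulr_ge0 (ltW q0) (ltW r0)) ?(mulr_ge0 (ltW q0) (ltW t00))//.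
  by rewrite ler_pM2l.
(* the exponents compare because [4 s <= t0] and [3 / 4 t0 <= r] *)
have ex : expR (- (2 * X2 / t0)) * expR (- (Y2 / (4 * s))) <= expR (- (D2 / (4 * r))) * expR (- zz).
  rewrite -!expRD ler_expR -!opprD lerN2.
  apply: (@le_trans _ _ ((2 * X2 + 2 * Y2) / (4 * r) + (Y2 / 4 + X2) / r)).
    by apply: lerD => //; rewrite ler_wpM2r// invr_ge0 mulr_ge0// ltW.
  have -> : (2 * X2 + 2 * Y2) / (4 * r) + (Y2 / 4 + X2) / r = (3 / 2 * X2 + 3 / 4 * Y2) / r.
    by field; rewrite gt_eqF.
  rewrite ler_pdivrMr//.
  apply: (@le_trans _ _ ((2 * X2 / t0 + Y2 / t0) * (3 / 4 * t0))).
    by apply: eqW; field; rewrite gt_eqF.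
  apply: ler_pM => //; rewrite ?addr_ge0 ?divr_ge0 ?mulr_ge0 ?(ltW t00)//.
  by rewrite lerD2l ler_wpM2l// lef_pV2 ?posrE ?mulr_gt0.
rewrite -/zz; apply: (@le_trans _ _ ((4 * pi * r) `^ e * expR (- (D2 / (4 * r))) * (zz * expR (- zz)))); last first.
  by rewrite ler_wpM2l// mulr_ge0 ?powR_ge0 ?expR_ge0.
rewrite [leLHS](_ : _ = (4 * pi * t0) `^ e * (x.2 * y.2 / t0) *
   (expR (- (2 * X2 / t0)) * expR (- (Y2 / (4 * s))))); last first.
  by rewrite (powRM e (ltW q0) (ltW t00)) -/Y2 -/e; ring.
rewrite [leRHS](_ : _ = (4 * pi * r) `^ e * zz * (expR (- (D2 / (4 * r))) * expR (- zz))); last by ring.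
have xy0 : 0 <= x.2 * y.2 / t0 by rewrite divr_ge0 ?mulr_ge0 ?(ltW t00) ?(ltW x0) ?(ltW y0).
apply: ler_pM => //.
- by rewrite mulr_ge0 ?powR_ge0.
- by apply: ler_pM => //; exact: powR_ge0.
Qed.

End mass.

(** * The weighted mass of a mild solution *)

Section mass_lower.
Context {R : realType} {N : nat}.
Hypothesis N0 : (0 < N)%N.
Notation space := (euclidean_space R N).
Notation spacetime := (space * measurableTypeR R)%type.
Notation leb := (@spacetime_lebesgue R N).
Notation mu := (@lebesgue_measure R).
Notation h2 := (N.-1%:R / 2 : R).
Notation e1 := (N.-1%:R / 2 + 3 / 2 : R).
Local Open Scope ereal_scope.

(** On the interval between [sqrt t] and [2 sqrt t] the integrand is of order [t ^ (- 2)]. *)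
Lemma pois1_sqr_lower (t : R) : (0 < t)%R ->
  ((4 * pi)^-1 * expR (- 2) * t `^ (- (3 / 2)))%:E <=
  \int[mu]_y (if (0 < y)%R then (pois1 t y * pois1 t y)%:E else 0).
Proof.
move=> t0; have r0 : (0 < Num.sqrt t)%R by rewrite sqrtr_gt0.
have E : t = (Num.sqrt t ^+ 2)%R by rewrite sqr_sqrtr ?ltW.
have p0 := @pi_gt0 R; have q0 : (0 < 4 * pi :> R)%R by rewrite mulr_gt0.
have mI : measurable (`](Num.sqrt t)%R, (2 * Num.sqrt t)%R[%classic : set R) by exact: measurable_itv.
have mf : measurable_fun setT (fun y : R => if (0 < y)%R then (pois1 t y * pois1 t y)%:E else 0).
  apply: measurable_fun_ifT => //; first exact: measurable_fun_ltr.
  by apply/measurable_EFinP; apply: measurable_funM; exact: measurable_pois1r.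
have f0 (y : R) : 0 <= (if (0 < y)%R then (pois1 t y * pois1 t y)%:E else 0).
  by case: ifP => // _; rewrite lee_fin -expr2 sqr_ge0.
apply: (@le_trans _ _ (\int[mu]_(y in `](Num.sqrt t)%R, (2 * Num.sqrt t)%R[)
   (if (0 < y)%R then (pois1 t y * pois1 t y)%:E else 0))); last first.
  by apply: ge0_subset_integral => //.
pose c : R := (t^-1 * ((4 * pi * t)^-1 * expR (- 2)))%R.
apply: (@le_trans _ _ (\int[mu]_(y in `](Num.sqrt t)%R, (2 * Num.sqrt t)%R[) (cst c%:E y))).
  rewrite integral_cst//= lebesgue_measure_itv/= lte_fin ltr_pMl// ltr1n -EFinB -EFinM lee_fin.
  apply: eqW.
  rewrite /c (_ : 2 * Num.sqrt t - Num.sqrt t = Num.sqrt t)%R; last by ring.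
  rewrite powRN (_ : 3 / 2 = 1 + 2^-1)%R; last by field.
  rewrite -powRD_gt0// powRr1 ?(ltW t0)// powR12_sqrt ?(ltW t0)//.
  move: (Num.sqrt t) E r0 => r E r0; rewrite E.
  have := gt_eqF q0; clear c; move: (4 * pi)%R => a a0; field; rewrite (gt_eqF r0) a0//.
apply: ge0_le_integral => //.
- by move=> y _; rewrite lee_fin /c !mulr_ge0 ?invr_ge0 ?expR_ge0// ?mulr_ge0 ?(ltW t0) ?(ltW p0).
- exact: measurable_funTS.
move=> y /=; rewrite in_itv/= => /andP[y1 y2].
have y0 : (0 < y)%R by exact: lt_trans y1.
rewrite y0 lee_fin /pois1 /heat1.
have -> : (y / t * ((4 * pi * t) `^ (- 2^-1) * expR (- (y ^+ 2 / (4 * t)))) *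
   (y / t * ((4 * pi * t) `^ (- 2^-1) * expR (- (y ^+ 2 / (4 * t))))) =
   (y ^+ 2 / t ^+ 2) * (((4 * pi * t) `^ (- 2^-1) * (4 * pi * t) `^ (- 2^-1)) *
   (expR (- (y ^+ 2 / (4 * t))) * expR (- (y ^+ 2 / (4 * t))))))%R.
  by field; rewrite gt_eqF.
rewrite -expRD powRD_gt0 ?mulr_gt0// (_ : - 2^-1 + - 2^-1 = - 1 :> R)%R; last by field.
rewrite powR_inv1 ?mulr_ge0 ?(ltW p0) ?(ltW t0)//.
have a1 : (t <= y ^+ 2)%R by rewrite E lerXn2r ?nnegrE ?(ltW r0) ?(ltW y0) ?(ltW y1).
have a2 : (y ^+ 2 <= 4 * t)%R.
  have -> : (4 * t = (2 * Num.sqrt t) ^+ 2)%R by rewrite exprMn -E; ring.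
  by rewrite lerXn2r ?nnegrE ?mulr_ge0 ?(ltW r0) ?(ltW y0) ?(ltW y2).
rewrite /c; apply: ler_pM.
- by rewrite invr_ge0 ltW.
- by rewrite mulr_ge0 ?expR_ge0// invr_ge0 !mulr_ge0 ?(ltW p0) ?(ltW t0).
- by rewrite ler_pdivlMr ?exprn_gt0// expr2 mulrA mulVf ?mul1r ?gt_eqF.
- rewrite ler_wpM2l ?invr_ge0 ?mulr_ge0 ?(ltW p0) ?(ltW t0)// ler_expR -opprD lerN2.
  have : (y ^+ 2 / (4 * t) <= 1)%R by rewrite ler_pdivrMr ?mul1r ?mulr_gt0.
  lra.
Qed.

Lemma heatN2_lower n (t : R) (y : n.-tuple R) : (0 < t)%R -> (enorm y <= Num.sqrt t)%R ->
  ((8 * pi) `^ (- (n%:R / 2)) * expR (- 8^-1) * t `^ (- (n%:R / 2)) <= heatN (t + t) y)%R.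
Proof.
move=> t0 yt; have p0 := @pi_gt0 R.
rewrite heatNE ?addr_ge0 ?(ltW t0)//.
have -> : (4 * pi * (t + t) = 8 * pi * t)%R by ring.
rewrite (@powRM _ (8 * pi)%R t) ?mulr_ge0 ?(ltW p0) ?(ltW t0)//.
rewrite mulrAC ler_wpM2l ?mulr_ge0 ?powR_ge0// ler_expR lerN2.
rewrite ler_pdivrMr ?mulr_gt0 ?addr_gt0//.
have : (enorm y ^+ 2 <= t)%R.
  by rewrite -[leRHS]sqr_sqrtr ?(ltW t0)// lerXn2r ?nnegrE ?enorm_ge0 ?sqrtr_ge0.
by lra.
Qed.

End mass_lower.

Section mass.
Context {R : realType} {N : nat}.
Hypothesis N0 : (0 < N)%N.
Notation space := (euclidean_space R N).
Notation spacetime := (space * measurableTypeR R)%type.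
Notation leb := (@spacetime_lebesgue R N).
Notation mu := (@lebesgue_measure R).
Notation h2 := (N.-1%:R / 2 : R).
Notation e1 := (N.-1%:R / 2 + 3 / 2 : R).
Local Open Scope ereal_scope.

Definition mass (v : spacetime -> \bar R) (t : R) : \bar R :=
  \int[@space_lebesgue R N]_x ((poisson_weight t x)%:E * v (x, t)).

Definition source (v : spacetime -> \bar R) (p t : R) : \bar R :=
  \int[leb]_z ((source_weight t z)%:E * v z `^ p).

Definition hmass (p t : R) : \bar R :=
  \int[lebesgue_tuple N.-1]_y (if (enorm y <= Num.sqrt t)%R then @hdens R N p y else 0%R)%:E.

(** By the semigroup law the double integral is the integral of [h] against the
heat kernel at time [2 t], which is of order [t `^ (- h2)] on the ball. *)
Lemma hmass_lower (p t : R) : (0 < t)%R ->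
  ((8 * pi) `^ (- h2) * expR (- 8^-1) * t `^ (- h2))%:E * hmass p t <=
  \int[lebesgue_tuple N.-1]_x ((heatN t x)%:E *
     \int[lebesgue_tuple N.-1]_y (heatN t (tsub x y) * @hdens R N p y)%:E).
Proof.
move=> t0.
pose F (z : N.-1.-tuple R * N.-1.-tuple R) : \bar R :=
  (heatN t z.1 * (heatN t (tsub z.1 z.2) * @hdens R N p z.2))%:E.
have F0 z : 0 <= F z by rewrite lee_fin !mulr_ge0 ?heatN_ge0 ?hdens_ge0.
have mF : measurable_fun setT F.
  apply/measurable_EFinP; apply: measurable_funM.
    exact: (measurableT_comp (@measurable_heatN1 R N.-1 t) measurable_fst).
  apply: measurable_funM.
    exact: (measurableT_comp (@measurable_heatN1 R N.-1 t) (@measurable_tsub R N.-1)).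
  exact: (measurableT_comp (@measurable_hdens R N p) measurable_snd).
rewrite (eq_integral (fun x => \int[lebesgue_tuple N.-1]_y F (x, y))); last first.
  move=> x _; rewrite -ge0_integralZl_EFin ?heatN_ge0//.
  - by move=> y _; rewrite lee_fin mulr_ge0 ?heatN_ge0 ?hdens_ge0.
  - apply/measurable_EFinP/measurable_funM; [exact: measurable_heatN_tsub|exact: measurable_hdens].
rewrite fubini_tonelli//=.
have c0 : (0 <= (8 * pi) `^ (- h2) * expR (- 8^-1) * t `^ (- h2) :> R)%R.
  by rewrite !mulr_ge0 ?powR_ge0 ?expR_ge0.
have mi : measurable_fun setT (fun y => (if (enorm y <= Num.sqrt t)%R then @hdens R N p y else 0%R)%:E).
  apply/measurable_EFinP; apply: measurable_fun_ifT => //; last exact: measurable_hdens.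
  by apply: measurable_fun_ler => //; exact: measurable_enorm.
have i0 y : 0 <= (if (enorm y <= Num.sqrt t)%R then @hdens R N p y else 0%R)%:E.
  by case: ifP; rewrite lee_fin ?hdens_ge0.
rewrite /hmass -ge0_integralZl_EFin//.
apply: ge0_le_integral => //.
- by move=> y _; rewrite mule_ge0.
- exact: emeasurable_funM.
- exact: (measurable_fun_fubini_tonelli_G _ mF F0).
move=> y _.
have -> : \int[lebesgue_tuple N.-1]_x F (x, y) = (heatN (t + t) y * @hdens R N p y)%:E.
  rewrite [in RHS]EFinM -heatN_semigroup// -ge0_integralZr ?lee_fin ?hdens_ge0//.
  - by apply: eq_integral => x _; rewrite /F/= heatN_tsubC -EFinM; congr (_%:E); ring.
  - apply/measurable_EFinP/measurable_funM; [exact: measurable_heatN_tsub|exact: measurable_heatN1].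
  - by move=> x _; rewrite lee_fin mulr_ge0 ?heatN_ge0.
case: ifPn => yt; last by rewrite mule0 lee_fin mulr_ge0 ?heatN_ge0 ?hdens_ge0.
by rewrite -EFinM lee_fin ler_wpM2r ?hdens_ge0// heatN2_lower.
Qed.

Lemma mass_potential : exists2 c : R, (0 < c)%R & forall p k t, (0 < t)%R -> (0 <= k)%R ->
  (c * k)%:E * hmass p t <= (t `^ e1)%:E * mass (potential p k) t.
Proof.
have p0 := @pi_gt0 R.
exists ((4 * pi)^-1 * expR (- 2) * ((8 * pi) `^ (- h2) * expR (- 8^-1)))%R.
  by rewrite !mulr_gt0 ?powR_gt0 ?expR_gt0 ?invr_gt0 ?mulr_gt0.
move=> p k t t0 k0.
pose H x := \int[lebesgue_tuple N.-1]_y (heatN t (tsub x y) * @hdens R N p y)%:E.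
have H0 x : 0 <= H x.
  by apply: integral_ge0 => y _; rewrite lee_fin mulr_ge0 ?heatN_ge0 ?hdens_ge0.
have mH : measurable_fun setT H.
  pose F (z : N.-1.-tuple R * N.-1.-tuple R) : \bar R :=
    (heatN t (tsub z.1 z.2) * @hdens R N p z.2)%:E.
  have mF : measurable_fun setT F.
    apply/measurable_EFinP/measurable_funM.
      exact: (measurableT_comp (@measurable_heatN1 R N.-1 t) (@measurable_tsub R N.-1)).
    exact: (measurableT_comp (@measurable_hdens R N p) measurable_snd).
  have F0 z : 0 <= F z by rewrite lee_fin mulr_ge0 ?heatN_ge0 ?hdens_ge0.
  exact: (measurable_fun_fubini_tonelli_F _ mF F0).
pose g (y : R) := k%:E * (if (0 < y)%R then (pois1 t y * pois1 t y)%:E else 0).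
have g20 (y : R) : 0 <= (if (0 < y)%R then (pois1 t y * pois1 t y)%:E else 0).
  by case: ifP => // _; rewrite lee_fin -expr2 sqr_ge0.
have mg2 : measurable_fun setT (fun y : R => if (0 < y)%R then (pois1 t y * pois1 t y)%:E else 0).
  apply: measurable_fun_ifT => //; first exact: measurable_fun_ltr.
  by apply/measurable_EFinP; apply: measurable_funM; exact: measurable_pois1r.
have mE : mass (potential p k) t =
    (\int[lebesgue_tuple N.-1]_x ((heatN t x)%:E * H x)) * \int[mu]_y g y.
  rewrite -(@integral_space_sep R N (fun x => (heatN t x)%:E * H x) g).
  - apply: eq_integral => x _; rewrite /potential/= t0/= -/(H x.1) /poisson_weight /g.
    case: ifPn => x0; last by rewrite mul0e !mule0.
    by rewrite muleA [RHS]muleAC -!EFinM; congr (_%:E * _); move: (pois1 t _) => a; ring.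
  - by move=> x; rewrite mule_ge0// lee_fin heatN_ge0.
  - by apply: emeasurable_funM => //; apply/measurable_EFinP; exact: measurable_heatN1.
  - by move=> y; rewrite /g mule_ge0.
  - exact: emeasurable_funM.
have hm0 : 0 <= hmass p t.
  by apply: integral_ge0 => y _; rewrite lee_fin; case: ifP => // _; exact: hdens_ge0.
rewrite mE /g ge0_integralZl_EFin//.
apply: (@le_trans _ _ ((t `^ e1)%:E *
  ((((8 * pi) `^ (- h2) * expR (- 8^-1) * t `^ (- h2))%:E * hmass p t) *
   (k%:E * ((4 * pi)^-1 * expR (- 2) * t `^ (- (3 / 2)))%:E)))); last first.
  apply: lee_wpmul2l; first by rewrite lee_fin powR_ge0.
  apply: lee_pmul.
  - by rewrite mule_ge0// lee_fin !mulr_ge0 ?powR_ge0 ?expR_ge0.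
  - by rewrite mule_ge0// lee_fin !mulr_ge0 ?powR_ge0 ?expR_ge0 ?invr_ge0 ?mulr_ge0 ?(ltW p0).
  - exact: hmass_lower.
  - by apply: lee_wpmul2l => //; exact: pois1_sqr_lower.
rewrite [in leRHS]muleAC -!EFinM !muleA -!EFinM; apply: eqW.
congr (_%:E * _).
transitivity ((4 * pi)^-1 * expR (- 2) * ((8 * pi) `^ (- h2) * expR (- 8^-1)) * k *
  (t `^ e1 * (t `^ (- h2) * t `^ (- (3 / 2)))))%R; last by ring.
by rewrite !powRD_gt0// (_ : e1 + _ = 0)%R ?powRr0 ?mulr1//; ring.
Qed.

(** The reproducing identity gives the weight at time [2 t - s]. Since it is at least
[s] and at most [2 t], monotonicity in time replaces it by the weight at [s] up to
the constant. *)
Lemma mass_duhamel (v : spacetime -> \bar R) (p t : R) : (0 < t)%R ->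
  measurable_fun setT v -> (forall z, 0 <= v z) ->
  (2 `^ (- e1))%:E * source v p t <=
  (t `^ e1)%:E * \int[@space_lebesgue R N]_x ((poisson_weight t x)%:E *
    \int[leb]_z ((kernelD ((x, t), z))%:E * v z `^ p)).
Proof.
move=> t0 mv v0.
have e10 : (0 <= e1)%R by rewrite addr_ge0 ?divr_ge0.
have mvp : measurable_fun setT (fun z => v z `^ p).
  exact: (measurableT_comp (measurable_poweR _) mv).
pose F (a : space * spacetime) : \bar R :=
  (poisson_weight t a.1 * kernelD ((a.1, t), a.2))%:E * v a.2 `^ p.
have F0 a : 0 <= F a.
  by rewrite mule_ge0 ?poweR_ge0// lee_fin mulr_ge0 ?poisson_weight_ge0 ?kernelD_ge0// ltW.
have mF : measurable_fun setT F.
  apply: emeasurable_funM; last exact: (measurableT_comp mvp measurable_snd).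
  apply/measurable_EFinP; apply: measurable_funM.
    exact: (measurableT_comp (@measurable_poisson_weight R N t) measurable_fst).
  apply: (measurableT_comp (@measurable_kernelD R N) (g := fun a : space * spacetime => ((a.1, t), a.2))).
  by apply: measurable_fun_pair => //; exact: measurable_fun_pair.
rewrite [in leRHS](eq_integral (fun x => \int[leb]_z F (x, z))); last first.
  move=> x _; rewrite -ge0_integralZl_EFin ?poisson_weight_ge0 ?(ltW t0)//.
  - by apply: eq_integral => z _; rewrite /F/= EFinM muleA.
  - by move=> z _; rewrite mule_ge0 ?poweR_ge0// lee_fin kernelD_ge0.
  - apply: emeasurable_funM => //; apply/measurable_EFinP.
    exact: (measurableT_comp (@measurable_kernelD R N) (measurable_pair1 (x, t))).
rewrite fubini_tonelli//=.
rewrite /source -!ge0_integralZl_EFin ?powR_ge0//; last 4 first.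
- by move=> z _; exact: integral_ge0.
- exact: (measurable_fun_fubini_tonelli_G _ mF F0).
- by move=> z _; rewrite mule_ge0 ?poweR_ge0// lee_fin source_weight_ge0.
- by apply: emeasurable_funM => //; apply/measurable_EFinP; exact: measurable_source_weight.
apply: ge0_le_integral => //.
- by move=> z _; rewrite !mule_ge0 ?poweR_ge0// lee_fin ?powR_ge0 ?source_weight_ge0.
- apply: emeasurable_funM => //.
  by apply: emeasurable_funM => //; apply/measurable_EFinP; exact: measurable_source_weight.
- by apply: emeasurable_funM => //; exact: (measurable_fun_fubini_tonelli_G _ mF F0).
move=> [y s] _.
have I0 : 0 <= (t `^ e1)%:E * \int[@space_lebesgue R N]_x F (x, (y, s)).
  by rewrite mule_ge0 ?lee_fin ?powR_ge0//; exact: integral_ge0.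
rewrite {1}/source_weight/=; case: ifPn => [/andP[s0 st]|_]; last by rewrite mul0e mule0.
have [y0|y0] := ltP 0%R (y.2 : R); last first.
  by rewrite /poisson_weight ltNge y0/= mulr0 mul0e mule0.
have r0 : (0 < t - s + t)%R by rewrite addr_gt0// subr_gt0.
have -> : \int[@space_lebesgue R N]_x F (x, (y, s)) = (poisson_weight (t - s + t) y)%:E * v (y, s) `^ p.
  rewrite -integral_poisson_weight_kernelD ?s0// -ge0_integralZr ?poweR_ge0//.
  - apply: emeasurable_funM; apply/measurable_EFinP; first exact: measurable_poisson_weight.
    apply: (measurableT_comp (@measurable_kernelD R N) (g := fun x : space => ((x, t), (y, s)))).
    by apply: measurable_fun_pair => //; exact: measurable_fun_pair.
  - by move=> x _; rewrite mule_ge0// lee_fin ?kernelD_ge0 ?poisson_weight_ge0// ltW.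
rewrite !muleA; apply: lee_wpmul2r; first exact: poweR_ge0.
rewrite -!EFinM lee_fin.
have h1 : (s `^ e1 * poisson_weight s y <= (t - s + t) `^ e1 * poisson_weight (t - s + t) y)%R.
  by apply: le_poisson_weight => //; lra.
have h3 : ((t - s + t) `^ e1 <= 2 `^ e1 * t `^ e1)%R.
  rewrite -powRM ?(ltW t0)//; apply: ge0_ler_powR; rewrite ?nnegrE ?mulr_ge0 ?(ltW r0) ?(ltW t0)//.
  by lra.
have -> : (t `^ e1 = 2 `^ (- e1) * (2 `^ e1 * t `^ e1))%R.
  by rewrite mulrA powRD_gt0// (_ : - e1 + e1 = 0)%R ?powRr0 ?mul1r//; ring.
rewrite -mulrA ler_wpM2l ?powR_ge0//; apply: (le_trans h1).
by rewrite ler_wpM2r// poisson_weight_ge0// ltW.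
Qed.

(** The two contributions of the mild equation, tested against the weight. *)
Lemma mass_lower : exists2 c : R, (0 < c)%R & forall p k t T v, (0 < t < T)%R -> (0 <= k)%R ->
  measurable_fun setT v -> (forall z, 0 <= v z) ->
  (forall z, Q_ T z -> v z = mild p k v z) ->
  (c * k)%:E * hmass p t + c%:E * source v p t <= (t `^ e1)%:E * mass v t.
Proof.
have [c c0 cP] := mass_potential.
exists (Num.min c (2 `^ (- e1)))%R; first by rewrite lt_min c0 powR_gt0.
move=> p k t T v /andP[t0 tT] k0 mv v0 vE.
have mvp : measurable_fun setT (fun z => v z `^ p).
  exact: (measurableT_comp (measurable_poweR _) mv).
have mD : measurable_fun setT (fun x : space => \int[leb]_z ((kernelD ((x, t), z))%:E * v z `^ p)).
  pose F (a : space * spacetime) : \bar R := (kernelD ((a.1, t), a.2))%:E * v a.2 `^ p.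
  have mF : measurable_fun setT F.
    apply: emeasurable_funM; last exact: (measurableT_comp mvp measurable_snd).
    apply/measurable_EFinP.
    apply: (measurableT_comp (@measurable_kernelD R N) (g := fun a : space * spacetime => ((a.1, t), a.2))).
    by apply: measurable_fun_pair => //; exact: measurable_fun_pair.
  have F0 a : 0 <= F a by rewrite mule_ge0 ?poweR_ge0// lee_fin kernelD_ge0.
  exact: (measurable_fun_fubini_tonelli_F _ mF F0).
have D0 (x : space) : 0 <= \int[leb]_z ((kernelD ((x, t), z))%:E * v z `^ p).
  by apply: integral_ge0 => z _; rewrite mule_ge0 ?poweR_ge0// lee_fin kernelD_ge0.
have mpw : measurable_fun setT (fun x => (@poisson_weight R N t x)%:E).
  by apply/measurable_EFinP; exact: measurable_poisson_weight.
have mw : measurable_fun setT (fun x : space => potential p k (x, t)).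
  apply: (measurableT_comp (@measurable_potential R N p k) (g := fun x : space => (x, t))).
  exact: measurable_fun_pair.
have mEq : mass v t = mass (potential p k) t +
    \int[@space_lebesgue R N]_x ((poisson_weight t x)%:E * \int[leb]_z ((kernelD ((x, t), z))%:E * v z `^ p)).
  rewrite /mass -ge0_integralD//; last 4 first.
  - by move=> x _; rewrite mule_ge0 ?potential_ge0// lee_fin poisson_weight_ge0// ltW.
  - exact: emeasurable_funM.
  - by move=> x _; rewrite mule_ge0// lee_fin poisson_weight_ge0// ltW.
  - exact: emeasurable_funM.
  apply: eq_integral => x _.
  have [x0|x0] := ltP 0%R (x.2 : R); last by rewrite /poisson_weight ltNge x0/= !mul0e adde0.
  rewrite vE; last by split => //=; rewrite t0 tT.
  by rewrite /mild /volterra ge0_muleDr ?potential_ge0.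
have hm0 : 0 <= hmass p t.
  by apply: integral_ge0 => y _; rewrite lee_fin; case: ifP => // _; exact: hdens_ge0.
have so0 : 0 <= source v p t.
  by apply: integral_ge0 => z _; rewrite mule_ge0 ?poweR_ge0// lee_fin source_weight_ge0.
rewrite mEq [leRHS]ge0_muleDr; last 2 first.
- by apply: integral_ge0 => x _; rewrite mule_ge0 ?potential_ge0// lee_fin poisson_weight_ge0// ltW.
- by apply: integral_ge0 => x _; rewrite mule_ge0// lee_fin poisson_weight_ge0// ltW.
apply: leeD.
  apply: le_trans (cP p k t t0 k0); apply: lee_wpmul2r => //.
  by rewrite lee_fin ler_wpM2r// ge_min lexx.
apply: le_trans (@mass_duhamel v p t t0 mv v0); apply: lee_wpmul2r => //.
by rewrite lee_fin ge_min lexx orbT.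
Qed.

End mass.

(** * Nonexistence by iteration of lower bounds *)

Section blowup.
Context {R : realType} {N : nat}.
Hypothesis N0 : (0 < N)%N.
Notation space := (euclidean_space R N).
Notation spacetime := (space * measurableTypeR R)%type.
Notation leb := (@spacetime_lebesgue R N).
Notation mu := (@lebesgue_measure R).
Notation h2 := (N.-1%:R / 2 : R).
Notation e1 := (N.-1%:R / 2 + 3 / 2 : R).
Local Open Scope ereal_scope.

(** Jensen at each time [s]: the total mass of the weight is at most of order
[s `^ (- 2^-1)], which produces the exponent of [s] in the integral. *)
Lemma source_lower (v : spacetime -> \bar R) (p a t : R) (phi : R -> R) :
  (1 < p)%R -> (0 < a)%R -> measurable_fun setT v -> (forall z, 0 <= v z) ->
  measurable_fun setT phi -> (forall s, (0 < s < t)%R -> (0 < phi s)%R) ->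
  (forall s, (0 < s < t)%R -> (a * phi s)%:E <= (s `^ e1)%:E * mass v s) ->
  (2 `^ (- p) * (2 * 2 `^ 2^-1) `^ (1 - p) * a `^ p)%:E *
    \int[mu]_(s in `]0%R, t[) (s `^ (- ((p - 1) * (h2 + 1))) * phi s `^ p)%:E
  <= source v p t.
Proof.
move=> p1 a0 mv v0 mphi phi0 hm; have p0 := lt_trans ltr01 p1.
set c := (2 `^ _ * _ * _)%R.
have c0 : (0 <= c)%R by rewrite /c !mulr_ge0 ?powR_ge0.
have mvp : measurable_fun setT (fun z => v z `^ p).
  exact: (measurableT_comp (measurable_poweR _) mv).
have mI : measurable (`]0%R, t[%classic : set R) by exact: measurable_itv.
have mg : measurable_fun setT (fun s : R => (s `^ (- ((p - 1) * (h2 + 1))) * phi s `^ p)%:E).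
  apply/measurable_EFinP/measurable_funM; first exact: measurable_powR.
  exact: (measurableT_comp (measurable_powR _) mphi).
have mj : measurable_fun setT (fun z : spacetime => (source_weight t z)%:E * v z `^ p).
  by apply: emeasurable_funM => //; apply/measurable_EFinP; exact: measurable_source_weight.
have j0 z : 0 <= (source_weight t z)%:E * v z `^ p by rewrite mule_ge0 ?poweR_ge0// lee_fin source_weight_ge0.
rewrite /source (ge0_integral_spacetime j0 mj) -ge0_integralZl_EFin//; last 2 first.
- by move=> s _; rewrite lee_fin mulr_ge0 ?powR_ge0.
- exact: measurable_funTS.
rewrite integral_mkcond; apply: ge0_le_integral => //.
- move=> s _; rewrite patchE; case: ifP => // _.
  by rewrite -EFinM lee_fin !mulr_ge0 ?powR_ge0.
- by apply/(measurable_restrictT _ mI)/measurable_funTS/emeasurable_funM.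
- have mj' : measurable_fun setT (fun z : R * space => (source_weight t (z.2, z.1))%:E * v (z.2, z.1) `^ p).
    apply: (measurableT_comp mj (g := fun z : R * space => (z.2, z.1))).
    exact: measurable_fun_pair.
  have j0' (z : R * space) : 0 <= (source_weight t (z.2, z.1))%:E * v (z.2, z.1) `^ p by exact: j0.
  exact: (measurable_fun_fubini_tonelli_F _ mj' j0').
move=> s _; rewrite patchE; case: ifPn => [/set_mem/=|_]; last exact: integral_ge0.
rewrite in_itv/= => st; case/andP: (st) => s0 _.
have -> : \int[@space_lebesgue R N]_y ((source_weight t (y, s))%:E * v (y, s) `^ p) =
    (s `^ e1)%:E * \int[@space_lebesgue R N]_y ((poisson_weight s y)%:E * v (y, s) `^ p).
  rewrite -ge0_integralZl_EFin ?powR_ge0//.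
  - by apply: eq_integral => y _; rewrite /source_weight/= st EFinM muleA.
  - by move=> y _; rewrite mule_ge0 ?poweR_ge0// lee_fin poisson_weight_ge0// ltW.
  - apply: emeasurable_funM; first by apply/measurable_EFinP; exact: measurable_poisson_weight.
    apply: (measurableT_comp mvp (g := fun y : space => (y, s))).
    exact: measurable_fun_pair.
have s1 e : (0 < s `^ e)%R by rewrite powR_gt0.
have se : (s `^ e1 * s `^ (- e1) = 1)%R by rewrite powRD_gt0// subrr powRr0.
have Z0 : (0 < 2 * 2 `^ 2^-1 * s `^ (- 2^-1) :> R)%R by rewrite !mulr_gt0 ?powR_gt0.
have M0 : (0 < a * phi s * s `^ (- e1))%R by rewrite !mulr_gt0 ?phi0.
have mvs : measurable_fun setT (fun y : space => v (y, s)).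
  apply: (measurableT_comp mv (g := fun y : space => (y, s))).
  exact: measurable_fun_pair.
have jen := @weighted_jensen _ space R (@space_lebesgue R N) (poisson_weight s) (fun y => v (y, s)) p _ _
  (fun x => poisson_weight_ge0 x (ltW s0)) (measurable_poisson_weight s) (fun y => v0 (y, s)) mvs p1 Z0 M0
  (integral_poisson_weight_le s0).
have {}jen := jen _.
apply: (@le_trans _ _ ((s `^ e1)%:E * (2 `^ (- p) * (2 * 2 `^ 2^-1 * s `^ (- 2^-1)) `^ (1 - p) *
    (a * phi s * s `^ (- e1)) `^ p)%:E)); last first.
  apply: lee_wpmul2l; first by rewrite lee_fin ltW.
  apply: jen; rewrite -(@lee_pmul2l _ (s `^ e1)%:E) ?lte_fin//.
  by rewrite -EFinM mulrCA se mulr1; exact: hm.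
rewrite -!EFinM lee_fin; apply: eqW.
have ph := phi0 s st.
rewrite powRM ?mulr_ge0 ?powR_ge0//.
rewrite (@powRM _ (a * phi s)%R) ?mulr_ge0 ?powR_ge0 ?(ltW a0) ?(ltW ph)//.
rewrite (@powRM _ a) ?(ltW a0) ?(ltW ph)// -!powRrM /c.
have -> : (- ((p - 1) * (h2 + 1)) = e1 + (- 2^-1 * (1 - p) + - e1 * p) :> R)%R by field.
by rewrite -!powRD_gt0//; ring.
Qed.

(** The solution at one later point dominates its Duhamel term. *)
Lemma source_finite (v : spacetime -> \bar R) (p k T : R) (z0 : spacetime) :
  measurable_fun setT v -> (forall z, 0 <= v z) -> (0 <= k)%R ->
  (forall z, Q_ T z -> v z = mild p k v z) -> Q_ T z0 -> v z0 < +oo ->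
  forall t, (t <= z0.2 / 4)%R -> source v p t < +oo.
Proof.
move=> mv v0 k0 vE Qz vz t tt; case: z0 Qz vz tt => [x t0] Qz vz /= tt.
case: (Qz) => /= x0 /andP[t00 _].
have mvp : measurable_fun setT (fun z => v z `^ p).
  exact: (measurableT_comp (measurable_poweR _) mv).
have [C C0 CP] := @source_weight_le_kernelD R N x t0 x0 t00.
have h : C%:E * source v p t <= v (x, t0).
  rewrite /source -ge0_integralZl_EFin ?(ltW C0)//; last 2 first.
  - by move=> z _; rewrite mule_ge0 ?poweR_ge0// lee_fin source_weight_ge0.
  - by apply: emeasurable_funM => //; apply/measurable_EFinP; exact: measurable_source_weight.
  rewrite vE// /mild /volterra.
  apply: (@le_trans _ _ (\int[leb]_y ((kernelD (x, t0, y))%:E * v y `^ p))); last first.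
    by rewrite leeDr// potential_ge0.
  apply: ge0_le_integral => //.
  - by move=> z _; rewrite !mule_ge0 ?poweR_ge0// lee_fin ?(ltW C0) ?source_weight_ge0.
  - apply: emeasurable_funM => //.
    by apply: emeasurable_funM => //; apply/measurable_EFinP; exact: measurable_source_weight.
  - apply: emeasurable_funM => //; apply/measurable_EFinP.
    exact: (measurableT_comp (@measurable_kernelD R N) (measurable_pair1 (x, t0))).
  by move=> z _; rewrite muleA; apply: lee_wpmul2r; [exact: poweR_ge0|rewrite -EFinM lee_fin CP].
have {}h := le_lt_trans h vz.
rewrite ltNge leye_eq; apply/negP => /eqP E.
by move: h; rewrite E gt0_muley ?lte_fin// ltxx.
Qed.

(** A lower bound [a * phi] on the mass returns through [source_lower] and
[mass_lower] as [d * a `^ p * phi] with [d] independent of [kappa], while the datum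
provides a starting value of [a] proportional to [kappa]. Once [d * a `^ (p - 1) >= 2]
the bound doubles at each step, against [source_finite]. *)
Lemma nonexistence_criterion (p T0 c4 c5 : R) (phi : R -> R) : (1 < p)%R ->
  (0 < T0)%R -> (0 < c4)%R -> (0 < c5)%R ->
  measurable_fun setT phi -> (forall s, (0 < s < T0)%R -> (0 < phi s)%R) ->
  (forall t, (0 < t < T0)%R -> (c5 * phi t)%:E <= @hmass R N p t) ->
  (forall t, (0 < t < T0)%R -> (c4 * phi t)%:E <=
    \int[mu]_(s in `]0%R, t[) (s `^ (- ((p - 1) * (h2 + 1))) * phi s `^ p)%:E) ->
  exists2 kappa1 : R, (0 < kappa1)%R &
    forall k : {posnum R}, (kappa1 <= k%:num)%R ->
      ~ local_in_time_solvable p (boundary_datum N p k).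
Proof.
move=> p1 T00 c40 c50 mphi phi0 hh hphi; have p0 := lt_trans ltr01 p1.
have p10 : (0 < p - 1)%R by rewrite subr_gt0.
have [c1 c10 c1P] := @mass_lower R N.
have [c [cE c0]] : exists c : R, c = (2 `^ (- p) * (2 * 2 `^ 2^-1) `^ (1 - p))%R /\ (0 < c)%R.
  by eexists; split; first reflexivity; rewrite mulr_gt0 ?powR_gt0// mulr_gt0 ?powR_gt0.
have [d [dE d0]] : exists d : R, d = (c1 * c * c4)%R /\ (0 < d)%R.
  by eexists; split; first reflexivity; rewrite !mulr_gt0.
(* the value for which the starting constant [a] gives [d * a `^ (p - 1) = 2] *)
exists ((2 / d) `^ (p - 1)^-1 / (c1 * c5))%R; first by rewrite divr_gt0 ?powR_gt0 ?divr_gt0 ?mulr_gt0.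
move=> k kk /(solvable_mild N0 p0)[T [v [T1 [mv v0 vE _ [z0 [Qz0 vz0]]]]]].
have [a [aE a0]] : exists a : R, a = (c1 * k%:num * c5)%R /\ (0 < a)%R.
  by eexists; split; first reflexivity; rewrite !mulr_gt0.
have da : (2 <= d * a `^ (p - 1))%R.
  have h : ((2 / d) `^ (p - 1)^-1 <= a)%R.
    by move: kk; rewrite ler_pdivrMr ?mulr_gt0// aE; lra.
  rewrite mulrC -ler_pdivrMr//.
  rewrite [leLHS](_ : _ = ((2 / d) `^ (p - 1)^-1) `^ (p - 1))%R; last first.
    by rewrite -powRrM mulVf ?lt0r_neq0// powRr1// divr_ge0// ltW.
  by apply: ge0_ler_powR; rewrite ?nnegrE ?powR_ge0 ?(ltW p10) ?(ltW a0).
have [S [SE S0]] : exists S : R, S = Num.min T T0 /\ (0 < S)%R.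
  by eexists; split; first reflexivity; rewrite lt_min T1.
have ST : (S <= T)%R by rewrite SE ge_min lexx.
have ST0 : (S <= T0)%R by rewrite SE ge_min lexx orbT.
have so0 t : 0 <= source v p t.
  by apply: integral_ge0 => z _; rewrite mule_ge0 ?poweR_ge0// lee_fin source_weight_ge0.
have step (b : R) : (a <= b)%R ->
    (forall t, (0 < t < S)%R -> (b * phi t)%:E <= (t `^ e1)%:E * mass v t) ->
    forall t, (0 < t < S)%R -> (2 * b * phi t)%:E <= c1%:E * source v p t.
  move=> ab hb t /andP[t0 tS]; have b0 := lt_le_trans a0 ab.
  have := @source_lower v p b t phi p1 b0 mv v0 mphi _ _.
  rewrite -cE => h'.
  have {h'}h : (c * b `^ p)%:E *
      \int[mu]_(s in `]0%R, t[) (s `^ (- ((p - 1) * (h2 + 1))) * phi s `^ p)%:E <= source v p t.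
    apply: h'.
    - by move=> s /andP[s0 st]; apply: phi0; rewrite s0 (lt_le_trans (lt_trans st tS)).
    - by move=> s /andP[s0 st]; apply: hb; rewrite s0 (lt_trans st).
  have tT0 : (0 < t < T0)%R by rewrite t0 (lt_le_trans tS).
  apply: (@le_trans _ _ (c1%:E * ((c * b `^ p)%:E * (c4 * phi t)%:E))); last first.
    apply: lee_wpmul2l; first by rewrite lee_fin ltW.
    apply: le_trans h; apply: lee_wpmul2l; last exact: hphi.
    by rewrite lee_fin mulr_ge0 ?powR_ge0 ?(ltW c0).
  rewrite -!EFinM lee_fin -(mulr_powRB1 (ltW b0) p0).
  have -> : (c1 * (c * (b * b `^ (p - 1)) * (c4 * phi t)) = d * b `^ (p - 1) * b * phi t)%R.
    by rewrite dE; ring.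
  rewrite ler_wpM2r ?(ltW (phi0 _ tT0))// ler_wpM2r ?(ltW b0)//.
  apply: (le_trans da); rewrite ler_wpM2l ?(ltW d0)//.
  by apply: ge0_ler_powR; rewrite ?nnegrE ?(ltW p10) ?(ltW a0) ?(ltW b0).
have lower t : (0 < t < S)%R ->
    (a * phi t)%:E + c1%:E * source v p t <= (t `^ e1)%:E * mass v t.
  move=> /andP[t0 tS].
  have tT0 : (0 < t < T0)%R by rewrite t0 (lt_le_trans tS).
  have tT : (0 < t < T)%R by rewrite t0 (lt_le_trans tS).
  apply: le_trans (c1P p _ t T v tT _ mv v0 vE); last by [].
  apply: leeD2r; rewrite aE -mulrA EFinM.
  by apply: lee_wpmul2l; [rewrite lee_fin mulr_ge0// ltW|exact: hh].
have iter n t : (0 < t < S)%R ->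
    (2 ^+ n * a * phi t)%:E <= (t `^ e1)%:E * mass v t /\
    (2 * (2 ^+ n * a) * phi t)%:E <= c1%:E * source v p t.
  elim: n t => [|n ih].
    have h t : (0 < t < S)%R -> (2 ^+ 0 * a * phi t)%:E <= (t `^ e1)%:E * mass v t.
      move=> tS; rewrite expr0 mul1r; apply: le_trans (lower t tS).
      by rewrite leeDl// mule_ge0// lee_fin ltW.
    move=> t tS; split; first exact: h.
    by apply: step => //; rewrite expr0 mul1r.
  have h t : (0 < t < S)%R -> (2 ^+ n.+1 * a * phi t)%:E <= (t `^ e1)%:E * mass v t.
    move=> tS; apply: le_trans (lower t tS); rewrite exprS -(mulrA 2%R).
    apply: (le_trans (ih t tS).2); rewrite leeDr// lee_fin mulr_ge0 ?(ltW a0)//.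
    by rewrite ltW// phi0//; case/andP: tS => -> /= /lt_le_trans; exact.
  move=> t tS; split; first exact: h.
  apply: step => //; rewrite ler_peMl ?(ltW a0)//.
  by rewrite exprn_ege1// ler1n.
case: (Qz0) => _ /andP[t00 _].
(* a time early enough for both the iteration and the finite bound *)
have [t [tE t0]] : exists t : R, t = Num.min (z0.2 / 4)%R (S / 2)%R /\ (0 < t)%R.
  by eexists; split; first reflexivity; rewrite lt_min !divr_gt0.
have tS : (0 < t < S)%R.
  by rewrite t0 tE gt_min (_ : S / 2 < S)%R ?orbT//; lra.
have ph : (0 < phi t)%R by rewrite phi0//; case/andP: tS => -> /= /lt_le_trans; exact.
have fin : source v p t < +oo.
  apply: (@source_finite v p k%:num T z0 mv v0 _ vE Qz0 vz0) => //.
  by rewrite tE ge_min lexx.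
have sE : source v p t = (fine (source v p t))%:E by rewrite fineK// ge0_fin_numE.
set y : R := fine (source v p t) in sE.
have bound n : (2 ^+ n * (a * phi t) <= c1 * y)%R.
  have := (iter n t tS).2; rewrite sE -EFinM lee_fin => h; apply: le_trans h.
  by rewrite -!mulrA ler_peMl// ?ler1n// !mulr_ge0 ?exprn_ge0 ?(ltW a0) ?(ltW ph).
have ap : (0 < a * phi t)%R by rewrite mulr_gt0.
have := @archi_boundP R (c1 * y / (a * phi t))%R.
have y0 : (0 <= c1 * y / (a * phi t))%R.
  by rewrite divr_ge0 ?(ltW ap)// (le_trans _ (bound 0%N))// mulr_ge0 ?exprn_ge0 ?(ltW ap).
move=> /(_ y0); set n := Num.bound _.
rewrite ltr_pdivrMr// => h.
have := bound n; rewrite leNgt => /negP; apply; apply: (lt_le_trans h).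
rewrite ler_wpM2r ?(ltW ap)// -natrX ler_nat ltnW//.
exact: ltn_expl.
Qed.

End blowup.

(** * Integrals over a cone *)

Section radial.
Context {R : realType}.
Notation mu := (@lebesgue_measure R).

Lemma enorm_tcons n (z : R) (y : n.-tuple R) :
  enorm (tcons (z, y)) ^+ 2 = z ^+ 2 + enorm y ^+ 2.
Proof.
rewrite !enorm_sqr big_ord_recl/= tnth0; congr (_ + _).
by apply: eq_bigr => i _; rewrite tnthS; congr (tnth _ _ ^+ 2); exact: val_inj.
Qed.

Lemma enorm_tcons_bounds n (z : R) (y : n.-tuple R) : 0 < z -> enorm y < z ->
  z <= enorm (tcons (z, y)) <= 2 * z.
Proof.
move=> z0 yz; have E := enorm_tcons z y.
have y0 := enorm_ge0 y; have e0 := enorm_ge0 (tcons (z, y)).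
rewrite -(@ler_pXn2r _ 2) ?nnegrE ?(ltW z0)// -[X in _ && X](@ler_pXn2r _ 2) ?nnegrE ?mulr_ge0 ?(ltW z0)//.
have : enorm y ^+ 2 <= z ^+ 2 by rewrite ler_pXn2r ?nnegrE ?(ltW z0) ?(ltW yz).
have := sqr_ge0 (enorm y); rewrite E exprMn; lra.
Qed.

Local Open Scope ereal_scope.

(** A ball contains the product of an interval and of a ball of half the radius. *)
Lemma eball_volume_lower n : exists2 c : R, (0 < c)%R & forall r : R, (0 < r)%R ->
  (c * r ^+ n)%:E <= \int[lebesgue_tuple n]_y (\1_(@eball R n r) y)%:E.
Proof.
elim: n => [|n [c c0 ih]].
  exists 1%R => // r r0; rewrite ge0_integral_tuple0; last first.
    by apply/measurable_EFinP/measurable_indic; exact: measurable_eball.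
  rewrite indicE mem_set ?expr0 ?mulr1//.
  by rewrite /eball/= /enorm big_ord0 sqrtr0.
exists (c * 2^-1 ^+ n.+1)%R; first by rewrite mulr_gt0 ?exprn_gt0.
move=> r r0; rewrite ge0_integral_tupleS; last 2 first.
- by move=> x; rewrite lee_fin.
- by apply/measurable_EFinP/measurable_indic; exact: measurable_eball.
have r20 : (0 < r / 2)%R by rewrite divr_gt0.
pose F (z : measurableTypeR R * n.-tuple R) : \bar R := (\1_(@eball R n.+1 r) (tcons z))%:E.
have mF : measurable_fun setT F.
  have m1 : measurable_fun setT (fun x => (\1_(@eball R n.+1 r) x)%:E : \bar R).
    by apply/measurable_EFinP/measurable_indic; exact: measurable_eball.
  exact: (measurableT_comp m1 (@measurable_tcons R n)).
have F0 z : 0 <= F z by rewrite lee_fin.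
have mG : measurable_fun setT (fun z : measurableTypeR R => \int[lebesgue_tuple n]_x F (z, x)).
  exact: (measurable_fun_fubini_tonelli_F _ mF F0).
have mI : measurable (`]0%R, (r / 2)%R[%classic : set R) by exact: measurable_itv.
apply: (@le_trans _ _ (\int[mu]_(z in `]0%R, (r / 2)%R[) (cst (c * (r / 2) ^+ n)%:E z))).
  rewrite integral_cst//= lebesgue_measure_itv/= lte_fin r20 sube0 -EFinM lee_fin.
  apply: eqW.
  by rewrite exprMn !exprS; ring.
apply: (@le_trans _ _ (\int[mu]_(z in `]0%R, (r / 2)%R[) (\int[lebesgue_tuple n]_x F (z, x)))); last first.
  apply: ge0_subset_integral => //.
  by move=> z _; exact: integral_ge0.
apply: ge0_le_integral => //.
- by move=> z _; rewrite lee_fin mulr_ge0 ?exprn_ge0 ?(ltW c0) ?(ltW r20).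
- exact: measurable_funTS.
move=> z /=; rewrite in_itv/= => /andP[z0 zr].
apply: (le_trans (ih _ r20)); apply: ge0_le_integral => //.
- by apply/measurable_EFinP/measurable_indic; exact: measurable_eball.
- exact: (measurableT_comp mF (measurable_pair1 z)).
move=> y _; rewrite lee_fin !indicE.
case: (boolP (y \in eball _)) => [/set_mem yr|//]; rewrite mem_set//.
rewrite /eball/= -(@ltr_pXn2r _ 2) ?nnegrE ?enorm_ge0 ?(ltW r0)// enorm_tcons.
have h1 : (z ^+ 2 <= (r / 2) ^+ 2)%R by rewrite ler_pXn2r ?nnegrE ?(ltW z0) ?(ltW zr) ?(ltW r20).
have h2 : (enorm y ^+ 2 <= (r / 2) ^+ 2)%R.
  by rewrite ler_pXn2r ?nnegrE ?enorm_ge0 ?(ltW r20)// ltW.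
by have := exprn_gt0 2 r0; move: h1 h2; rewrite exprMn; lra.
Qed.

(** In the cone where the first coordinate dominates, the norm is comparable to
that coordinate, so a radial lower bound is integrated in one variable only; the
slice at height [z] contributes a volume of order [z ^+ n]. *)
Lemma integral_cone_lower n : exists2 c : R, (0 < c)%R &
  forall (f : n.+1.-tuple R -> \bar R) (F : R -> R) (a b : R), (0 < a)%R ->
  (forall x, 0 <= f x) -> measurable_fun setT f -> measurable_fun setT F ->
  (forall z, (a <= z <= b)%R -> (0 <= F z)%R) ->
  (forall z y, (a <= z <= b)%R -> (enorm y < z)%R -> (F z)%:E <= f (tcons (z, y))) ->
  \int[mu]_(z in `[a, b]) (c * z ^+ n * F z)%:E <= \int[lebesgue_tuple n.+1]_x f x.
Proof.
have [c c0 cP] := eball_volume_lower n; exists c => //.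
move=> f F a b a0 f0 mf mF F0 Ff; rewrite ge0_integral_tupleS//.
have mft : measurable_fun setT (fun z : measurableTypeR R * n.-tuple R => f (tcons z)).
  exact: (measurableT_comp mf (@measurable_tcons R n)).
have ft0 (z : measurableTypeR R * n.-tuple R) : 0 <= f (tcons z) by [].
have mG : measurable_fun setT (fun z : measurableTypeR R => \int[lebesgue_tuple n]_x f (tcons (z, x))).
  exact: (measurable_fun_fubini_tonelli_F _ mft ft0).
have mI : measurable (`[a, b]%classic : set R) by exact: measurable_itv.
apply: (@le_trans _ _ (\int[mu]_(z in `[a, b]) (\int[lebesgue_tuple n]_x f (tcons (z, x))))); last first.
  apply: ge0_subset_integral => //.
  by move=> z _; exact: integral_ge0.
apply: ge0_le_integral => //.
- move=> z /=; rewrite in_itv/= => zab; rewrite lee_fin mulr_ge0 ?F0//.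
  by rewrite mulr_ge0 ?exprn_ge0 ?(ltW c0)//; case/andP: zab => /(lt_le_trans a0)/ltW.
- by apply: measurable_funTS; apply/measurable_EFinP/measurable_funM => //; apply: measurable_funM => //; exact: measurable_funX.
- exact: measurable_funTS.
move=> z /=; rewrite in_itv/= => zab.
have z0 : (0 < z)%R by case/andP: zab => /(lt_le_trans a0).
have mi : measurable_fun setT (fun y : n.-tuple R => (\1_(eball z) y)%:E : \bar R).
  by apply/measurable_EFinP/measurable_indic; exact: measurable_eball.
rewrite mulrC EFinM.
apply: (@le_trans _ _ ((F z)%:E * \int[lebesgue_tuple n]_y (\1_(@eball R n z) y)%:E)).
  by apply: lee_wpmul2l; [rewrite lee_fin F0|exact: cP].
rewrite -ge0_integralZl_EFin ?F0//.
apply: ge0_le_integral => //.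
- by move=> y _; rewrite mule_ge0 ?lee_fin ?F0.
- exact: emeasurable_funM.
- exact: (measurableT_comp mft (measurable_pair1 z)).
move=> y _; rewrite indicE; case: (boolP (y \in eball _)) => [/set_mem yz|_].
  by rewrite mule1 Ff.
by rewrite mule0.
Qed.

End radial.

(** * Nonexistence for large data *)

Section nonexistence.
Context {R : realType} {N : nat}.
Hypothesis N2 : (2 <= N)%N.
Notation mu := (@lebesgue_measure R).
Notation h2 := (N.-1%:R / 2 : R).

Let N0 : (0 < N)%N. Proof. exact: ltnW. Qed.

Let p_crit_h2 : p_crit N = 1 + (h2 + 1)^-1 :> R.
Proof.
rewrite /p_crit; congr (1 + _).
have -> : N.+1%:R = 2 * (h2 + 1) :> R.
  by rewrite -[in LHS](prednK N0) -[N.-1.+2]addn2 natrD; field.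
have h0 : 0 < h2 + 1 by rewrite ltr_wpDl ?divr_ge0.
by rewrite invfM mulrA divff ?mul1r.
Qed.

Lemma nonincreasing_powR (a x y : R) : a <= 0 -> 0 < x <= y -> y `^ a <= x `^ a.
Proof.
move=> a0 /andP[x0 xy]; have y0 := lt_le_trans x0 xy.
rewrite -[a]opprK !(powRN _ (- a)) lef_pV2 ?posrE ?powR_gt0//.
by apply: ge0_ler_powR; rewrite ?nnegrE ?oppr_ge0 ?(ltW x0) ?(ltW y0).
Qed.

Lemma integral_itv_ge (f : R -> R) (a b m : R) : a < b -> 0 <= m ->
  measurable_fun setT f -> (forall x, a < x < b -> m <= f x) ->
  ((m * (b - a))%:E <= \int[mu]_(x in `]a, b[) (f x)%:E)%E.
Proof.
move=> ab m0 mf mlef.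
have mI : measurable (`]a, b[%classic : set R) by exact: measurable_itv.
apply: (@le_trans _ _ (\int[mu]_(x in `]a, b[) (cst m%:E x))%E).
  by rewrite integral_cst//= lebesgue_measure_itv/= lte_fin ab -EFinB -EFinM.
apply: ge0_le_integral => //.
- by apply/measurable_EFinP; exact: measurable_funTS.
Qed.

Lemma subitv_integral_le (f : R -> R) (A : set R) (a b : R) :
  measurable A -> `]a, b[ `<=` A -> measurable_fun setT f -> (forall x, 0 <= f x) ->
  (\int[mu]_(x in `]a, b[) (f x)%:E <= \int[mu]_(x in A) (f x)%:E)%E.
Proof.
move=> mA sA mf f0; apply: ge0_subset_integral => //.
- by apply/measurable_EFinP; exact: measurable_funTS.
- by move=> x _; rewrite lee_fin.
Qed.

Lemma measurable_hmass_integrand (p t : R) : measurable_fun setT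
  (fun y => (if (enorm y <= Num.sqrt t)%R then @hdens R N p y else 0%R)%:E).
Proof.
apply/measurable_EFinP; apply: measurable_fun_ifT => //; last exact: measurable_hdens.
by apply: measurable_fun_ler => //; exact: measurable_enorm.
Qed.

(** The mass of [h] in the ball of radius [sqrt t] is of order [t `^ e], already on the
heights between [sqrt t / 4] and [sqrt t / 2]. The choice of [e] makes the exponent
[- q + p e] equal to [e - 1], and [e] is positive exactly above the critical exponent. *)
Lemma nonexistence_power (p : R) : p_crit N < p -> p < 2 ->
  exists2 kappa1 : R, 0 < kappa1 &
    forall k : {posnum R}, kappa1 <= k%:num ->
      ~ local_in_time_solvable p (boundary_datum N p k).
Proof.
move=> pc p2.
have h20 : 0 <= h2 by rewrite divr_ge0.
have h21 : 0 < h2 + 1 by rewrite ltr_wpDl.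
have p1 : 1 < p by apply: lt_trans pc; rewrite p_crit_h2 ltrDl invr_gt0.
have p0 := lt_trans ltr01 p1.
have p10 : 0 < p - 1 by rewrite subr_gt0.
have [e [eE e0]] : exists e : R, e = h2 + 1 - (p - 1)^-1 /\ 0 < e.
  eexists; split; first reflexivity.
  rewrite subr_gt0 -[ltRHS]invrK ltf_pV2 ?posrE ?invr_gt0//.
  by move: pc; rewrite p_crit_h2; lra.
have [g [gE g0]] : exists g : R, g = 2 - 2 / (p - 1) /\ g < 0.
  eexists; split; first reflexivity.
  by rewrite subr_lt0 ltr_pdivlMr//; lra.
have [c c0 cP] := @integral_cone_lower R N.-2.
apply: (@nonexistence_criterion R N N0 p 16^-1 (2 `^ (- e) / 2)
  (c * 4^-1 ^+ N.-1) (fun t => t `^ e)) => //.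
- by rewrite mulr_gt0 ?exprn_gt0.
- by move=> s /andP[s0 _]; rewrite powR_gt0.
- move=> t /andP[t0 t16].
  have r0 : 0 < Num.sqrt t by rewrite sqrtr_gt0.
  have E : t = Num.sqrt t ^+ 2 by rewrite sqr_sqrtr ?(ltW t0).
  have r1 : Num.sqrt t < 4^-1.
    rewrite -(@ltr_pXn2r _ 2) ?nnegrE ?sqrtr_ge0// -E.
    by rewrite (_ : 4^-1 ^+ 2 = 16^-1 :> R)//; field.
  set r := Num.sqrt t in E r0 r1.
  have gN : c * 4^-1 ^+ N.-1 * t `^ e = c * (r / 4) ^+ N.-2 * r `^ g * (r / 2 - r / 4).
    have -> : t `^ e = r ^+ N.-1 * r `^ g.
      rewrite E -powR_mulrn ?(ltW r0)// -powRrM -powR_mulrn ?(ltW r0)// powRD_gt0//.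
      by congr (_ `^ _); rewrite eE gE; field; rewrite gt_eqF.
    have -> : N.-1 = N.-2.+1 by case: N N2 => [|[]].
    by rewrite exprMn !exprS; field.
  rewrite gN; apply: (@le_trans _ _ (\int[mu]_(z in `](r / 4)%R, (r / 2)%R[) (c * z ^+ N.-2 * r `^ g)%:E)%E).
    apply: integral_itv_ge.
    + by lra.
    + by rewrite !mulr_ge0 ?powR_ge0 ?exprn_ge0 ?(ltW c0)// divr_ge0// ltW.
    + by apply: measurable_funM => //; apply: measurable_funM => //; exact: measurable_funX.
    + move=> z /andP[z1 z2]; rewrite ler_wpM2r ?powR_ge0// ler_wpM2l ?(ltW c0)//.
      by rewrite lerXn2r ?nnegrE ?(ltW z1)//; lra.
  apply: (@le_trans _ _ (\int[mu]_(z in `[(r / 4)%R, (r / 2)%R]) (c * z ^+ N.-2 * r `^ g)%:E)%E).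
    apply: ge0_subset_integral => //.
    + apply/measurable_EFinP; apply: measurable_funTS.
      by apply: measurable_funM => //; apply: measurable_funM => //; exact: measurable_funX.
    + move=> z /=; rewrite in_itv/= => /andP[z1 _]; rewrite lee_fin !mulr_ge0 ?powR_ge0 ?(ltW c0)//.
      by rewrite exprn_ge0//; lra.
    + by apply: subset_itv; rewrite bnd_simp.
  have N1E : N.-1 = N.-2.+1 by case: N N2 => [|[]].
  rewrite /hmass; move: (@measurable_hmass_integrand p t); rewrite -/r /hdens pc.
  move: (N.-2) N1E cP => m N1E cP; move: (N.-1) N1E => n ->.
  move=> mf; apply: (cP _ (fun=> r `^ g)) => //.
  + by rewrite divr_gt0.
  + by move=> y; rewrite lee_fin; case: ifP => // _; rewrite mulr_ge0 ?powR_ge0.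
  + by move=> z _; rewrite powR_ge0.
  + move=> z y /andP[z1 z2] yz.
    have z0 : 0 < z by lra.
    have /andP[w1 w2] := enorm_tcons_bounds z0 yz.
    have wr : enorm (tcons (z, y)) <= r by lra.
    rewrite wr lee_fin indicE mem_set ?mulr1; last by rewrite /eball/=; lra.
    by rewrite -gE; apply: nonincreasing_powR; [exact: ltW|rewrite wr andbT; lra].
- move=> t /andP[t0 t16].
  have mf : measurable_fun setT (fun s : R => s `^ (- ((p - 1) * (h2 + 1))) * (s `^ e) `^ p).
    apply: measurable_funM; first exact: measurable_powR.
    apply: (measurableT_comp (measurable_powR _)); exact: measurable_powR.
  apply: (@le_trans _ _ (\int[mu]_(s in `](t / 2)%R, t[)
      (s `^ (- ((p - 1) * (h2 + 1))) * (s `^ e) `^ p)%:E)%E); last first.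
    apply: subitv_integral_le => //.
    + by apply: subset_itv; rewrite bnd_simp//; lra.
    + by move=> s; rewrite mulr_ge0 ?powR_ge0.
  have -> : 2 `^ (- e) / 2 * t `^ e = (t / 2) `^ e * t^-1 * (t - t / 2).
    rewrite (@powRM _ t) ?(ltW t0) ?invr_ge0//.
    have -> : (2^-1 : R) `^ e = 2 `^ (- e) by rewrite -powR_inv1// -powRrM mulN1r.
    by field; rewrite gt_eqF.
  apply: integral_itv_ge => //.
  + by lra.
  + by rewrite mulr_ge0 ?powR_ge0 ?invr_ge0 ?(ltW t0).
  move=> s /andP[s1 s2]; have s0 : 0 < s by lra.
  rewrite -powRrM powRD_gt0// (_ : - ((p - 1) * (h2 + 1)) + e * p = e + -1)%R; last first.
    by rewrite eE; field; rewrite gt_eqF.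
  rewrite -powRD_gt0// powR_inv1 ?(ltW s0)//; apply: ler_pM.
  + exact: powR_ge0.
  + by rewrite invr_ge0 ltW.
  + by apply: ge0_ler_powR; rewrite ?nnegrE ?(ltW e0) ?(ltW s0) ?(ltW s1) ?divr_ge0 ?(ltW t0).
  + by rewrite lef_pV2 ?posrE ?(ltW s2).
Qed.

Let ln_scale (s : R) n : 0 < s -> ln (s ^+ n) = n%:R * ln s.
Proof. by move=> s0; rewrite lnXn// mulr_natl. Qed.

Lemma integral_inv_cst (m a b : R) : 0 <= m -> 0 < a -> a < b ->
  (\int[mu]_(x in `[a, b]) (m * x^-1)%:E = (m * (ln b - ln a))%:E)%E.
Proof.
move=> m0 a0 ab; under eq_integral do rewrite EFinM.
rewrite ge0_integralZl_EFin//.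
- by rewrite integral_inv_itv// EFinM.
- by move=> x /=; rewrite in_itv/= => /andP[/(lt_le_trans a0) x0 _]; rewrite lee_fin invr_ge0 ltW.
- by apply/measurable_EFinP/measurable_funTS; exact: measurable_inv.
Qed.

(** Here [q = 1] and both lower bounds are logarithmic: the mass of [h] is collected on
a range of heights that is long on the logarithmic scale, and so is the integral of
[s^-1 * (- ln s) `^ (- (p - 1)^-1 - 1)]. *)
Lemma nonexistence_critical (p : R) : p = p_crit N ->
  exists2 kappa1 : R, 0 < kappa1 &
    forall k : {posnum R}, kappa1 <= k%:num ->
      ~ local_in_time_solvable p (boundary_datum N p k).
Proof.
move=> pc.
have h20 : 0 <= h2 by rewrite divr_ge0.
have [g [gE g0]] : exists g : R, g = h2 + 1 /\ 0 < g.
  by eexists; split; first reflexivity; rewrite ltr_wpDl.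
have pE : p = 1 + g^-1 by rewrite pc p_crit_h2 gE.
have p1 : 1 < p by rewrite pE ltrDl invr_gt0.
have q1 : (p - 1) * (h2 + 1) = 1 by rewrite -gE pE addrC addKr mulVf// gt_eqF.
have gp : - g * p = - g - 1 by rewrite pE; field; rewrite gt_eqF.
have mL : measurable_fun setT (fun s : R => - ln s).
  by apply: measurableT_comp => //; exact: measurable_ln.
have [c c0 cP] := @integral_cone_lower R N.-2.
apply: (@nonexistence_criterion R N N0 p 16^-1 (3 `^ (- g - 1))
  (c * 2 `^ (- N%:R + 1) / 4) (fun t => (- ln t) `^ (- g))) => //.
- by rewrite !mulr_gt0 ?powR_gt0 ?invr_gt0.
- exact: (measurableT_comp (measurable_powR _) mL).
- move=> s /andP[s0 s1]; rewrite powR_gt0// oppr_gt0 ln_lt0// s0/=; lra.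
- move=> t /andP[t0 t16].
  (* heights from [t = s ^+ 4] to [s ^+ 3]: the latter is below [sqrt t / 2], and the
     logarithms of the endpoints differ by a quarter of [- ln t] *)
  have [s [sE s0]] : exists s : R, s = Num.sqrt (Num.sqrt t) /\ 0 < s.
    by eexists; split; first reflexivity; rewrite !sqrtr_gt0.
  have s2 : s ^+ 2 = Num.sqrt t by rewrite sE sqr_sqrtr ?sqrtr_ge0.
  have s4 : t = s ^+ 4 by rewrite (_ : 4 = 2 * 2)%N// exprM s2 sqr_sqrtr ?(ltW t0).
  have sh : s < 2^-1.
    rewrite -(@ltr_pXn2r _ 4) ?nnegrE ?(ltW s0)// -s4.
    by rewrite (_ : 2^-1 ^+ 4 = 16^-1 :> R)//; field.
  have L0 : 0 < - ln s by rewrite oppr_gt0 ln_lt0// s0/=; lra.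
  have tL : - ln t = 4 * - ln s by rewrite s4 ln_scale//; ring.
  have st : t < s ^+ 3 by rewrite s4 exprS gtr_pMl ?exprn_gt0//; lra.
  have s3 : 2 * s ^+ 3 <= Num.sqrt t.
    by rewrite -s2 exprS mulrA ler_piMl ?exprn_ge0 ?(ltW s0)//; lra.
  have r1 : Num.sqrt t < 4^-1.
    rewrite -s2 (_ : 4^-1 = 2^-1 ^+ 2 :> R); last by field.
    by rewrite ltr_pXn2r ?nnegrE ?(ltW s0).
  pose F (z : R) := (2 * z) `^ (- N%:R + 1) * (- ln t) `^ (- g - 1).
  have N1E : N.-1 = N.-2.+1 by case: N N2 => [|[]].
  have NE : - N%:R + 1 = - N.-1%:R :> R by rewrite -{1}(prednK N0) -natr1; ring.
  apply: (@le_trans _ _ (\int[mu]_(z in `[t, (s ^+ 3)%R]) (c * z ^+ N.-2 * F z)%:E)%E).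
    rewrite [leRHS](_ : _ = \int[mu]_(z in `[t, (s ^+ 3)%R])
        (c * 2 `^ (- N%:R + 1) * (- ln t) `^ (- g - 1) * z^-1)%:E)%E; last first.
      apply: eq_integral => z /set_mem/=; rewrite in_itv/= => /andP[/(lt_le_trans t0) z0 _].
      congr (_%:E); rewrite /F powRM ?(ltW z0)//.
      rewrite {2}NE N1E powRN powR_mulrn ?(ltW z0)// exprS.
      by field; rewrite !gt_eqF// exprn_gt0.
    rewrite integral_inv_cst//; last by rewrite !mulr_ge0 ?powR_ge0 ?(ltW c0).
    rewrite lee_fin ln_scale//; apply: eqW.
    have t1 : 0 < - ln t by rewrite tL mulr_gt0.
    have -> : (- ln t) `^ (- g) = (- ln t) `^ (- g - 1) * (- ln t).
      by rewrite -[X in _ = _ * X](powRr1 (ltW t1)) powRD_gt0// subrK.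
    have -> : ln s = ln t / 4 by have := tL; lra.
    by field.
  have N2' : N.+1%:R / 2 = g :> R.
    by rewrite gE -[in LHS](prednK N0) -[N.-1.+2]addn2 natrD; field.
  rewrite /hmass; move: (@measurable_hmass_integrand p t); rewrite /hdens pc ltxx N2'.
  have N10 : - N%:R + 1 <= 0 :> R by rewrite NE oppr_le0.
  rewrite /F; move: (- N%:R + 1 : R) N10 => a a0.
  move: (N.-2) N1E cP => m N1E cP; move: (N.-1) N1E => n ->.
  move=> mf; apply: (cP _ (fun z : R => (2 * z) `^ a * (- ln t) `^ (- g - 1))) => //.
  + by move=> y; rewrite lee_fin; case: ifP => // _; rewrite !mulr_ge0 ?powR_ge0.
  + apply: measurable_funM => //; apply: (measurableT_comp (measurable_powR _)).
    exact: measurable_funM.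
  + by move=> z _; rewrite mulr_ge0 ?powR_ge0.
  + move=> z y /andP[z1 z2] yz.
    have z0 : 0 < z by lra.
    have /andP[w1 w2] := enorm_tcons_bounds z0 yz.
    have w0 : 0 < enorm (tcons (z, y)) by lra.
    have wr : enorm (tcons (z, y)) <= Num.sqrt t by lra.
    rewrite wr lee_fin indicE mem_set ?mulr1; last by rewrite /eball/=; lra.
    apply: ler_pM; rewrite ?powR_ge0//.
    * by apply: nonincreasing_powR => //; rewrite w0.
    * apply: nonincreasing_powR; first lra.
      rewrite ler0_norm ?normr_gt0; last by rewrite ln_le0//; lra.
      by rewrite oppr_gt0 ln_lt0 ?w0/= ?lerN2 ?ler_ln ?posrE//; lra.
- move=> t /andP[t0 t16].
  have t1 : t < 1 by lra.
  have L0 : 0 < - ln t by rewrite oppr_gt0 ln_lt0// t0.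
  have t32 : t ^+ 3 < t ^+ 2 by rewrite exprS gtr_pMl ?exprn_gt0.
  have m0 : 0 <= (3 * - ln t) `^ (- g - 1) by exact: powR_ge0.
  have mf : measurable_fun setT (fun s : R => s `^ (- ((p - 1) * (h2 + 1))) * ((- ln s) `^ (- g)) `^ p).
    apply: measurable_funM; first exact: measurable_powR.
    apply: (measurableT_comp (measurable_powR _)).
    exact: (measurableT_comp (measurable_powR _) mL).
  (* on this interval [- ln s] is comparable to [- ln t], and its logarithmic length
     is [- ln t] *)
  have sub : `[(t ^+ 3)%R, (t ^+ 2)%R] `<=` (`]0%R, t[%classic : set R).
    apply: subset_itv; rewrite bnd_simp ?exprn_gt0// expr2 gtr_pMl//.
  apply: (@le_trans _ _ (\int[mu]_(s in `[(t ^+ 3)%R, (t ^+ 2)%R])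
      (s `^ (- ((p - 1) * (h2 + 1))) * ((- ln s) `^ (- g)) `^ p)%:E)%E); last first.
    apply: ge0_subset_integral => //.
    + by apply/measurable_EFinP; exact: measurable_funTS.
    + by move=> x _; rewrite lee_fin mulr_ge0 ?powR_ge0.
  apply: (@le_trans _ _ (\int[mu]_(s in `[(t ^+ 3)%R, (t ^+ 2)%R])
      ((3 * - ln t) `^ (- g - 1) * s^-1)%:E)%E).
    rewrite integral_inv_cst ?exprn_gt0// !ln_scale// lee_fin powRM ?(ltW L0)//.
    have -> : (- ln t) `^ (- g) = (- ln t) `^ (- g - 1) * (- ln t).
      by rewrite -[X in _ = _ * X](powRr1 (ltW L0)) powRD_gt0// subrK.
    by apply: eqW; ring.
  apply: ge0_le_integral => //.
  + move=> s /=; rewrite in_itv/= => /andP[/(lt_le_trans (exprn_gt0 3 t0)) s0 _].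
    by rewrite lee_fin mulr_ge0// invr_ge0 ltW.
  + apply/measurable_EFinP/measurable_funTS/measurable_funM => //; exact: measurable_inv.
  + by apply/measurable_EFinP; exact: measurable_funTS.
  move=> s /=; rewrite in_itv/= => /andP[s3 s2].
  have s0 : 0 < s by apply: lt_le_trans s3; rewrite exprn_gt0.
  have s1 : s < 1 by apply: (le_lt_trans s2); rewrite exprn_ilt1// ltW.
  rewrite lee_fin q1 powR_inv1 ?(ltW s0)// mulrC ler_wpM2l ?invr_ge0 ?(ltW s0)//.
  rewrite -powRrM gp; apply: nonincreasing_powR; first lra.
  rewrite oppr_gt0 ln_lt0 ?s0//= mulrN lerN2 -[3](mulr1n) -ln_scale// ler_ln ?posrE ?exprn_gt0//.
Qed.

End nonexistence.

(** * The threshold *)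

Theorem theorem5p8 (R : realType) (N : nat) (p : R)
    (hN : (2 <= N)%N) (hp1 : p_crit N <= p) (hp2 : p < 2) :
  exists kappa0 : R, 0 < kappa0 /\
    (forall kappa : {posnum R}, kappa%:num < kappa0 ->
       local_in_time_solvable p (boundary_datum N p kappa)) /\
    (forall kappa : {posnum R}, kappa0 < kappa%:num ->
       ~ local_in_time_solvable p (boundary_datum N p kappa)).
Proof.
have N0 : (0 < N)%N by exact: ltnW.
have p0 : 0 < p by apply: lt_le_trans hp1; rewrite /p_crit ltr_wpDr ?divr_ge0.
have [k0 k00 k0P] : exists2 k0 : R, 0 < k0 & forall k : {posnum R},
    k%:num <= k0 -> local_in_time_solvable p (boundary_datum N p k).
  move: hp1; rewrite le_eqVlt => /orP[/eqP/esym pc|pc].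
    exact: existence_critical.
  exact: existence_power.
have [k1 k10 k1P] : exists2 k1 : R, 0 < k1 & forall k : {posnum R},
    k1 <= k%:num -> ~ local_in_time_solvable p (boundary_datum N p k).
  move: hp1; rewrite le_eqVlt => /orP[/eqP/esym pc|pc].
    exact: nonexistence_critical.
  exact: nonexistence_power.
pose A : set R := [set x | exists2 k : {posnum R}, x = k%:num &
  local_in_time_solvable p (boundary_datum N p k)].
have Ak0 : A k0 by exists (PosNum k00) => //; exact: k0P.
have ubA : ubound A k1.
  by move=> _ [k -> sk]; rewrite leNgt; apply/negP => /ltW /k1P.
have supA : has_sup A by split; [exists k0|exists k1].
exists (sup A); split; [|split].
- by apply: (lt_le_trans k00); exact: sup_upper_bound.
- move=> k /(sup_gt (ex_intro _ k0 Ak0)) [_ [k' -> sk'] /ltW kk'].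
  exact: (solvable_le N0 p0 kk').
- move=> k; rewrite ltNge => /negP + sk; apply.
  by apply: sup_upper_bound => //; exists k.
Qed.
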